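(* Let $L\ge1$, let $\sigma\colon I_{\mathrm h}\to\{\pm\}$ be a map, $\lambda\colon\mathbb{Z}_{\mathrm h}\to\{\pm\}$ a map with $\lambda(h)=\pm\sigma(\pi(h))$ for $\pm h\gg0$, $\nu=(\nu_+,\nu_-)$ a pair of Young diagrams and $\theta\in\Theta$. Then $$\mathcal{Z}_{\sigma,\lambda,\nu,\theta}\big/\mathcal{Z}_{\sigma,\lambda,\vec\emptyset,\theta}=\mathcal{Z}^{\mathrm{NCDT}}_{\sigma,\lambda,\nu}\big/\mathcal{Z}^{\mathrm{NCDT}}_{\sigma,\lambda,\vec\emptyset},$$ where $\vec\emptyset=(\emptyset,\emptyset)$ and $\mathcal{Z}^{\mathrm{NCDT}}_{\sigma,\lambda,\nu}:=\mathcal{Z}_{\sigma,\lambda,\nu,\mathrm{id}}$.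
   Context: **Indices, Young diagrams.** $\mathbb{Z}_{\mathrm h}$ is the set of half-integers ($\mathbb Z+\frac12$), $I=\mathbb Z/L\mathbb Z$, $I_{\mathrm h}=\mathbb Z_{\mathrm h}/L\mathbb Z$, identified with $\{0,\dots,L-1\}$ and $\{\frac12,\dots,L-\frac12\}$; both projections are written $\pi$. For $h\in\mathbb Z_{\mathrm h}$ write $h=c(h)L+\pi(h)$, $c(h)\in\mathbb Z$. Signs $\pm$ are identified with $\pm1$; $\sigma(h):=\sigma(\pi(h))$. A Young diagram is a map $\eta\colon\mathbb Z\to\mathbb Z$ with $\eta(n)=|n|$ for $|n|\gg0$ and $\eta(n)-\eta(n-1)=\pm1$ for all $n$; the map $\mathbb Z_{\mathrm h}\to\{\pm1\}$, $h\mapsto\eta(h+\frac12)-\eta(h-\frac12)$, is also denoted $\eta$; $\emptyset$ is $n\mapsto|n|$. The integers $c_\lambda[j]$ and Young diagrams $\lambda^{[j]}$ ($j\in I_{\mathrm h}$) are determined by $\lambda(h)=\lambda^{[\pi(h)]}\bigl(\sigma(h)(c(h)-c_\lambda[\pi(h)]+\frac12)\bigr)$. **Roots and $\Theta$.** $P=\bigoplus_{i\in I}\mathbb Z\alpha_i$. For $h<h'$, $\alpha_{[h,h']}=\sum_{n=h+1/2}^{h'-1/2}\alpha_{\pi(n)}$, and $\alpha_{[h,h']}=-\alpha_{[h',h]}$ for $h>h'$. $\Lambda^{\mathrm{re},+}=\{\alpha_{[h,h']}\mid h<h',\,h\not\equiv h' \bmod L\}$. For $\alpha=\alpha_{[h,h']}\in\Lambda^{\mathrm{re},+}$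 put $j_-(\alpha)=\pi(h)$, $j_+(\alpha)=\pi(h')$, $B^{\alpha,\pm}_{\sigma,\lambda}=\{(h,h')\mid\alpha_{[h,h']}=\alpha,\ -\lambda(h)\sigma(h)=\lambda(h')\sigma(h')=\pm\}$. $\Theta$ is the set of bijections $\theta\colon\mathbb Z_{\mathrm h}\to\mathbb Z_{\mathrm h}$ with $\theta(h+L)=\theta(h)+L$ and $\sum_{h=1/2}^{L-1/2}\theta(h)=\sum_{h=1/2}^{L-1/2}h$. For $\alpha=\alpha_{[h,h']}\in\Lambda^{\mathrm{re},+}$, $\theta(\alpha)>0$ (resp. $<0$) means $\theta^{-1}(h)>\theta^{-1}(h')$ (resp. $<$). **Dimer model.** $\tilde\sigma=\sigma\circ\pi\circ\theta$, $\tilde\lambda=\lambda\circ\theta$. $H=\{n\in\mathbb Z\mid\tilde\sigma(n-\frac12)=\tilde\sigma(n+\frac12)\}$, $S=\mathbb Z\setminus H$; for $n\in H$, $\tilde\sigma(n):=\tilde\sigma(n\pm\frac12)$. Consider the planar graph with vertices: $v(n,m)$ at $(n,m)$ for $n\in S$, $n-m$ odd; $v_{\mathrm l}(n-\frac12,m)$ and $v_{\mathrm r}(n+\frac12,m)$ at $(n\mp\frac12,m)$ for $n\in H$, $n-m$ odd. Edges: $e_{\mathrm h}(n,m)$ ($n\in H$, $n-m$ odd) joins $v_{\mathrm l}(n-\frac12,m)$ and $v_{\mathrm r}(n+\frac12,m)$; $e_{\mathrm s}(h,k)$ ($h,k\in\mathbb Z_{\mathrm h}$) joins, if $h-k$ is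 even, [$v(h-\frac12,k+\frac12)$ or $v_{\mathrm r}(h,k+\frac12)$] with [$v(h+\frac12,k-\frac12)$ or $v_{\mathrm l}(h,k-\frac12)$], and, if $h-k$ is odd, [$v(h-\frac12,k-\frac12)$ or $v_{\mathrm r}(h,k-\frac12)$] with [$v(h+\frac12,k+\frac12)$ or $v_{\mathrm l}(h,k+\frac12)$] (in each bracket, the vertex that exists). $\mathcal V_\pm$ consists of the $v(n,m)$ with $\tilde\sigma(n+\frac12)=\pm$, the $v_{\mathrm l}(n-\frac12,m)$ with $\tilde\sigma(n)=\mp$ and the $v_{\mathrm r}(n+\frac12,m)$ with $\tilde\sigma(n)=\pm$; every edge joins $\mathcal V_+$ to $\mathcal V_-$. A perfect matching is a set of edges giving a bijection $\mathcal V_+\leftrightarrow\mathcal V_-$. $F\colon\mathbb Z\to\mathbb Z$ is given by $F(0)=0$, $F(n)=F(n-1)-\tilde\lambda(n-\frac12)$. For $k\in\mathbb Z_{\mathrm h}$, $\mathcal P^{k,\pm}=\{e_{\mathrm h}(n,F(n)+2k)\mid n\in H,\tilde\sigma(n)=\mp\}\sqcup\{e_{\mathrm s}(h,\frac12(F(h-\frac12)+F(h+\frac12))+2k)\mid\tilde\sigma(h)=\pm\}$; for a Young diagram $\eta$, $\mathcal P^\eta=\bigsqcup_{k}\mathcal P^{k,\eta(k)}$; $\mathcal P^\pm=\{e_{\mathrm h}(n,m)\mid\tilde\sigma(n)=\mp\}\sqcup\{e_{\mathrm s}(h,k)\mid\tilde\sigma(h)=\pm,\ h\tilde\lambda(h)-k\text{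 even}\}$. A dimer configuration of type $(\sigma,\lambda,\nu,\theta)$ is a perfect matching $D$ such that for some $m_1$ it coincides with $\mathcal P^{\nu_\pm}$ in $\{\pm x>m_1\}$, and for some $m_2$ with $\mathcal P^{\pm}$ in $\{|x|\le m_1,\ \pm y>m_2\}$. **Weights.** $q_+,q_-,q_1,\dots,q_{L-1}$ are formal variables, $Q_\pm=q_\pm^2q_1\cdots q_{L-1}$, $q_\pm^{(j)}=q_\pm q_1\cdots q_{j-1/2}$. Monomials $w_{\sigma,\lambda}(h)$ are determined by $w_{\sigma,\lambda}(h)=(Q_{\pm\sigma(h)})^{c(h)-c_\lambda[\pi(h)]}q_{\pm\sigma(h)}^{(\pi(h))}$ for $\pm h\gg0$, and $w_{\sigma,\lambda}(h)/w_{\sigma,\lambda}(h-L)=q_{\lambda(h)}q_{\lambda(h-L)}q_1\cdots q_{L-1}$. Edge weights: $w(e_{\mathrm h}(n,m))=1$; $w(e_{\mathrm s}(h,k))=w_{\sigma,\lambda}(\theta(h))^{\tilde\sigma(h)\tilde\lambda(h)}$ if $h\tilde\lambda(h)-k$ is odd and $1$ if even. $F^\theta_{\sigma,\lambda}=\prod_\alpha\prod_{(h,h')\in B^{\alpha,-}_{\sigma,\lambda}}w_{\sigma,\lambda}(h')/w_{\sigma,\lambda}(h)$ over $\alpha\in\Lambda^{\mathrm{re},+}$ with $\theta(\alpha)<0$ and $\sigma(j_-(\alpha))\ne\sigma(j_+(\alpha))$. The weight of $D$ is $w_{\sigma,\lambda,\theta}(D)=F^\theta_{\sigma,\lambda}\prod_{e\in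 D}w(e)$ (finitely many factors $\ne1$), and $\mathcal Z_{\sigma,\lambda,\nu,\theta}=\sum_Dw_{\sigma,\lambda,\theta}(D)$, the formal sum over all dimer configurations of type $(\sigma,\lambda,\nu,\theta)$. *)

(* Defs.v *)
From HB Require Import structures.
From mathcomp Require Import all_boot all_order all_algebra zify.
From mathcomp Require Import boolp classical_sets functions cardinality fsbigop.
Set Implicit Arguments.
Unset Strict Implicit.
Unset Printing Implicit Defensive.
Import Order.TTheory GRing.Theory Num.Theory.
Local Open Scope classical_set_scope.
Local Open Scope ring_scope.

(* Signs: [true] is + and [false] is -, so [~~] is the opposite and [==] the
   product; [sgn] is the identification with {+1, -1}. *)
Definition sign := bool.
Definition sgn (s : sign) : int := if s then 1 else -1.

(* Half-integers: the integer [a] stands for the half-integer a + 1/2.  All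
   formulas below go through the following conversions. *)
Definition halfint := int.
Definition below (h : halfint) : int := h.                 (* h - 1/2 *)
Definition above (h : halfint) : int := h + 1.             (* h + 1/2 *)
Definition dbl (h : halfint) : int := 2 * h + 1.           (* 2h *)
Definition hbelow (n : int) : halfint := n - 1.            (* n - 1/2 *)
Definition habove (n : int) : halfint := n.                (* n + 1/2 *)
Definition signed (s : sign) (h : halfint) : halfint :=   (* s h *)
  if s then h else - h - 1.

Definition oddz (n : int) : bool := ~~ (2 %| n)%Z.

Record young := Young {
  height :> int -> int;
  height_abs : exists N : int, forall n : int, N < `|n| -> height n = `|n|;
  height_step : forall n : int, height n - height (n - 1) = 1 \/
                          height n - height (n - 1) = -1 }.

Definition slope (eta : young) (h : halfint) : sign :=
  eta (above h) - eta (below h) == 1.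

Fact empty_abs : exists N : int, forall n : int, N < `|n| -> `|n| = `|n|.
Proof. by exists 0. Qed.

Fact empty_step (n : int) : `|n| - `|n - 1| = 1 \/ `|n| - `|n - 1| = -1.
Proof. lia. Qed.

Definition young0 : young := Young empty_abs empty_step.

Section Cyclic.
Variable l : nat.

(* I = Z/LZ and I_h = Z_h/LZ with L = l+1; r : 'I_L stands for r in I and for
   r + 1/2 in I_h. *)
Notation L := l.+1.

Definition proj (n : int) : 'I_L := inord `|(n %% L)%Z|%N.
Definition quo (h : halfint) : int := (h %/ L)%Z.

Variables (sigma : 'I_L -> sign) (lam : halfint -> sign).

Definition asymptotics : Prop := exists N : int, forall h : halfint,
  (N < h -> lam h = sigma (proj h)) /\ (h < - N -> lam h = ~~ sigma (proj h)).

Definition maya_decomposition (c : {ffun 'I_L -> int}) (eta : 'I_L -> young) :=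
  forall h : halfint,
    lam h = slope (eta (proj h))
              (signed (sigma (proj h)) (habove (quo h - c (proj h)))).

(* Determined by the decomposition: see [c_lamP] and [maya_unique]. *)
Definition c_lam : {ffun 'I_L -> int} :=
  xget 0 [set c | exists eta, maya_decomposition c eta].

(* Laurent monomials in q_+, q_-, q_1, ..., q_(L-1), written additively by
   their exponents: [inl s] indexes q_s and [inr i] indexes q_(i+1). *)
Definition var := (sign + 'I_l)%type.
Definition mono := {ffun var -> int}.

Definition qsg (s : sign) : mono := [ffun v => (v == inl s)%:R].
Definition qn (i : 'I_l) : mono := [ffun v => (v == inr i)%:R].
Definition Qsg (s : sign) : mono := qsg s *+ 2 + \sum_(i < l) qn i.
Definition qsgj (s : sign) (j : 'I_L) : mono :=
  qsg s + \sum_(i < l | (i < j)%N) qn i.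

Definition is_weight (w : halfint -> mono) : Prop :=
  (exists N : int, forall h : halfint,
     (N < h -> w h = Qsg (sigma (proj h)) *~ (quo h - c_lam (proj h))
                     + qsgj (sigma (proj h)) (proj h)) /\
     (h < - N -> w h = Qsg (~~ sigma (proj h)) *~ (quo h - c_lam (proj h))
                       + qsgj (~~ sigma (proj h)) (proj h))) /\
  (forall h : halfint,
     w h - w (h - L%:Z) =
     qsg (lam h) + qsg (lam (h - L%:Z)) + \sum_(i < l) qn i).

(* Determined by [is_weight]: see [wtP] and [weight_unique]. *)
Definition wt : halfint -> mono := xget (fun=> 0) [set w | is_weight w].

End Cyclic.

(* Formal series: integer-valued functions of the exponent vector, i.e. sums of
   Laurent monomials with no condition on the support. *)
Section Series.
Variable l : nat.
Definition series := mono l -> int.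

Definition sone : series := fun m => (m == 0)%:R.
Definition smul (f g : series) : series :=
  fun m => \sum_(a \in [set: mono l]) f a * g (m - a).

(* The degree of a monomial when the variable v is given degree d v. *)
Definition mdeg (d : {ffun var l -> int}) (m : mono l) : int :=
  \sum_v d v * m v.

(* The series with finitely many terms in degrees bounded above, for a fixed
   grading d.  They form an integral domain under [smul], all sums involved
   being finite. *)
Definition laurent (d : {ffun var l -> int}) (f : series) : Prop :=
  forall N : int, finite_set [set m | f m != 0 /\ mdeg d m <= N].

(* r = f / g, that is r = f g^-1 in the domain of d-Laurent series, for a
   grading d of the variables such that f and g belong to that domain and g is
   invertible in it.  No grading suits the partition functions of all theta at
   once, hence the existential quantifier. *)
Definition is_quotient (f g r : series) : Prop :=
  exists d : {ffun var l -> int}, [/\ laurent d f, laurent d g &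
    exists g' : series,
      [/\ laurent d g', smul g g' = sone & r = smul f g']].

End Series.

(* [Eh n m] is e_h(n,m) and [Es h k] is e_s(h,k). *)
Inductive edge := Eh of int & int | Es of halfint & halfint.
HB.instance Definition _ := gen_eqMixin edge.
HB.instance Definition _ := gen_choiceMixin edge.

(* [V n m] is v(n,m), [Vl h m] is v_l(h,m) and [Vr h m] is v_r(h,m). *)
Inductive vertex := V of int & int | Vl of halfint & int | Vr of halfint & int.

(* Doubled coordinates: e_h(n,m) lies over (n,m) and e_s(h,k) over (h,k), which
   is the middle of the edge up to the splitting of the columns of H. *)
Definition xpos (e : edge) : int :=
  match e with Eh n _ => 2 * n | Es h _ => dbl h end.
Definition ypos (e : edge) : int :=
  match e with Eh _ m => 2 * m | Es _ k => dbl k end.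

Record Theta (l : nat) := MkTheta {
  theta_fun :> halfint -> halfint;
  theta_bij : bijective theta_fun;
  theta_shift : forall h : halfint,
    theta_fun (h + l.+1%:Z) = theta_fun h + l.+1%:Z;
  theta_sum : \sum_(i < l.+1) dbl (theta_fun (i : nat)%:Z) =
              \sum_(i < l.+1) dbl (i : nat)%:Z }.

Definition theta_id (l : nat) : Theta l :=
  @MkTheta l id 
    (@Bijective _ _ id id (fun=> erefl) (fun=> erefl)) (fun=> erefl) erefl.

Section Roots.
Variable l : nat.
Notation L := l.+1.
Variables (sigma : 'I_L -> sign) (lam : halfint -> sign) (theta : Theta l).

Definition alpha (i : 'I_L) : {ffun 'I_L -> int} := [ffun j => (j == i)%:R].

Definition root_lt (h h' : halfint) : {ffun 'I_L -> int} :=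
  \sum_(0 <= i < `|(h' - h)%R|%N) alpha (proj l (above h + i%:Z)).
Definition root (h h' : halfint) : {ffun 'I_L -> int} :=
  if h <= h' then root_lt h h' else - root_lt h' h.

(* a = alpha_[h,h'] is in Lambda^(re,+); h and h' are determined by a up to a
   simultaneous translation by a multiple of L. *)
Definition real_pos (a : {ffun 'I_L -> int}) (h h' : halfint) : Prop :=
  [/\ h < h', proj l h != proj l h' & a = root h h'].

(* theta(a) < 0, with h = theta g and h' = theta g' *)
Definition theta_neg (a : {ffun 'I_L -> int}) : Prop :=
  exists g g' : halfint, real_pos a (theta g) (theta g') /\ g < g'.

(* sigma(j_-(a)) <> sigma(j_+(a)) *)
Definition sigma_odd (a : {ffun 'I_L -> int}) : Prop :=
  exists h h' : halfint,
    real_pos a h h' /\ sigma (proj l h) <> sigma (proj l h').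

Definition Bset (a : {ffun 'I_L -> int}) (s : sign) : set (halfint * halfint) :=
  [set p | [/\ root p.1 p.2 = a,
     - (sgn (lam p.1) * sgn (sigma (proj l p.1))) = sgn s &
     sgn (lam p.2) * sgn (sigma (proj l p.2)) = sgn s]].

Definition prefactor : mono l :=
  \sum_(a \in [set a | theta_neg a /\ sigma_odd a])
    \sum_(p \in Bset a false) (wt sigma lam p.2 - wt sigma lam p.1).

End Roots.

Section Dimers.
Variable l : nat.
Notation L := l.+1.
Variables (sigma : 'I_L -> sign) (lam : halfint -> sign) (theta : Theta l).

Definition tsigma (h : halfint) : sign := sigma (proj l (theta h)).
Definition tlam (h : halfint) : sign := lam (theta h).

Definition inH (n : int) : bool := tsigma (hbelow n) == tsigma (habove n).
Definition tsigmaH (n : int) : sign := tsigma (habove n).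

Definition is_vertex (v : vertex) : bool :=
  match v with
  | V n m => ~~ inH n && oddz (n - m)
  | Vl h m => inH (above h) && oddz (above h - m)
  | Vr h m => inH (below h) && oddz (below h - m)
  end.

Definition color (v : vertex) : sign :=
  match v with
  | V n _ => tsigma (habove n)
  | Vl h _ => ~~ tsigmaH (above h)
  | Vr h _ => tsigmaH (below h)
  end.

Definition Vset (s : sign) : set vertex := [set v | is_vertex v /\ color v = s].

Definition is_edge (e : edge) : bool :=
  match e with Eh n m => inH n && oddz (n - m) | Es _ _ => true end.

Definition left_end (e : edge) : vertex :=
  match e with
  | Eh n m => Vl (hbelow n) m
  | Es h k => let m := if oddz (h - k) then below k else above k in
              if inH (below h) then Vr h m else V (below h) m
  end.

Definition right_end (e : edge) : vertex :=
  match e with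
  | Eh n m => Vr (habove n) m
  | Es h k => let m := if oddz (h - k) then above k else below k in
              if inH (above h) then Vl h m else V (above h) m
  end.

Definition joined (D : set edge) (u v : vertex) : Prop :=
  exists2 e, D e & (left_end e = u /\ right_end e = v) \/
                   (left_end e = v /\ right_end e = u).

Definition perfect_matching (D : set edge) : Prop :=
  [/\ forall e, D e -> is_edge e,
      forall u, Vset true u -> exists! v, Vset false v /\ joined D u v &
      forall v, Vset false v -> exists! u, Vset true u /\ joined D u v].

Definition F (n : int) : int :=
  match n with
  | Posz k => - \sum_(0 <= i < k) sgn (tlam (habove i%:Z))
  | Negz k => \sum_(0 <= i < k.+1) sgn (tlam (hbelow (- i%:Z)))
  end.

Lemma F0 : F 0 = 0.
Proof. by change (F (Posz 0) = 0); rewrite /F big_geq ?oppr0. Qed.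

Lemma F_rec (n : int) : F n = F (n - 1) - sgn (tlam (hbelow n)).
Proof.
case: n => [[|k]|k].
- rewrite F0 (_ : Posz 0 - 1 = Negz 0) // /F.
  by rewrite big_nat1 oppr0 subrr.
- have -> : Posz k.+1 - 1 = Posz k by lia.
  have -> : hbelow k.+1 = habove k by rewrite /hbelow /habove; lia.
  by rewrite /F big_nat_recr //= opprD.
- have -> : Negz k - 1 = Negz k.+1 by lia.
  rewrite /F [in RHS]big_nat_recr //= NegzE.
  by rewrite addrK.
Qed.

(* P^{k,s}: the second coordinate of e_s is k' with 2k' = F + F + 4k. *)
Definition Pk (k : halfint) (s : sign) : set edge := [set e |
  match e with
  | Eh n m => [/\ inH n, tsigmaH n = ~~ s & m = F n + dbl k]
  | Es h k' => tsigma h = s /\ dbl k' = F (below h) + F (above h) + 2 * dbl k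
  end].

Definition Pyoung (eta : young) : set edge :=
  [set e | exists k, Pk k (slope eta k) e].

(* h tlam(h) - k is odd *)
Definition odd_edge (h k : halfint) : bool := oddz (signed (tlam h) h - k).

Definition Pinf (s : sign) : set edge := [set e | is_edge e /\
  match e with
  | Eh n _ => tsigmaH n = ~~ s
  | Es h k => tsigma h = s /\ ~~ odd_edge h k
  end].

(* nu = (nu_+, nu_-) *)
Definition dimer (nu : young * young) (D : set edge) : Prop :=
  perfect_matching D /\ exists m1 : int,
  [/\ forall e, 2 * m1 < xpos e -> (D e <-> Pyoung nu.1 e),
      forall e, 2 * m1 < - xpos e -> (D e <-> Pyoung nu.2 e) &
      exists m2 : int, forall e, `|xpos e| <= 2 * m1 ->
        (2 * m2 < ypos e -> (D e <-> Pinf true e)) /\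
        (2 * m2 < - ypos e -> (D e <-> Pinf false e))].

Definition edge_weight (e : edge) : mono l :=
  match e with
  | Eh _ _ => 0
  | Es h k => if odd_edge h k
              then wt sigma lam (theta h) *~ (sgn (tsigma h) * sgn (tlam h))
              else 0
  end.

Definition dimer_weight (D : set edge) : mono l :=
  prefactor sigma lam theta + \sum_(e \in D) edge_weight e.

Definition dimers_of_weight (nu : young * young) (m : mono l) : set (set edge) :=
  [set D | dimer nu D /\ dimer_weight D = m].

(* Needed for [Z] to be meaningful: \sum_(_ \in A) is 0 if A is infinite. *)
Definition summable (nu : young * young) : Prop :=
  forall m : mono l, finite_set (dimers_of_weight nu m).

Definition Z (nu : young * young) : series l :=
  fun m => \sum_(D \in dimers_of_weight nu m) (1 : int).

End Dimers.

Definition ZNCDT (l : nat) (sigma : 'I_l.+1 -> sign) (lam : halfint -> sign)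
  (nu : young * young) : series l := Z sigma lam (theta_id l) nu.

Lemma int_ind_from (m : int) (P : int -> Prop) :
  P m -> (forall n, m <= n -> P n -> P (n + 1)) -> forall n, m <= n -> P n.
Proof.
move=> Pm Ps n mn; have -> : n = m + `|(n - m)%R|%N by lia.
elim: `|(n - m)%R|%N => [|k IH]; first by rewrite addr0.
by rewrite -addn1 PoszD addrA; apply: Ps => //; lia.
Qed.

Lemma young_of_signs (f : halfint -> sign) (N : int) :
  (forall h : int, N < h -> f h = true) -> (forall h : int, h < - N -> f h = false) ->
  exists (t : int) (eta : young), forall h, f h = slope eta (h - t).
Proof.
move=> fp fm; pose M : int := `|N| + 1.
pose G (n : int) : int := if n <= - M then - n else
  M + \sum_(i < `|(n + M)%R|%N) sgn (f (- M + i%:Z)).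
have Gm (n : int) : n <= - M -> G n = - n by rewrite /G => ->.
have Gs (n : int) : G (n + 1) - G n = sgn (f n).
  rewrite /G; case: (leP (n + 1) (- M)) => h1.
    have -> : n <= - M by lia.
    by rewrite fm /sgn; lia.
  case: (leP n (- M)) => h2.
    have -> : n = - M by lia.
    have -> : `|(- M + 1 + M)%R|%N = 1%N by lia.
    by rewrite big_ord1 addr0; lia.
  have -> : `|(n + 1 + M)%R|%N = `|(n + M)%R|.+1 by lia.
  rewrite big_ord_recr /=.
  have -> : - M + `|(n + M)%R|%N = n by lia.
  by rewrite addrA [X in X - _]addrC addrK.
clearbody G.
have sgn2 s : sgn s = 1 \/ sgn s = -1 by case: s; [left|right].
have Gpar (n : int) : - M <= n -> exists k : int, G n = n + 2 * k.
  move: n; apply: int_ind_from; first by exists M; rewrite Gm; lia.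
  move=> n _ [k Gk]; have := Gs n; case: (sgn2 (f n)) => -> E.
    by exists k; lia.
  by exists (k - 1); lia.
have [k Gk] : exists k : int, G M = M + 2 * k by apply: Gpar; lia.
have Gp (n : int) : M <= n -> G n = n + 2 * k.
  move: n; apply: int_ind_from => // n Mn E.
  by have := Gs n; rewrite fp /sgn; lia.
pose e n := G (n - k) - k.
have ea : exists N0 : int, forall n : int, N0 < `|n| -> e n = `|n|.
  exists (M + `|k|) => n h; rewrite /e; case: (leP 0 n) => n0.
    by rewrite Gp; lia.
  by rewrite Gm; lia.
have es (n : int) : e n - e (n - 1) = 1 \/ e n - e (n - 1) = -1.
  have := Gs (n - k - 1); rewrite /e.
  have -> : n - k - 1 + 1 = n - k by lia.
  have -> : n - 1 - k = n - k - 1 by lia.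
  have R (a b c : int) : a - c - (b - c) = a - b by lia.
  by rewrite R; case: (sgn2 (f (n - k - 1))) => -> ->; [left|right].
exists (- k), (Young ea es) => h; rewrite /slope /above /below /= /e.
have := Gs h.
have -> : h - - k + 1 - k = h + 1 by lia.
have -> : h - - k - k = h by lia.
by case: (f h) => /= E; apply/esym; lia.
Qed.

Lemma slope_shift_inj (e1 e2 : young) (t : int) :
  (forall h, slope e1 h = slope e2 (h + t)) -> t = 0.
Proof.
move=> E.
have step (e : young) h : e (h + 1) - e h = sgn (slope e h).
  rewrite /slope /above /below; case: (height_step e (h + 1)); rewrite addrK => ->;
  by rewrite ?eqxx.
have D n m : m <= n -> e1 n - e2 (n + t) = e1 m - e2 (m + t).
  move: n; apply: int_ind_from => // n mn IH.
  have := step e1 n; have := step e2 (n + t); rewrite E.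
  have -> : n + t + 1 = n + 1 + t by lia.
  move=> s2 s1; rewrite -IH; apply/eqP; rewrite -subr_eq0.
  have R (a b c d : int) : a - b - (c - d) = (a - c) - (b - d) by lia.
  by rewrite R s1 s2 subrr.
have [N1 a1] := height_abs e1; have [N2 a2] := height_abs e2.
pose K := `|N1| + `|N2| + `|t| + 1.
have := D K (- K); rewrite !(a1, a2); lia.
Qed.

Section WellDefined.
Variable l : nat.
Notation L := l.+1.
Variables (sigma : 'I_L -> sign) (lam : halfint -> sign).

Lemma val_proj n : (proj l n : nat)%:Z = (n %% L)%Z.
Proof. by rewrite /proj inordK; have := modz_ge0 n (isT : L%:Z != 0);
 have := ltz_pmod n (isT : 0 < L%:Z); lia. Qed.

Lemma quo_proj n : n = quo l n * L%:Z + (proj l n : nat)%:Z.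
Proof. by rewrite val_proj; exact: divz_eq. Qed.

Lemma proj_at (c : int) (j : 'I_L) : proj l (c * L%:Z + (j : nat)%:Z) = j.
Proof.
have := val_proj (c * L%:Z + (j : nat)%:Z).
rewrite modzMDl modz_small; last by have := ltn_ord j; lia.
by case=> /val_inj.
Qed.

Lemma quo_at (c : int) (j : 'I_L) : quo l (c * L%:Z + (j : nat)%:Z) = c.
Proof.
rewrite /quo divzMDl // divz_small ?addr0 //; have := ltn_ord j; lia.
Qed.

Lemma maya_exists : asymptotics sigma lam ->
  exists c eta, maya_decomposition sigma lam c eta.
Proof.
move=> [N HN].
suff /choice [g Hg] : forall j : 'I_L, exists p : int * young, forall c,
    lam (c * L%:Z + (j : nat)%:Z) = slope p.2 (signed (sigma j) (c - p.1)).
  exists [ffun j => (g j).1], (fun j => (g j).2) => h.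
  by rewrite {1}(quo_proj h) Hg ffunE.
move=> j; have jL := ltn_ord j.
pose B : int := `|N| + 1.
have hi (c : int) : B < c -> lam (c * L%:Z + (j : nat)%:Z) = sigma j.
  move=> Bc; have [+ _] := HN (c * L%:Z + (j : nat)%:Z); rewrite proj_at; apply.
  by nia.
have lo (c : int) : c < - B -> lam (c * L%:Z + (j : nat)%:Z) = ~~ sigma j.
  move=> Bc; have [_] := HN (c * L%:Z + (j : nat)%:Z); rewrite proj_at; apply.
  by nia.
case: (sigma j) hi lo => hi lo.
  have [//|//|t [e E]] := @young_of_signs (fun c => lam (c * L%:Z + (j : nat)%:Z)) B.
  by exists (t, e).
have [h|h|t [e E]] := @young_of_signs (fun c => lam ((- c - 1) * L%:Z + (j : nat)%:Z)) (B + 1).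
- by move=> ?; apply: lo; lia.
- by move=> ?; apply: hi; lia.
exists (- t, e) => c /=.
have := E (- c - 1); have -> : - (- c - 1) - 1 = c by lia.
by move=> ->; congr slope; lia.
Qed.

Lemma maya_unique c1 e1 c2 e2 :
  maya_decomposition sigma lam c1 e1 -> maya_decomposition sigma lam c2 e2 ->
  c1 = c2.
Proof.
move=> H1 H2; apply/ffunP => j.
have E c : slope (e1 j) (signed (sigma j) (c - c1 j)) =
           slope (e2 j) (signed (sigma j) (c - c2 j)).
  by have := H1 (c * L%:Z + (j : nat)%:Z);
     rewrite H2 proj_at quo_at /habove => ->.
case: (sigma j) E => /= E.
  have : c1 j - c2 j = 0.
    apply: (@slope_shift_inj (e1 j) (e2 j)) => h.
    by have := E (h + c1 j); rewrite addrK addrA.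
  lia.
have : c2 j - c1 j = 0.
  apply: (@slope_shift_inj (e1 j) (e2 j)) => h.
  have := E (- h - 1 + c1 j).
  have -> : - (- h - 1 + c1 j - c1 j) - 1 = h by lia.
  by have -> : - (- h - 1 + c1 j - c2 j) - 1 = h + (c2 j - c1 j) by lia.
lia.
Qed.

Lemma c_lamP : asymptotics sigma lam ->
  exists eta, maya_decomposition sigma lam (c_lam sigma lam) eta.
Proof. by move/maya_exists; apply: xgetPex. Qed.


Lemma sum_qnE (P : pred 'I_l) (v : var l) :
  (\sum_(i < l | P i) qn i) v = if v is inr i then (P i)%:R else 0.
Proof.
rewrite sum_ffunE; case: v => [s|k]; first by rewrite big1 // => i _; rewrite ffunE.
rewrite (eq_bigr (fun i => (i == k)%:R)); last first.
  by move=> i _; rewrite ffunE eq_sym.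
case Pk : (P k).
  rewrite (bigD1 k) //= eqxx big1 ?addr0 // => i /andP[_ /negPf ->] //.
by rewrite big1 // => i Pi; case: (i =P k) Pi => [->|//]; rewrite Pk.
Qed.

Lemma mulrzE (m : mono l) (n : int) v : (m *~ n) v = n * m v.
Proof.
case: n => n; first by rewrite -pmulrn ffunMnE -mulr_natl natz.
by rewrite NegzE mulrNz ffunE -pmulrn ffunMnE -mulr_natl natz mulNr.
Qed.

Lemma QsgE s v (n : int) (j : 'I_L) : (Qsg l s *~ n + qsgj s j) v =
  match v with inl s' => (s' == s)%:R * (2 * n + 1)
             | inr i => n + (i < j)%N%:R end.
Proof.
rewrite ffunE mulrzE !ffunE !sum_qnE.
case: v => [s'|i] /=; last first.
  by lia.
by rewrite (_ : (inl s' == inl s) = (s' == s)) //; case: (s' == s) => /=; lia.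
Qed.

Lemma qstepE s1 s2 v : (qsg l s1 + qsg l s2 + \sum_(i < l) qn i) v =
  match v with inl s' => (s' == s1)%:R + (s' == s2)%:R | inr i => 1 end.
Proof. by rewrite ffunE sum_qnE !ffunE; case: v => [s'|i] //=; rewrite ?addr0. Qed.

Lemma quo_shift (h : int) : quo l (h - L%:Z) = quo l h - 1.
Proof. by have := quo_at (quo l h - 1) (proj l h); rewrite mulrBl mul1r addrAC -quo_proj. Qed.

Lemma proj_shift (h : int) : proj l (h - L%:Z) = proj l h.
Proof. by have := proj_at (quo l h - 1) (proj l h); rewrite mulrBl mul1r addrAC -quo_proj. Qed.

Lemma weight_exists : asymptotics sigma lam -> exists w, is_weight sigma lam w.
Proof.
move=> asy; have [eta Heta] := c_lamP asy; have [N HN] := asy.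
pose x (h : int) : int := quo l h - c_lam sigma lam (proj l h).
pose a (j : 'I_L) (n : int) : int := if sigma j then eta j n else - eta j (- n).
have aS h : a (proj l h) (x h) = a (proj l h) (x h - 1) + sgn (lam (h - L%:Z)).
  rewrite Heta proj_shift quo_shift /habove -/(x h) /a.
  have -> : quo l h - 1 - c_lam sigma lam (proj l h) = x h - 1 by rewrite /x; lia.
  move: (x h) (proj l h) => n j.
  case: (sigma j); rewrite /slope /above /below /=.
    rewrite subrK; case: (height_step (eta j) n) => E; rewrite E /=; lia.
  have -> : - (n - 1) - 1 = - n by lia.
  have := height_step (eta j) (- n + 1); rewrite addrK.
  have -> : - (n - 1) = - n + 1 by lia.
  by case=> E; rewrite E /=; lia.
exists (fun h => [ffun v : var l => match v with
  | inl s => x h + sgn s * a (proj l h) (x h) + (s == lam h)%:R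
  | inr i => x h + (i < proj l h)%N%:R end : int]).
split; last first.
  move=> h; apply/ffunP => v; rewrite qstepE !ffunE proj_shift.
  have -> : x (h - L%:Z) = x h - 1 by rewrite /x quo_shift proj_shift; lia.
  case: v => [s|i]; last by lia.
  rewrite aS; move: (a _ _) => A.
  by case: s; case: (lam h); case: (lam (h - L%:Z)) => /=; lia.
have [B HB] : exists B : int, forall j n, B < `|n| -> eta j n = `|n|.
  have /choice [b Hb] : forall j, exists N : int, forall n : int, N < `|n| -> eta j n = `|n|.
    by move=> j; exact: height_abs.
  exists (\sum_j `|b j|) => j n h; apply: Hb; apply: le_lt_trans h.
  rewrite (bigD1 j) //= (le_trans (ler_norm _)) // lerDl.
  by apply: sumr_ge0 => i _; exact: normr_ge0.
pose C := \sum_j `|c_lam sigma lam j|.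
have HC j : `|c_lam sigma lam j| <= C.
  by rewrite /C (bigD1 j) //= lerDl; apply: sumr_ge0 => i _; exact: normr_ge0.
pose K : int := `|B| + C + 2.
have C0 : 0 <= C by apply: sumr_ge0.
have big_x h : K * L%:Z < h -> B < x h /\ 0 < x h.
  move=> Kh; have := HC (proj l h); rewrite /x.
  have := quo_proj h; have := ltn_ord (proj l h) => jL.
  move: (c_lam _ _ _) (quo l h) (proj l h : nat) jL => c q j jL hq hc.
  have : K - 1 < q by nia.
  by rewrite /K; lia.
have small_x h : h < - (K * L%:Z) -> B < - x h /\ x h < 0.
  move=> Kh; have := HC (proj l h); rewrite /x.
  have := quo_proj h; have := ltn_ord (proj l h) => jL.
  move: (c_lam _ _ _) (quo l h) (proj l h : nat) jL => c q j jL hq hc.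
  have : q < - K + 1 by nia.
  by rewrite /K; lia.
exists (`|N| + K * L%:Z) => h.
have KL : 0 <= K * L%:Z by rewrite /K; nia.
split=> hh; apply/ffunP => v; rewrite QsgE ffunE -/(x h).
  have [Bx x0] : B < x h /\ 0 < x h by apply: big_x; lia.
  have -> : lam h = sigma (proj l h) by have [+ _] := HN h; apply; lia.
  case: v => [s|i //].
  have -> : a (proj l h) (x h) = sgn (sigma (proj l h)) * x h.
    rewrite /a; case: (sigma _); rewrite HB /= ?normrN; lia.
  by case: s; case: (sigma _) => /=; lia.
have [Bx x0] : B < - x h /\ x h < 0 by apply: small_x; lia.
have -> : lam h = ~~ sigma (proj l h) by have [_] := HN h; apply; lia.
case: v => [s|i //].
have -> : a (proj l h) (x h) = - (sgn (sigma (proj l h)) * x h).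
  rewrite /a; case: (sigma _); rewrite HB /= ?normrN; lia.
by case: s; case: (sigma _) => /=; lia.
Qed.

Lemma wtP : asymptotics sigma lam -> is_weight sigma lam (wt sigma lam).
Proof. by move/weight_exists; apply: xgetPex. Qed.

Lemma weight_unique w1 w2 :
  is_weight sigma lam w1 -> is_weight sigma lam w2 -> w1 = w2.
Proof.
move=> [[N1 a1] s1] [[N2 a2] s2]; apply/funext => h.
have stepE g : w1 g - w2 g = w1 (g - L%:Z) - w2 (g - L%:Z).
  have := s1 g; rewrite -(s2 g) => E; apply/eqP; rewrite subr_eq.
  by move/eqP: E; rewrite subr_eq => /eqP ->; rewrite addrAC -!addrA addrC !addrA.
have stepsE (k : nat) g : w1 g - w2 g = w1 (g - L%:Z * k%:Z) - w2 (g - L%:Z * k%:Z).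
  elim: k => [|k IH]; first by rewrite mulr0 subr0.
  rewrite IH stepE; have -> // : g - L%:Z * k%:Z - L%:Z = g - L%:Z * k.+1%:Z by lia.
apply/eqP; rewrite -subr_eq0 (stepsE (`|N1| + `|N2| + `|h| + 1)%N) subr_eq0; apply/eqP.
by rewrite (a1 _).2 ?(a2 _).2 //; nia.
Qed.

End WellDefined.

(* Main.v *)
Require Import Defs.
From HB Require Import structures.
From mathcomp Require Import all_boot all_order all_algebra zify ring.
From mathcomp Require Import boolp classical_sets functions cardinality fsbigop.

(** Read column by column, a dimer configuration is a sequence of Young diagrams
[K : int -> young], equal to nu_- far on the left and to nu_+ far on the right,
in which [K h] and [K (h + 1)] differ by a horizontal or a vertical strip
(according to [tsigma h]), which is removed if [tsigma h = tlam h] and added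
otherwise ([dimers_are_sequences]).  Each odd edge used in the column h is a box
of the strip, so the weight of the configuration is the product of the prefactor
and of w(theta h)^(|K h| - |K (h + 1)|) over all h.  Up to a monomial, the
partition function is thus a matrix coefficient, between nu_- and nu_+, of a
product of half vertex operators: one for each half-integer a = theta h, whose
type and weight depend on a alone, and multiplied in the order given by theta.

Half vertex operators commute up to scalars.  Here this is a family of weighted
bijections: two consecutive steps can be exchanged, at the cost of a factor
which does not depend on the two outer diagrams ([swap_same], [swap_anti]).
Sorting a finite word of steps so that the shrinking ones come first, one gets
that its paths from x to y are, up to a factor independent of x and y, the paths
of the sorted word; and for x = y = empty the sorted word has only one path.  So
the paths of the word from x to y are the pairs of a path of the sorted word
from x to y and a path of the word from the empty diagram to itself
([path_factor]).  The sorted word only depends on the set of steps: theta has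
disappeared from the first factor.

It remains to let the words become infinite.  For each theta there is a grading
of the variables in which w(theta g) has degree 2 g + C ([theta_graded]).  By
Abel summation the degree of a sequence is then, up to a constant, twice the
number of boxes of all its diagrams ([deg_total]), so that a bound on the degree
leaves finitely many sequences, and every coefficient is computed in a finite
window.  In the limit Z_nu = Z_vac R_nu ([series_factor]), where R_nu
([open_limit]) is a limit over the finite sets of half-integers and is therefore
the same series for all theta.  Finally the only vacuum configuration of least
degree has coefficient 1, so Z_vac is invertible among Laurent series for this
grading ([series_inverse]), and Z_nu / Z_vac = R_nu both for theta and for the
identity. *)

Set Implicit Arguments.
Unset Strict Implicit.
Unset Printing Implicit Defensive.
Import Order.TTheory GRing.Theory Num.Theory.
Local Open Scope ring_scope.

(** * Young diagrams: boxes and rows *)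
Section Diagrams.
Local Open Scope classical_set_scope.
Implicit Types (a b : int) (e f : young).

Lemma young_eq (e f : young) : (forall a, e a = f a) -> e = f.
Proof.
case: e f => [e ea es] [f fa fs] /= /funext E; subst f.
by rewrite (Prop_irrelevance ea fa) (Prop_irrelevance es fs).
Qed.

Lemma young_step (e : young) (a : int) : e (a + 1) = e a + 1 \/ e (a + 1) = e a - 1.
Proof. have := height_step e (a + 1); rewrite addrK; lia. Qed.

Lemma young_far (e : young) : exists N : nat, forall a : int, N%:Z <= `|a| -> e a = `|a|.
Proof.
by have [N h] := height_abs e; exists `|N|.+1%N => a ha; apply: h; lia.
Qed.

Fact transpose_abs (e : young) : exists N : int, forall a : int, N < `|a| -> e (- a) = `|a|.
Proof. by have [N h] := height_abs e; exists N => a ha; rewrite h ?normrN. Qed.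

Fact transpose_step (e : young) (a : int) :
  e (- a) - e (- (a - 1)) = 1 \/ e (- a) - e (- (a - 1)) = -1.
Proof.
have -> : - (a - 1) = - a + 1 by lia.
by case: (young_step e (- a)) => ->; lia.
Qed.

Definition transpose (e : young) : young := Young (transpose_abs e) (transpose_step e).

Lemma transposeK : involutive transpose.
Proof. by move=> e; apply: young_eq => a /=; rewrite opprK. Qed.

Lemma young_geN (e : young) (a : int) : - a <= e a.
Proof.
have [N h] := young_far e.
case: (leP (- N%:Z) a) => [|aN]; last by rewrite h; lia.
move: a; apply: int_ind_from; first by rewrite h; lia.
by move=> a _ ?; case: (young_step e a) => ->; lia.
Qed.

Lemma young_ge (e : young) (a : int) : `|a| <= e a.
Proof. have := young_geN e a; have := young_geN (transpose e) (- a); rewrite /= opprK; lia. Qed.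

Lemma young_parity (e : young) (a : int) : exists k : int, e a = a + 2 * k.
Proof.
have [N h] := young_far e.
case: (leP (- N%:Z) a) => [|aN]; last by exists (- a); rewrite h; lia.
move: a; apply: int_ind_from; first by exists N; rewrite h; lia.
move=> a _ [k ka]; case: (young_step e a) => ->; first by exists k; lia.
by exists (k - 1); lia.
Qed.

(** Also the number of rows i with [a < row e i - i]: every downward step to
the right of [a] brings the profile closer to the line of slope 1. *)
Definition gap (e : young) (a : int) : int := ((e a - a) %/ 2)%Z.

Lemma gapE (e : young) (a : int) : e a = a + 2 * gap e a.
Proof. by have [k E] := young_parity e a; rewrite /gap E addrAC subrr add0r mulKz. Qed.

Lemma gap_ge0 e a : 0 <= gap e a /\ - a <= gap e a.
Proof. by have := young_ge e a; rewrite gapE; lia. Qed.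

Lemma gap_step e a : gap e (a + 1) <= gap e a <= gap e (a + 1) + 1.
Proof.
have := gapE e a; have := gapE e (a + 1).
by case: (young_step e a) => ->; lia.
Qed.

Lemma gap_le e (a b : int) : a <= b -> gap e b <= gap e a.
Proof.
move: b; apply: int_ind_from => // b _; apply: le_trans; by case/andP: (gap_step e b).
Qed.

Lemma gap_far e : exists N : nat, forall a : int,
  (N%:Z <= a -> gap e a = 0) /\ (a <= - N%:Z -> gap e a = - a).
Proof.
by have [N h] := young_far e; exists N => a; have := gapE e a; have := h a; lia.
Qed.

(** The number of boxes on the diagonal of content [a]: the profile rises
by two units for each of them. *)
Definition excess e a : int := ((e a - `|a|) %/ 2)%Z.

Lemma excessE e a : e a = `|a| + 2 * excess e a.
Proof.
have -> : excess e a = gap e a - (if a < 0 then - a else 0).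
  rewrite /excess gapE; set x := (X in _ = X).
  have -> : a + 2 * gap e a - `|a| = 2 * x by rewrite /x; case: ifP; lia.
  by rewrite mulKz.
by rewrite gapE; case: ifP; lia.
Qed.

Lemma excess_gap e a : excess e a = gap e a - (if a < 0 then - a else 0).
Proof. by have := gapE e a; have := excessE e a; case: ifP; lia. Qed.

Lemma excess_ge0 e a : 0 <= excess e a.
Proof. by have := young_ge e a; rewrite excessE; lia. Qed.

Lemma excess_far e : exists N : nat, forall a : int, N%:Z <= `|a| -> excess e a = 0.
Proof.
by have [N h] := young_far e; exists N => a ha; have := excessE e a; rewrite h //; lia.
Qed.

Definition irange (N : nat) : seq int := [seq k%:Z - N%:Z | k <- iota 0 (2 * N).+1].

Arguments irange : simpl never.

Lemma mem_irange N a : (a \in irange N) = (`|a| <= N%:Z).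
Proof.
apply/mapP/idP => [[k]|h]; first by rewrite mem_iota => ? ->; lia.
by exists `|(a + N%:Z)%R|%N; rewrite ?mem_iota; lia.
Qed.

Lemma irange_uniq N : uniq (irange N).
Proof. by rewrite map_inj_uniq ?iota_uniq // => a b; lia. Qed.

Definition boxes (e : young) : int := \sum_(a \in [set: int]) excess e a.

Lemma fsum_irange (V : nmodType) (f : int -> V) (N : nat) :
  (forall a : int, N%:Z < `|a| -> f a = 0) ->
  \sum_(a \in [set: int]) f a = \sum_(a <- irange N) f a.
Proof.
move=> h; rewrite -(@fsbig_widen _ _ _ _ [set` irange N]) //; last first.
  move=> a /= [_ /negP]; rewrite mem_irange -ltNge => ?; exact: h.
by rewrite -fsbig_seq // irange_uniq.
Qed.

Lemma boxesE e (N : nat) : (forall a : int, N%:Z < `|a| -> excess e a = 0) ->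
  boxes e = \sum_(a <- irange N) excess e a.
Proof. exact: fsum_irange. Qed.

Lemma excess_far2 (e f : young) : exists N : nat, forall a : int, N%:Z <= `|a| ->
  excess e a = 0 /\ excess f a = 0.
Proof.
have [N h] := excess_far e; have [M k] := excess_far f.
by exists (maxn N M) => a ha; rewrite h ?k; lia.
Qed.

Lemma boxes_ge0 e : 0 <= boxes e.
Proof.
have [N h] := excess_far e; rewrite (@boxesE _ N); last by move=> a ?; apply: h; lia.
by apply: sumr_ge0 => a _; exact: excess_ge0.
Qed.

Lemma boxes0 : boxes young0 = 0.
Proof. by rewrite /boxes fsbig1 // => a _; rewrite /excess /= subrr. Qed.

Lemma boxes_transpose e : boxes (transpose e) = boxes e.
Proof.
rewrite /boxes (reindex_fsbigT (fun a : int => - a)); last first.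
  by exists -%R; apply: opprK.
by apply: eq_fsbigr => a _; rewrite /excess /= normrN opprK.
Qed.

Lemma boxes_diff (e f : young) : boxes f - boxes e = \sum_(a \in [set: int]) (excess f a - excess e a).
Proof.
have [N h] := excess_far2 e f.
rewrite (@boxesE e N); last by move=> a ha; case: (h a (ltW ha)).
rewrite (@boxesE f N); last by move=> a ha; case: (h a (ltW ha)).
rewrite (@fsum_irange _ _ N) ?sumrB // => a ha.
by case: (h a (ltW ha)) => -> ->.
Qed.

Lemma boxes_le e f : (forall a, e a <= f a) -> boxes e <= boxes f.
Proof.
move=> h; rewrite -subr_ge0 boxes_diff; apply: fsumr_ge0 => a _.
by have := h a; rewrite !excessE; lia.
Qed.

Lemma boxes_eq e f : (forall a, e a <= f a) -> boxes e = boxes f -> e = f.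
Proof.
move=> h E; have [N k] := excess_far2 e f; apply: young_eq => a.
case: (leP N%:Z `|a|) => aN; first by have [] := k a aN; rewrite !excessE => -> ->.
have : boxes f - boxes e = 0 by rewrite E subrr.
rewrite boxes_diff (@fsum_irange _ _ N) => [S|b bN]; last first.
  by have [-> ->] := k b (ltW bN).
have ge0 b : 0 <= excess f b - excess e b by have := h b; rewrite !excessE; lia.
have /eqP := S; rewrite big_seq psumr_eq0 // => /allP /(_ a).
by rewrite mem_irange => /(_ (ltW aN)); rewrite (ltW aN) /= !excessE; lia.
Qed.

Lemma boxes_eq0 e : boxes e = 0 -> e = young0.
Proof.
move=> E; symmetry; apply: boxes_eq; last by rewrite boxes0 E.
by move=> a; exact: young_ge.
Qed.

Fact row_ex e (i : nat) : exists j : nat, gap e (j%:Z - i%:Z) <= i%:Z.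
Proof.
have [N h] := gap_far e; exists (N + i)%N.
by rewrite (h _).1; lia.
Qed.

Definition row e i : nat := ex_minn (row_ex e i).

(** The downward steps of the profile are, from right to left, those that
start at [row e i - i - 1], for i = 0, 1, 2, and so on. *)
Lemma rowP e i a : (i%:Z < gap e a) = (a < (row e i)%:Z - i%:Z).
Proof.
rewrite /row; case: ex_minnP => m hm min_m.
have ha := gap_ge0 e a.
case: (ltP a (m%:Z - i%:Z)) => am; last by have := gap_le e am; lia.
case: (ltP a (- i%:Z)) => ai; first by lia.
apply/negP => /negP; rewrite -leNgt => gi.
have := min_m `|(a + i%:Z)%R|%N.
have -> : `|(a + i%:Z)%R|%N%:Z - i%:Z = a by lia.
by move=> /(_ gi); lia.
Qed.

Lemma row_noninc e i : (row e i.+1 <= row e i)%N.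
Proof.
apply: contraT; rewrite -ltnNge => h.
have := rowP e i.+1 ((row e i)%:Z - i.+1%:Z).
have := rowP e i ((row e i)%:Z - i.+1%:Z + 1).
have := gap_step e ((row e i)%:Z - i.+1%:Z).
lia.
Qed.

Lemma row_far e : exists N : nat, forall i, (N <= i)%N -> row e i = 0%N.
Proof.
have [N h] := gap_far e; exists N => i Ni.
have := rowP e i (- i%:Z); have [_ ->] := h (- i%:Z); lia.
Qed.

Lemma row_inj e f : (forall i, row e i = row f i) -> e = f.
Proof.
move=> E; apply: young_eq => a; rewrite !gapE; congr (_ + 2 * _).
have ge := gap_ge0 e a; have gf := gap_ge0 f a.
have := rowP e `|gap e a|%N a; have := rowP f `|gap e a|%N a.
have := rowP e `|gap f a|%N a; have := rowP f `|gap f a|%N a.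
by rewrite !E; lia.
Qed.

Section OfRows.
Variable r : nat -> nat.
Hypothesis r_noninc : forall i, (r i.+1 <= r i)%N.
Hypothesis r_far : exists N : nat, forall i, (N <= i)%N -> r i = 0%N.

Fact of_gap_ex a : exists i : nat, (r i)%:Z - i%:Z <= a.
Proof.
have [N h] := r_far; exists (N + `|a|)%N; rewrite h; lia.
Qed.

(** The profile with prescribed rows, through its numbers of downward steps. *)
Definition of_gap a : nat := ex_minn (of_gap_ex a).

Lemma of_gapP i a : (i < of_gap a)%N = (a < (r i)%:Z - i%:Z).
Proof.
rewrite /of_gap; case: ex_minnP => m hm min_m.
case: (ltnP i m) => im.
  by apply/esym/negP => /negP; rewrite -leNgt => /min_m; lia.
apply/esym/negP => h; move: hm; apply/negP; rewrite -ltNge.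
elim: i im h => [|i IH] im h; first by have -> : m = 0%N by lia.
case: (leqP m i) => [mi|mi]; last by have -> : m = i.+1 by lia.
by apply: IH => //; have := r_noninc i; lia.
Qed.

Fact of_rows_abs : exists N : int, forall a : int, N < `|a| -> a + 2 * (of_gap a)%:Z = `|a|.
Proof.
have [N h] := r_far; exists (N + r 0)%N%:Z => a ha.
case: (leP 0 a) => a0.
  by have := of_gapP 0 a; case: (of_gap a) => [|g]; lia.
have := of_gapP `|a|%N a; rewrite h; last by lia.
have := of_gapP `|a|.-1 a; rewrite h; lia.
Qed.

Fact of_rows_step a :
  a + 2 * (of_gap a)%:Z - (a - 1 + 2 * (of_gap (a - 1))%:Z) = 1 \/
  a + 2 * (of_gap a)%:Z - (a - 1 + 2 * (of_gap (a - 1))%:Z) = -1.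
Proof.
have h1 : (of_gap a <= of_gap (a - 1))%N.
  case E : (of_gap a) => [|g] //.
  by have := of_gapP g a; have := of_gapP g (a - 1); rewrite E; lia.
have h2 : (of_gap (a - 1) <= (of_gap a).+1)%N.
  case E : (of_gap (a - 1)) => [|[|g]] //.
  have := of_gapP g.+1 (a - 1); have := of_gapP g a; have := r_noninc g; rewrite E; lia.
lia.
Qed.

Definition of_rows : young := Young of_rows_abs of_rows_step.

Lemma gap_of_rows a : gap of_rows a = of_gap a.
Proof. by rewrite /gap /=; lia. Qed.

Lemma row_of_rows i : row of_rows i = r i.
Proof.
have H a : (a < (row of_rows i)%:Z - i%:Z) = (a < (r i)%:Z - i%:Z).
  by rewrite -rowP gap_of_rows -of_gapP; lia.
by have := H ((row of_rows i)%:Z - i%:Z); have := H ((r i)%:Z - i%:Z); lia.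
Qed.

End OfRows.

(** Counts the boxes by rows instead of by diagonals; the box of row i
and content a is recorded as [box i a]. *)
Lemma sum_rows e (N : nat) : (forall i, (N <= i)%N -> row e i = 0%N) ->
  boxes e = \sum_(i < N) (row e i)%:Z.
Proof.
move=> h0; have [N' h1] := excess_far e; have [N'' h2] := gap_far e.
have r0 i : (row e i <= row e 0)%N.
  by elim: i => // i IH; exact: leq_trans (row_noninc e i) IH.
pose M := (N + N' + N'' + row e 0)%N.
have -> : \sum_(i < N) (row e i)%:Z = \sum_(i < M) (row e i)%:Z.
  rewrite (big_ord_widen M (fun i => (row e i)%:Z)); last by rewrite /M; lia.
  rewrite [RHS](bigID (fun i : 'I_M => (i < N)%N)) /= [X in _ + X]big1 ?addr0 //.
  by move=> i; rewrite -leqNgt => /h0 ->.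
rewrite (@boxesE _ M); last by move=> a ha; apply: h1; rewrite /M in ha; lia.
pose box (i : nat) (a : int) := (0 <= i%:Z + a) && (i%:Z + a < (row e i)%:Z).
have gen_series (n : nat) (P : pred nat) : \sum_(i < n) (P i)%:R = (count P (iota 0 n))%:Z.
  elim: n => [|n IH]; first by rewrite big_ord0.
  have -> : iota 0 n.+1 = iota 0 n ++ iota n 1 by rewrite -iotaD addn1.
  by rewrite big_ord_recr /= IH count_cat /= addn0 PoszD; case: (P n).
rewrite (eq_big_seq (fun a => \sum_(i < M) (box i a)%:R)); last first.
  move=> a; rewrite mem_irange => aM.
  rewrite (gen_series M (fun i => box i a)).
  have gM : gap e a <= M.
    have [g0 ga] := gap_ge0 e a.
    case: (leP (- N''%:Z) a) => aN; last by rewrite (h2 a).2; lia.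
    have := gap_le e aN; rewrite (h2 (- N''%:Z)).2; rewrite /M; lia.
  have := gap_ge0 e a.
  pose lo : nat := if a < 0 then `|a|%N else 0%N.
  have loE : (if a < 0 then - a else 0) = lo%:Z by rewrite /lo; case: ifP; lia.
  rewrite excess_gap loE => ga.
  have -> : count (fun i => box i a) (iota 0 M) =
            count (fun i => (lo <= i < `|gap e a|)%N) (iota 0 M).
    apply: eq_count => i; rewrite /box; have := rowP e i a; rewrite /lo; case: ifP; lia.
  have -> : M = (lo + ((`|gap e a| - lo) + (M - `|gap e a|)))%N by rewrite /lo; case: ifP; lia.
  rewrite !iotaD !count_cat add0n.
  rewrite (@eq_in_count _ _ pred0 (iota 0 lo)) ?count_pred0; last first.
    by move=> i; rewrite mem_iota /=; lia.
  rewrite (@eq_in_count _ _ predT (iota lo _)) ?count_predT ?size_iota; last first.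
    by move=> i; rewrite mem_iota /=; lia.
  rewrite (@eq_in_count _ _ pred0 (iota _ (M - _))) ?count_pred0; last first.
    by move=> i; rewrite mem_iota /= => hi; apply/negP; lia.
  have : lo%:Z <= gap e a by rewrite -loE; case: ifP; lia.
  by rewrite /= !add0n addn0; lia.
rewrite exchange_big /=; apply: eq_bigr => i _.
pose f k := k%:Z - i%:Z.
rewrite (perm_big ([seq f k | k <- iota 0 (row e i)] ++
   [seq a <- irange M | ~~ box i a])).
  have E : \sum_(a <- [seq a <- irange M | ~~ box i a]) (box i a)%:R = 0 :> int.
    by rewrite big1_seq // => a; rewrite mem_filter => /andP[_ /andP[/negPf -> _]].
  rewrite big_cat E /= addr0.
  rewrite big_map (eq_big_seq (fun=> 1)).
    by rewrite big_const_seq count_predT size_iota iter_addr addr0 natz.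
  by move=> k; rewrite mem_iota /box /f => hk; have -> : (0 <= i%:Z + (k%:Z - i%:Z)) && (i%:Z + (k%:Z - i%:Z) < row e i) by lia.
apply: uniq_perm; rewrite ?irange_uniq //.
  have finj : injective f by move=> k k'; rewrite /f; lia.
  rewrite cat_uniq (map_inj_uniq finj) iota_uniq filter_uniq ?irange_uniq // andbT andTb.
  apply/hasPn => a; rewrite mem_filter => /andP[nb _]; apply/mapP => [[k]].
  by rewrite mem_iota => hk E; move: nb; rewrite E /box /f; lia.
move=> a; rewrite mem_cat mem_filter mem_irange.
case: (boolP (box i a)) => b /=.
  rewrite orbF; have := r0 i; have iM := ltn_ord i; move: b; rewrite /box => b ri.
  have -> : (`|a| <= M%:Z) by rewrite /M; lia.
  by apply/esym/mapP; exists `|(i%:Z + a)%R|%N; rewrite ?mem_iota /f; lia.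
case: (`|a| <= M%:Z); rewrite ?orbT //= orbF.
apply/esym/mapP => [[k]]; rewrite mem_iota => hk E; move: b; rewrite E /box /f; lia.
Qed.
End Diagrams.
Arguments irange : simpl never.

(** * Strips and weighted bijections *)
Section Strips.
Local Open Scope classical_set_scope.
Implicit Types (a b : int) (e f x y z : young).

(** For [s = true] the rows of e and f interlace (f / e is a horizontal
strip), for [s = false] each row grows by at most one box (a vertical strip):
see [strip_rowT] and [strip_rowF].  In terms of heights both conditions are
local and are exchanged by the reflection of the profile. *)
Definition strip (s : sign) e f : Prop :=
  forall a, e a <= f a /\ f a <= e (if s then a + 1 else a - 1) + 1.

(** A shifted comparison of two profiles is a comparison of their sets
of downward steps, hence of their rows. *)
Lemma gap_le_row e f (c : int) (k : nat) :
  (forall a, gap f a <= gap e (a + c) + k%:Z) <->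
  forall i, (row f (i + k))%:Z - (i + k)%N%:Z <= (row e i)%:Z - i%:Z - c.
Proof.
split=> [h i|h a].
  pose a := (row f (i + k))%:Z - (i + k)%N%:Z - 1.
  have := rowP f (i + k) a; have := rowP e i (a + c); have := h a; rewrite /a; lia.
have g0 := gap_ge0 e (a + c); pose i := `|gap e (a + c)|%N.
have := rowP f (i + k) a; have := rowP e i (a + c); have := h i; rewrite /i; lia.
Qed.

Lemma le_row e f : (forall a, e a <= f a) <-> forall i, (row e i <= row f i)%N.
Proof.
have [h1 h2] := gap_le_row f e 0 0; split=> h.
  move=> i; have := h1 _ i; rewrite addn0 => H.
  suff : (row e i)%:Z - i%:Z <= (row f i)%:Z - i%:Z - 0 by lia.
  by apply: H => a; have := h a; have := gapE e a; have := gapE f a; rewrite !addr0; lia.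
move=> a; have := h2 _ a; rewrite (gapE e a) (gapE f a) !addr0 => H.
suff : gap e a <= gap f a by lia.
by apply: H => i; have := h i; rewrite addn0; lia.
Qed.

Lemma strip_leE s e f : strip s e f -> forall a, e a <= f a.
Proof. by move=> h a; case: (h a). Qed.

Lemma strip_rowT e f : strip true e f <->
  forall i, (row e i <= row f i)%N /\ (row f i.+1 <= row e i)%N.
Proof.
have [h1 h2] := gap_le_row e f 1 1; split=> h.
  move=> i; split; first by move: i; apply/le_row/(strip_leE h).
  suff : (row f (i + 1))%:Z - (i + 1)%N%:Z <= (row e i)%:Z - i%:Z - 1.
    by rewrite addn1; lia.
  by apply: h1 => a; have [_] := h a; have := gapE f a; have := gapE e (a + 1); lia.
move=> a; split; first by move: a; apply/le_row => i; case: (h i).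
suff : gap f a <= gap e (a + 1) + 1%N%:Z.
  by have := gapE f a; have := gapE e (a + 1); lia.
by apply: h2 => i; have := h i; rewrite addn1; lia.
Qed.

Lemma strip_rowF e f : strip false e f <->
  forall i, (row e i <= row f i <= (row e i).+1)%N.
Proof.
have [h1 h2] := gap_le_row e f (- 1) 0; split=> h.
  move=> i; apply/andP; split; first by move: i; apply/le_row/(strip_leE h).
  suff : (row f (i + 0))%:Z - (i + 0)%N%:Z <= (row e i)%:Z - i%:Z - - 1.
    by rewrite addn0; lia.
  by apply: h1 => a; have [_] := h a; have := gapE f a; have := gapE e (a - 1); lia.
move=> a; split; first by move: a; apply/le_row => i; case/andP: (h i).
suff : gap f a <= gap e (a - 1) + 0%N%:Z.
  by have := gapE f a; have := gapE e (a - 1); lia.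
by apply: h2 => i; have := h i; rewrite addn0; lia.
Qed.

Lemma strip_transpose s e f : strip s (transpose e) (transpose f) <-> strip (~~ s) e f.
Proof.
suff H s' e' f' : strip s' e' f' -> strip (~~ s') (transpose e') (transpose f').
  by split=> /H; rewrite ?transposeK ?negbK.
move=> h a; have [h1 h2] := h (- a); split=> //=; move: h2.
by case: (s') => /=; [have -> : - (a - 1) = - a + 1 by lia|have -> : - (a + 1) = - a - 1 by lia].
Qed.

(** Weighted bijections: the identities between generating series below are
established before summation, so that no convergence is involved. *)
Definition wiso (V T U : Type) (f : T -> V) (g : U -> V) : Prop :=
  exists2 phi : T -> U, bijective phi & forall t, g (phi t) = f t.

Lemma wiso_refl V T (f : T -> V) : wiso f f.
Proof. by exists id => //; exists id. Qed.

Lemma wiso_sym V T U (f : T -> V) (g : U -> V) : wiso f g -> wiso g f.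
Proof.
move=> [phi [psi K1 K2] E]; exists psi; first by exists phi.
by move=> u; rewrite -E K2.
Qed.

Lemma wiso_trans V T U W (f : T -> V) (g : U -> V) (h : W -> V) :
  wiso f g -> wiso g h -> wiso f h.
Proof.
move=> [phi b1 E1] [psi b2 E2]; exists (psi \o phi); first exact: bij_comp.
by move=> t; rewrite /= E2 E1.
Qed.

Lemma wiso_comp V W T U (f : T -> V) (g : U -> V) (h : V -> W) :
  wiso f g -> wiso (h \o f) (h \o g).
Proof. by move=> [phi b E]; exists phi => // t; rewrite /= E. Qed.

Lemma sval_eq T (P : T -> Prop) (u v : {t | P t}) : sval u = sval v -> u = v.
Proof.
case: u v => [u pu] [v pv] /= E; subst v.
by rewrite (Prop_irrelevance pu pv).
Qed.

Lemma wiso_sig V T U (P : T -> Prop) (Q : U -> Prop) (f : T -> V) (g : U -> V)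
    (phi : T -> U) (psi : U -> T) :
  (forall t, P t -> [/\ Q (phi t), psi (phi t) = t & g (phi t) = f t]) ->
  (forall u, Q u -> P (psi u) /\ phi (psi u) = u) ->
  wiso (fun t : {t | P t} => f (sval t)) (fun u : {u | Q u} => g (sval u)).
Proof.
move=> h1 h2.
have h1Q t (p : P t) : Q (phi t) by have [] := h1 t p.
have h2P u (q : Q u) : P (psi u) by have [] := h2 u q.
exists (fun t => exist _ (phi (sval t)) (h1Q _ (svalP t))).
  exists (fun u => exist _ (psi (sval u)) (h2P _ (svalP u))).
    by move=> [t p]; apply: sval_eq => /=; have [] := h1 t p.
  by move=> [u q]; apply: sval_eq => /=; have [] := h2 u q.
by move=> [t p] /=; have [] := h1 t p.
Qed.

Definition is_rows (r : nat -> nat) : Prop :=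
  (forall i, (r i.+1 <= r i)%N) /\ exists N : nat, forall i, (N <= i)%N -> r i = 0%N.

(** Total, so that a bijection can be given by a formula for the rows
before its image is known to be a diagram. *)
Definition mkyoung (r : nat -> nat) : young :=
  if pselect (is_rows r) is left h then of_rows h.1 h.2 else young0.

Lemma row_mkyoung r : is_rows r -> forall i, row (mkyoung r) i = r i.
Proof. by rewrite /mkyoung; case: pselect => // h _ i; apply: row_of_rows. Qed.

Lemma mkyoung_row r e : (forall i, r i = row e i) -> mkyoung r = e.
Proof.
move=> E; apply: row_inj => i; rewrite row_mkyoung //.
by split=> [j|]; [rewrite !E row_noninc|have [N h] := row_far e; exists N => j /h; rewrite E].
Qed.

Lemma is_rows_box (lo hi r : nat -> nat) :
  (forall i, (hi i.+1 <= lo i)%N) -> (forall i, (lo i <= r i <= hi i)%N) ->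
  (exists N : nat, forall i, (N <= i)%N -> hi i = 0%N) -> is_rows r.
Proof.
move=> h1 h2 [N h3]; split=> [i|].
  by have := h1 i; have := h2 i; have := h2 i.+1; lia.
by exists N => i /h3; have := h2 i; lia.
Qed.

Lemma row_far2 e f : exists N : nat, forall i, (N <= i)%N -> row e i = 0%N /\ row f i = 0%N.
Proof.
have [N h] := row_far e; have [M k] := row_far f.
by exists (maxn N M) => i hi; rewrite h ?k; lia.
Qed.

Lemma row_far3 e f x : exists N : nat, forall i, (N <= i)%N ->
  [/\ row e i = 0%N, row f i = 0%N & row x i = 0%N].
Proof.
have [N h] := row_far2 e f; have [M k] := row_far x.
by exists (maxn N M) => i hi; case: (h i) => [|-> ->]; rewrite ?k //; lia.
Qed.

(** The intervals in which the rows of a diagram vary between two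
given ones have end points of the form max and min of the same pair of rows, and
max + min is the sum. *)
Lemma sum_bounds (u v : nat -> nat) (n : nat) :
  \sum_(i < n.+1) ((maxn (u i) (v i.+1))%:Z +
     (if (i : nat) is i'.+1 then minn (u i') (v i) else v 0%N)%:Z) + (minn (u n) (v n.+1))%:Z =
  \sum_(i < n.+1) (u i)%:Z + \sum_(i < n.+2) (v i)%:Z.
Proof.
elim: n => [|n IH]; first by rewrite !big_ord_recr !big_ord0 /=; lia.
rewrite big_ord_recr [X in _ = X + _]big_ord_recr [X in _ = _ + X]big_ord_recr /=.
have aux (A B C : int) (a b c d : nat) : A + (minn a b)%:Z = B + C ->
    A + ((maxn c d)%:Z + (minn a b)%:Z) + (minn c d)%:Z = B + c%:Z + (C + d%:Z) by lia.
exact: aux.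
Qed.

(** The rows of a diagram z between x and y range over intervals
independently of each other, so reflecting each row in its interval is an
involution; it exchanges |z| and |x| + |y| - |z|.  This is the commutation of two
half vertex operators of the same sign and kind. *)
Lemma swap_TT x y :
  wiso (fun z : {z | strip true x z /\ strip true z y} => boxes (sval z))
       (fun z : {z | strip true x z /\ strip true z y} => boxes x + boxes y - boxes (sval z)).
Proof.
pose lo i := maxn (row x i) (row y i.+1).
pose hi i := if i is i'.+1 then minn (row x i') (row y i) else row y 0.
have hilo i : (hi i.+1 <= lo i)%N by rewrite /hi /lo; lia.
have hifar : exists N : nat, forall i, (N <= i)%N -> hi i = 0%N.
  have [N h] := row_far y; exists N.+1 => [[//|i] hi']; rewrite /hi h; lia.
have inE z : (strip true x z /\ strip true z y) <->
    forall i, (lo i <= row z i <= hi i)%N.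
  rewrite !strip_rowT; split=> [[h1 h2] i|h].
    rewrite /lo /hi; case: i => [|i].
      by have := h1 0%N; have := h2 0%N; lia.
    by have := h1 i; have := h2 i; have := h1 i.+1; have := h2 i.+1; lia.
  split=> i; have := h i; have := h i.+1; rewrite /lo /hi; first by lia.
  by case: i => [|i]; lia.
pose phi z := mkyoung (fun i => lo i + hi i - row z i)%N.
have phiP z : (forall i, (lo i <= row z i <= hi i)%N) ->
    forall i, row (phi z) i = (lo i + hi i - row z i)%N.
  move=> h; apply: row_mkyoung; apply: (is_rows_box hilo) hifar => i.
  by have := h i; lia.
have phiK z : (forall i, (lo i <= row z i <= hi i)%N) -> phi (phi z) = z.
  by move=> h; apply: mkyoung_row => i; rewrite phiP //; have := h i; lia.
have phi_in z : (forall i, (lo i <= row z i <= hi i)%N) ->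
    forall i, (lo i <= row (phi z) i <= hi i)%N.
  by move=> h i; rewrite phiP //; have := h i; lia.
apply: (@wiso_sig _ _ _ _ _ boxes (fun z => boxes x + boxes y - boxes z) phi phi) => z /inE h; last first.
  by split; [apply/inE/phi_in|exact: phiK].
split; [by apply/inE/phi_in|exact: phiK|].
have [N hN] := row_far3 x y z; have [M hM] := row_far (phi z).
have hN' i : (N + M <= i)%N -> [/\ row x i = 0, row y i = 0, row z i = 0 & row (phi z) i = 0]%N.
  move=> hi'; have [|-> -> ->] := hN i; first by lia.
  by rewrite hM //; lia.
rewrite (@sum_rows x (N + M).+1); last by move=> i ?; case: (hN' i) => //; lia.
rewrite (@sum_rows y (N + M).+2); last by move=> i ?; case: (hN' i) => //; lia.
rewrite (@sum_rows z (N + M).+1); last by move=> i ?; case: (hN' i) => //; lia.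
rewrite (@sum_rows (phi z) (N + M).+1); last by move=> i ?; case: (hN' i) => //; lia.
rewrite -sum_bounds; have [-> _ _ _] := hN' (N + M)%N (leqnn _).
rewrite min0n addr0; apply/eqP; rewrite subr_eq eq_sym -big_split /=; apply/eqP.
by apply: eq_bigr => i _; rewrite phiP //; have := h i; rewrite /lo /hi; lia.
Qed.

(** All rows of z but the first range over the same intervals as
the rows of a diagram contained in x and y; the first one is only bounded below,
and what exceeds the bound is the additional integer.  This integer is the
geometric series in the commutation relation of two half vertex operators of
opposite signs. *)
Lemma swap_TT_anti x y :
  wiso (fun z : {z | strip true x z /\ strip true y z} => boxes (sval z))
       (fun p : {p : young * nat | strip true p.1 x /\ strip true p.1 y} =>
          boxes x + boxes y - boxes (sval p).1 + (sval p).2%:Z).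
Proof.
pose lo i := maxn (row x i.+1) (row y i.+1).
pose hi i := minn (row x i) (row y i).
have hilo i : (hi i.+1 <= lo i)%N by rewrite /hi /lo; lia.
have hifar : exists N : nat, forall i, (N <= i)%N -> hi i = 0%N.
  have [N h] := row_far y; exists N => i hi'; rewrite /hi h //; lia.
have inz z : (strip true x z /\ strip true y z) <->
    (maxn (row x 0) (row y 0) <= row z 0)%N /\ forall i, (lo i <= row z i.+1 <= hi i)%N.
  rewrite !strip_rowT /lo /hi; split=> [[h1 h2]|[h0 h]].
    split=> [|i]; first by have := h1 0%N; have := h2 0%N; lia.
    by have := h1 i; have := h2 i; have := h1 i.+1; have := h2 i.+1; lia.
  by split=> i; have := h i; case: i => [|i]; try have := h i; lia.
have inp z : (strip true z x /\ strip true z y) <-> forall i, (lo i <= row z i <= hi i)%N.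
  rewrite !strip_rowT /lo /hi; split=> [[h1 h2] i|h].
    by have := h1 i; have := h2 i; lia.
  by split=> i; have := h i; lia.
pose phi z := (mkyoung (fun i => lo i + hi i - row z i.+1)%N,
               (row z 0 - maxn (row x 0) (row y 0))%N).
pose psi (p : young * nat) := mkyoung (fun i => if i is i'.+1 then
   lo i' + hi i' - row p.1 i' else maxn (row x 0) (row y 0) + p.2)%N.
have phiP z : (forall i, (lo i <= row z i.+1 <= hi i)%N) ->
    forall i, row (phi z).1 i = (lo i + hi i - row z i.+1)%N.
  move=> h; apply: row_mkyoung; apply: (is_rows_box hilo) hifar => i.
  by have := h i; lia.
have psiP p : (forall i, (lo i <= row p.1 i <= hi i)%N) ->
    forall i, row (psi p) i = (if i is i'.+1 then
   lo i' + hi i' - row p.1 i' else maxn (row x 0) (row y 0) + p.2)%N.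
  move=> h; apply: row_mkyoung; split=> [[|i]|].
  - by have := h 0%N; rewrite /lo /hi; lia.
  - by have := h i; have := h i.+1; have := hilo i; lia.
  by have [N hN] := hifar; exists N.+1 => [[//|i] /hN]; have := h i; lia.
apply: (@wiso_sig _ _ _ _ _ boxes (fun p => boxes x + boxes y - boxes p.1 + p.2%:Z) phi psi); last first.
  move=> p /inp h; split.
    apply/inz; split=> [|i]; rewrite psiP //; first by lia.
    by have := h i; lia.
  have h' i : (lo i <= row (psi p) i.+1 <= hi i)%N by rewrite psiP //; have := h i; lia.
  rewrite [LHS]surjective_pairing [RHS]surjective_pairing; congr pair.
    by apply: mkyoung_row => i; rewrite psiP //; have := h i; lia.
  by rewrite /= psiP //; lia.
move=> z /inz [h0 h]; split; first by apply/inp => i; rewrite phiP //; have := h i; lia.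
  have h' i : (lo i <= row (phi z).1 i <= hi i)%N by rewrite phiP //; have := h i; lia.
  apply: mkyoung_row => [[|i]]; first by rewrite /=; lia.
  by rewrite phiP //; have := h i; lia.
have [N hN] := row_far3 x y z; have [M hM] := row_far (phi z).1.
have hN' i : (N + M <= i)%N -> [/\ row x i = 0, row y i = 0, row z i = 0 & row (phi z).1 i = 0]%N.
  move=> hi'; have [|-> -> ->] := hN i; first by lia.
  by rewrite hM //; lia.
rewrite (@sum_rows x (N + M).+1); last by move=> i ?; case: (hN' i) => //; lia.
rewrite (@sum_rows y (N + M).+1); last by move=> i ?; case: (hN' i) => //; lia.
rewrite (@sum_rows z (N + M).+1); last by move=> i ?; case: (hN' i) => //; lia.
rewrite (@sum_rows (phi z).1 (N + M)); last by move=> i ?; case: (hN' i) => //; lia.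
rewrite !(big_ord_recl (N + M)) /=.
have -> : \sum_(i < N + M) (row (mkyoung (fun i => lo i + hi i - row z i.+1)%N) i)%:Z =
   \sum_(i < N + M) ((lo i)%:Z + (hi i)%:Z - (row z i.+1)%:Z).
  by apply: eq_bigr => i _; rewrite (phiP _ h); have := h i; lia.
rewrite sumrB big_split /=.
have E n : \sum_(i < n) (lo i)%:Z + \sum_(i < n) (hi i)%:Z + (maxn (row x 0) (row y 0))%:Z
    + (minn (row x n) (row y n))%:Z =
  \sum_(i < n.+1) (row x i)%:Z + \sum_(i < n.+1) (row y i)%:Z.
  elim: n => [|n IH]; first by rewrite !big_ord_recr !big_ord0 /=; lia.
  move: IH; rewrite !big_ord_recr /= -/(lo n) -/(hi n).
  have aux (A B C D c' d' : int) (a b c d e : nat) : A + B + a%:Z + (minn b c)%:Z = C + c' + (D + d') ->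
    A + (maxn d e)%:Z + (B + (minn b c)%:Z) + a%:Z + (minn d e)%:Z = C + c' + d%:Z + (D + d' + e%:Z) by lia.
  exact: aux.
have := E (N + M)%N; have [-> _ _ _] := hN' (N + M)%N (leqnn _).
rewrite min0n addr0 !(big_ord_recl (N + M)) /=.
have aux (A B C D Z : int) (a b c d : nat) : (a <= b)%N -> A + B + a%:Z = c%:Z + C + (d%:Z + D) ->
  c%:Z + C + (d%:Z + D) - (A + B - Z) + (b - a)%N%:Z = b%:Z + Z by lia.
exact: aux.
Qed.
End Strips.

(** * Exchanging strips of different kinds *)
Section Mixed.
Implicit Types (a b : int) (e f x y z : young).

Lemma wiso_empty V T U (f : T -> V) (g : U -> V) :
  (T -> False) -> (U -> False) -> wiso f g.
Proof.
move=> nT nU; exists (fun t => False_rect U (nT t)); last by move=> t; case: (nT t).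
by exists (fun u => False_rect T (nU u)) => [t|u]; [case: (nT t)|case: (nU u)].
Qed.

Lemma wiso_prod V V' W T U T' U' (op : V -> V' -> W) (f : T -> V) (g : U -> V)
    (f' : T' -> V') (g' : U' -> V') : wiso f g -> wiso f' g' ->
  wiso (fun p => op (f p.1) (f' p.2)) (fun q => op (g q.1) (g' q.2)).
Proof.
move=> [phi [psi K1 K2] E] [phi' [psi' K1' K2'] E'].
exists (fun p => (phi p.1, phi' p.2)); last by move=> p; rewrite /= E E'.
exists (fun p => (psi p.1, psi' p.2)) => [[t t']|[u u']] /=; by rewrite ?K1 ?K1' ?K2 ?K2'.
Qed.

Section Bits.
Variable N : nat.

Definition in_ord (A : {set 'I_N}) (i : nat) : bool :=
  if insub i is Some j then j \in A else false.

Lemma in_ordE (A : {set 'I_N}) (j : 'I_N) : in_ord A j = (j \in A).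
Proof. by rewrite /in_ord valK. Qed.

Lemma in_ord_lt A i : in_ord A i -> (i < N)%N.
Proof. by rewrite /in_ord; case: insubP. Qed.

Lemma in_ord_ge A i : (N <= i)%N -> in_ord A i = false.
Proof. by move=> h; apply/negP => /in_ord_lt; rewrite ltnNge h. Qed.

(** Encodes diagrams by bits, bit i being free exactly when
[hi i && ~~ lo i].  The set of diagrams becomes a cube that only depends on the
number of free bits, so two families with as many free bits, at possibly
different places, are in weighted bijection. *)
Lemma bits_iso (lo hi : nat -> bool) (P : young -> Prop) (bit : young -> nat -> bool)
    (mk : (nat -> bool) -> young) (w : young -> int) (c : int) :
  (forall i, lo i -> hi i) -> (forall i, hi i -> (i < N)%N) ->
  (forall z, P z -> [/\ forall i, (lo i <= bit z i <= hi i)%N, mk (bit z) = z &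
                        w z = c + (\sum_(i < N) bit z i)%N%:Z]) ->
  (forall u : nat -> bool, (forall i, (lo i <= u i <= hi i)%N) ->
     P (mk u) /\ forall i, bit (mk u) i = u i) ->
  wiso (fun z : {z | P z} => w (sval z))
       (fun B : {set 'I_(\sum_(i < N) (hi i && ~~ lo i))%N} =>
          c + (\sum_(i < N) lo i)%N%:Z + #|B|%:Z).
Proof.
move=> lohi hiN h1 h2.
pose F := [set i : 'I_N | hi i && ~~ lo i].
have inF k : (k \in F) = hi k && ~~ lo k by rewrite inE.
have cardF : (\sum_(i < N) (hi i && ~~ lo i) = #|F|)%N.
  rewrite -sum1_card [RHS]big_mkcond /=; apply: eq_bigr => i _.
  by rewrite inF; case: (_ && _).
rewrite cardF.
pose dec (B : {set 'I_#|F|}) (i : nat) :=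
  lo i || in_ord [set enum_val j | j in B] i.
have decE B i : (lo i <= dec B i <= hi i)%N.
  rewrite /dec; case: (boolP (lo i)) => [/lohi ->//|_] /=.
  case: (ltnP i N) => iN; last by rewrite in_ord_ge.
  rewrite -[i]/(val (Ordinal iN)) in_ordE; case: imsetP => // [[j _ ->]].
  by have := enum_valP j; rewrite inF => /andP[->].
have P1 z (p : P z) := (h1 z p).
pose enc z : {set 'I_#|F|} := [set j : 'I_#|F| | bit z (@enum_val _ (mem F) j)].
have decK z : P z -> dec (enc z) = bit z.
  move=> p; have [b _ _] := h1 z p; apply/funext => i; have := b i; rewrite /dec.
  case: (ltnP i N) => iN; last first.
    by rewrite in_ord_ge // orbF; case: (hi i) (@hiN i) => [/(_ isT)|_]; [lia|case: (lo i); case: (bit z i)].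
  rewrite -[i]/(val (Ordinal iN)) in_ordE; move: (Ordinal iN) => k.
  case lok : (lo k) => /=; first by case: (bit z k).
  move=> bk; apply/imsetP/idP => [[j]|bz]; first by rewrite inE => ? ->.
  have kF : k \in F by rewrite inF lok andbT; move: bk; rewrite bz; case: (hi k).
  by exists (enum_rank_in kF k); rewrite ?inE enum_rankK_in.
pose phi (z : {z | P z}) := enc (sval z).
pose psi B : {z | P z} := exist _ (mk (dec B)) (h2 _ (decE B)).1.
exists phi.
  exists psi.
    move=> [z p]; apply: sval_eq; rewrite /= decK //; by have [] := h1 z p.
  move=> B; apply/setP => j; rewrite inE /= (h2 _ (decE B)).2 /dec.
  have := enum_valP j; rewrite inF => /andP[_ /negPf ->] /=.
  by rewrite in_ordE mem_imset //; exact: enum_val_inj.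
move=> [z p]; rewrite /phi /=; have [b _ ->] := h1 z p.
rewrite -addrA; congr (_ + _); rewrite -PoszD; congr Posz.
rewrite -[in RHS](decK z p) -(card_imset _ (@enum_val_inj _ (mem F))).
rewrite -sum1_card [X in (_ + X)%N]big_mkcond -big_split /=; apply: eq_bigr => i _.
rewrite /dec in_ordE; case loi : (lo i) => /=; last by case: ifP.
rewrite ifF //; apply/negP => /imsetP[j _ E].
by have := enum_valP j; rewrite -E inF loi andbF.
Qed.

End Bits.

Lemma wiso_setS (n : nat) :
  wiso (fun B : {set 'I_n.+1} => #|B|) (fun p : {set 'I_n} * bool => (#|p.1| + p.2)%N).
Proof.
pose phi (B : {set 'I_n.+1}) := ([set i | lift ord0 i \in B], ord0 \in B).
pose psi (p : {set 'I_n} * bool) : {set 'I_n.+1} :=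
  [set i | if unlift ord0 i is Some j then j \in p.1 else p.2].
exists phi.
  exists psi.
    move=> B; apply/setP => i; rewrite inE.
    by case: unliftP => [j ->|->] //=; rewrite inE.
  by move=> [B b]; congr pair; [apply/setP => i; rewrite !inE liftK|rewrite inE unlift_none].
move=> B; have -> : #|B| = (\sum_(i < n.+1) (i \in B))%N.
  by rewrite -sum1_card big_mkcond /=; apply: eq_bigr => i _; case: (i \in B).
have -> : #|(phi B).1| = (\sum_(i < n) (lift ord0 i \in B))%N.
  by rewrite -sum1_card big_mkcond /=; apply: eq_bigr => i _; rewrite inE; case: (_ \in B).
by rewrite big_ord_recl addnC.
Qed.

Lemma sum_sub (N : nat) (hi lo : nat -> bool) : (forall i, lo i -> hi i) ->
  (\sum_(i < N) (hi i && ~~ lo i) + \sum_(i < N) lo i = \sum_(i < N) hi i)%N.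
Proof.
move=> h; rewrite -big_split /=; apply: eq_bigr => i _.
by case: (lo i) (h i) => [/(_ isT) ->|_]; rewrite ?andbT ?addn0.
Qed.

(** On both sides z is given by one bit for each row, which tells
whether the row differs from that of x or of y.  The forced bits of one side
are those of the other side shifted by one row, so the numbers of free bits
agree. *)
Lemma swap_TF x y :
  wiso (fun z : {z | strip true x z /\ strip false z y} => boxes x + boxes y - boxes (sval z))
       (fun z : {z | strip false x z /\ strip true z y} => boxes (sval z)).
Proof.
(* Otherwise both sides are empty. *)
case: (pselect (forall i, (row x i <= row y i)%N /\ (row y i.+1 <= (row x i).+1)%N)); last first.
  move=> nf; apply: wiso_empty => [] [z [h1 h2]]; apply: nf => i.
    have := (strip_rowT x z).1 h1 i; have := (strip_rowF z y).1 h2 i.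
    by have := (strip_rowF z y).1 h2 i.+1; lia.
  have := (strip_rowF x z).1 h1 i; have := (strip_rowT z y).1 h2 i.
  by have := (strip_rowF x z).1 h1 i.+1; lia.
move=> feas; have [M hM] := row_far2 x y; pose N := M.+1.
have fN i : (M <= i)%N -> row x i = 0%N /\ row y i = 0%N by exact: hM.
pose hi i := (row x i < row y i)%N.
pose lo i := (row y i.+1 == (row x i).+1)%N.
pose lo' i := if i is j.+1 then lo j else false.
have hiN i : hi i -> (i < N)%N.
  by rewrite /hi; case: (ltnP i N) => // h; have [|-> ->] := fN i; lia.
have lohi i : lo i -> hi i by rewrite /lo /hi; have := row_noninc y i; lia.
have lohi' i : lo' i -> hi i.
  by case: i => // i; rewrite /lo' /lo /hi; have := row_noninc x i; lia.
have sumlo : (\sum_(i < N) lo' i = \sum_(i < N) lo i)%N.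
  have loM : lo M = false by rewrite /lo; have [|_ ->] := fN M.+1.
  by rewrite big_ord_recl [RHS]big_ord_recr /= loM add0n addn0.
have sumhl : (\sum_(i < N) (hi i && ~~ lo' i) = \sum_(i < N) (hi i && ~~ lo i))%N.
  by have := sum_sub N lohi; have := sum_sub N lohi'; rewrite sumlo; lia.
have szN z (h : forall i, (M <= i)%N -> row z i = 0%N) : boxes z = \sum_(i < M.+1) (row z i)%:Z.
  by apply: sum_rows => i ?; apply: h; lia.
have szx := szN x (fun i h => (fN i h).1).
have szy := szN y (fun i h => (fN i h).2).
have := @bits_iso N lo hi (fun z => strip false x z /\ strip true z y)
  (fun z i => row z i != row x i) (fun u => mkyoung (fun i => row x i + u i)%N) boxes (boxes x).
have := @bits_iso N lo' hi (fun z => strip true x z /\ strip false z y)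
  (fun z i => row z i != row y i) (fun u => mkyoung (fun i => row y i - u i)%N)
  (fun z => boxes x + boxes y - boxes z) (boxes x).
rewrite sumlo sumhl => iso1 iso2.
apply: wiso_trans (iso1 lohi' hiN _ _) _ => [z [/strip_rowT h1 /strip_rowF h2]|u hu|].
- split=> [i||].
  + have := h1 i; have := h2 i; rewrite /lo' /hi /lo; case: i => [|i] /=; first by lia.
    by have := h1 i; lia.
  + by apply: mkyoung_row => i; have := h2 i; lia.
  rewrite szx szy (szN z); last by move=> i /fN [_ E]; have := h2 i; rewrite E; lia.
  rewrite -addrA -sumrB; congr (_ + _); rewrite (big_morph Posz PoszD (erefl _)).
  apply: eq_bigr => i _; have E : row y i = (row z i + (row z i != row y i))%N.
    by have := h2 i; case: eqP => /=; lia.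
  by rewrite [in LHS]E PoszD addrAC subrr add0r.
- have ir : is_rows (fun i => row y i - u i)%N.
    split=> [i|]; last by exists M => i /fN [_ ->].
    have := hu i; have := hu i.+1; rewrite /lo' /hi /lo; have := feas i.
    have := row_noninc y i; have := row_noninc x i; lia.
  split; last by move=> i; rewrite row_mkyoung //; have := hu i; rewrite /hi; lia.
  split; [apply/strip_rowT|apply/strip_rowF] => i; rewrite !row_mkyoung //.
    have := hu i; have := hu i.+1; rewrite /lo' /hi /lo; have := feas i; lia.
  by have := hu i; rewrite /hi; lia.
apply/wiso_sym/iso2 => //.
- move=> z [/strip_rowF h1 /strip_rowT h2]; split=> [i||].
  + by have := h1 i; have := h2 i; rewrite /hi /lo; lia.
  + by apply: mkyoung_row => i; have := h1 i; lia.
  rewrite szx (szN z); last by move=> i /fN [E1 E2]; have := h2 i; rewrite E2; lia.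
  rewrite (big_morph Posz PoszD (erefl _)) -big_split /=.
  apply: eq_bigr => i _; have E : row z i = (row x i + (row z i != row x i))%N.
    by have := h1 i; case: eqP => /=; lia.
  by rewrite [in LHS]E PoszD.
- move=> u hu.
  have ir : is_rows (fun i => row x i + u i)%N.
    split=> [i|].
      have := hu i; have := hu i.+1; rewrite /hi /lo; have := feas i.
      have := row_noninc y i; have := row_noninc x i; lia.
    by exists N => i Ni; have := hu i; have := hiN i; have [|->] := fN i; lia.
  split; last by move=> i; rewrite row_mkyoung //; lia.
  split; [apply/strip_rowF|apply/strip_rowT] => i; rewrite !row_mkyoung //; first by lia.
  by have := hu i; rewrite /hi /lo; have := feas i; lia.
Qed.

(** As in [swap_TF], except that above x and y the bit of the first row is
never forced to vanish, which leaves one more free bit, the additional boolean: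
it is the factor 1 + t of the commutation relation for half vertex operators of
opposite signs and different kinds. *)
Lemma swap_TF_anti x y :
  wiso (fun z : {z | strip true x z /\ strip false y z} => boxes (sval z))
       (fun p : {p : young * bool | strip false p.1 x /\ strip true p.1 y} =>
          boxes x + boxes y - boxes (sval p).1 + ((sval p).2 : nat)%:Z).
Proof.
apply: (@wiso_trans _ _ ({z | strip false z x /\ strip true z y} * bool) _ _
   (fun p => boxes x + boxes y - boxes (sval p.1) + (p.2 : nat)%:Z)); last first.
  exists (fun p => exist (fun p => strip false p.1 x /\ strip true p.1 y)
            (sval p.1, p.2) (svalP p.1)) => //.
  exists (fun p => (exist (fun z => strip false z x /\ strip true z y) (sval p).1 (svalP p), (sval p).2)).
    by move=> [[z h] b]; congr pair; apply: sval_eq.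
  by move=> [[z b] h]; apply: sval_eq.
(* Otherwise both sides are empty. *)
case: (pselect (forall i, (row x i <= (row y i).+1)%N /\ (row y i.+1 <= row x i)%N)); last first.
  move=> nf; apply: wiso_empty => [[z [h1 h2]]|[[z [h1 h2]] _]]; apply: nf => i.
    have := (strip_rowT x z).1 h1 i; have := (strip_rowF y z).1 h2 i.
    by have := (strip_rowF y z).1 h2 i.+1; lia.
  have := (strip_rowF z x).1 h1 i; have := (strip_rowT z y).1 h2 i.
  by have := (strip_rowF z x).1 h1 i.+1; lia.
move=> feas; have [M fN] := row_far2 x y; pose N := M.+1.
pose lo i := (row x i == (row y i).+1)%N.
pose hi' i := (row y i.+1 < row x i)%N.
pose hi i := if i is j.+1 then (row y i < row x j)%N else true.
have hi'M i : hi' i -> (i < M)%N.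
  by rewrite /hi'; case: (ltnP i M) => // h; have [|-> _] := fN i; lia.
have hi'N i : hi' i -> (i < N)%N by move=> /hi'M; rewrite /N; lia.
have hiN i : hi i -> (i < N)%N.
  rewrite /N; case: i => [//|j]; rewrite /hi => h; rewrite ltnS ltnNge; apply/negP => Mj.
  by move: h; have [-> _] := fN j Mj.
have lohi' i : lo i -> hi' i by rewrite /lo /hi'; have := row_noninc y i; lia.
have lohi i : lo i -> hi i.
  by case: i => // i; rewrite /lo /hi; have := row_noninc x i; lia.
have sumhi : (\sum_(i < N) hi i = (\sum_(i < N) hi' i).+1)%N.
  have hi'0 : hi' M = false by apply/negP => /hi'M; rewrite ltnn.
  by rewrite big_ord_recl [in RHS]big_ord_recr /= hi'0 addn0 add1n.
have sumhl : (\sum_(i < N) (hi i && ~~ lo i) = (\sum_(i < N) (hi' i && ~~ lo i)).+1)%N.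
  by have := sum_sub N lohi; have := sum_sub N lohi'; rewrite sumhi; lia.
have szN z (h : forall i, (M <= i)%N -> row z i = 0%N) : boxes z = \sum_(i < M.+1) (row z i)%:Z.
  by apply: sum_rows => i ?; apply: h; lia.
have szN' z (h : forall i, (M < i)%N -> row z i = 0%N) : boxes z = \sum_(i < M.+1) (row z i)%:Z.
  exact: sum_rows.
have szx := szN x (fun i h => (fN i h).1).
have szy := szN y (fun i h => (fN i h).2).
have iso1 : wiso (fun z : {z | strip true x z /\ strip false y z} => boxes (sval z)) _ :=
  @bits_iso N lo hi (fun z => strip true x z /\ strip false y z)
  (fun z i => row z i != row y i) (fun u => mkyoung (fun i => row y i + u i)%N)
  boxes (boxes y) lohi hiN _ _.
have iso2 : wiso (fun z : {z | strip false z x /\ strip true z y} => boxes x + boxes y - boxes (sval z)) _ :=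
  @bits_iso N lo hi' (fun z => strip false z x /\ strip true z y)
  (fun z i => row z i != row x i) (fun u => mkyoung (fun i => row x i - u i)%N)
  (fun z => boxes x + boxes y - boxes z) (boxes y) lohi' hi'N _ _.
rewrite sumhl in iso1.
apply: wiso_trans (iso1 _ _) _ => [z [/strip_rowT h1 /strip_rowF h2]|u hu|].
- split=> [i||].
  + have := h1 i; have := h2 i; rewrite /hi /lo; case: i => [|i] /=; first by lia.
    by have := h1 i; lia.
  + by apply: mkyoung_row => i; have := h2 i; lia.
  rewrite szy (szN' z).
    rewrite (big_morph Posz PoszD (erefl _)) -big_split /=.
    apply: eq_bigr => i _; have E : row z i = (row y i + (row z i != row y i))%N.
      by have := h2 i; case: eqP => /=; lia.
    by rewrite [in LHS]E PoszD.
  by case=> // i Mi; have [_] := h1 i; have [-> _] := fN i Mi; lia.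
- have ir : is_rows (fun i => row y i + u i)%N.
    split=> [i|].
      have := hu i; have := hu i.+1; rewrite /hi /lo /=; have := feas i.
      have := row_noninc y i; have := row_noninc x i; lia.
    by exists N => i Ni; have := hu i; have := hiN i; have [_ ->] := fN i (ltnW Ni); lia.
  split; last by move=> i; rewrite row_mkyoung //; lia.
  split; [apply/strip_rowT|apply/strip_rowF] => i; rewrite !row_mkyoung //; last by lia.
  by have := hu i; have := hu i.+1; rewrite /hi /lo /=; have := feas i; lia.
(* Split off one free bit as the boolean. *)
apply: wiso_trans (wiso_comp (fun k : nat => boxes y + (\sum_(i < N) lo i)%N%:Z + k%:Z) (wiso_setS _)) _.
apply: wiso_trans _ (wiso_prod (fun (u : int) (v : bool) => u + (v : nat)%:Z) (wiso_sym (iso2 _ _)) (wiso_refl id)).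
- by exists id => [|p]; [exists id|rewrite /= PoszD addrA].
- move=> z [/strip_rowF h1 /strip_rowT h2]; split=> [i||].
  + by have := h1 i; have := h2 i; rewrite /hi' /lo; lia.
  + by apply: mkyoung_row => i; have := h1 i; lia.
  rewrite szx (szN z); last by move=> i /fN [E1 E2]; have := h1 i; rewrite E1; lia.
  rewrite addrAC addrC; congr (_ + _); rewrite (big_morph Posz PoszD (erefl _)) -sumrB.
  apply: eq_bigr => i _; have E : row x i = (row z i + (row z i != row x i))%N.
    by have := h1 i; case: eqP => /=; lia.
  by rewrite [in LHS]E PoszD addrAC subrr add0r.
- move=> u hu.
  have ir : is_rows (fun i => row x i - u i)%N.
    split=> [i|]; last by exists M => i /fN [-> _].
    have := hu i; have := hu i.+1; rewrite /hi' /lo; have := feas i; have := feas i.+1.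
    have := row_noninc y i; have := row_noninc x i; lia.
  split; last by move=> i; rewrite row_mkyoung //; have := hu i; rewrite /hi'; lia.
  split; [apply/strip_rowF|apply/strip_rowT] => i; rewrite !row_mkyoung //.
    by have := hu i; rewrite /hi'; lia.
  by have := hu i; rewrite /hi' /lo; have := feas i; lia.
Qed.
End Mixed.

(** * Paths of strips and the exchange of steps *)
Section Commutation.
Implicit Types (x y z : young) (s t : sign).

Lemma strip_transposeE s x z : strip s (transpose x) (transpose z) = strip (~~ s) x z.
Proof. by apply/propext; exact: strip_transpose. Qed.

Lemma strip_transposel s x z : strip s (transpose x) z = strip (~~ s) x (transpose z).
Proof. by rewrite -[in LHS](transposeK z) strip_transposeE. Qed.

Lemma strip_transposer s x z : strip s z (transpose x) = strip (~~ s) (transpose z) x.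
Proof. by rewrite -[in LHS](transposeK z) strip_transposeE. Qed.

Definition trans s t x y : Prop := if t then strip s y x else strip s x y.

Lemma wiso_eq V T U (f f' : T -> V) (g g' : U -> V) :
  wiso f g -> (forall u, f u = f' u) -> (forall u, g u = g' u) -> wiso f' g'.
Proof. by move=> [phi b E] E1 E2; exists phi => // u; rewrite -E1 -E2. Qed.

Lemma wiso_map (P Q : young -> Prop) (g : young -> young) (c c' : int)
    (X : Type) (v : X -> nat) : involutive g ->
  (forall z, P z <-> Q (g z)) -> (forall z, boxes (g z) = boxes z) -> c = c' ->
  wiso (fun p : {p : young * X | P p.1} => c - boxes (sval p).1 + (v (sval p).2)%:Z)
       (fun p : {p : young * X | Q p.1} => c' - boxes (sval p).1 + (v (sval p).2)%:Z).
Proof.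
move=> gK PQ E ->.
apply: (@wiso_sig _ _ _ (fun p : young * X => P p.1) (fun p => Q p.1)
  (fun p => c' - boxes p.1 + (v p.2)%:Z) (fun p => c' - boxes p.1 + (v p.2)%:Z)
  (fun p => (g p.1, p.2)) (fun p => (g p.1, p.2))).
  by move=> [z j] /= p; split; [apply/PQ|rewrite gK|rewrite E].
by move=> [z j] /= p; split; [apply/PQ; rewrite gK|rewrite gK].
Qed.

Lemma wiso_map1 V (P Q : young -> Prop) (g : young -> young) (f : young -> V) (f' : young -> V) :
  involutive g -> (forall z, P z <-> Q (g z)) -> (forall z, f' (g z) = f z) ->
  wiso (fun p : {p | P p} => f (sval p)) (fun p : {p | Q p} => f' (sval p)).
Proof.
move=> gK PQ E; apply: (@wiso_sig _ _ _ P Q f f' g g) => z p.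
  by split; [apply/PQ|rewrite gK|rewrite E].
by split; [apply/PQ; rewrite gK|rewrite gK].
Qed.

(** The case of two vertical strips is the transpose of that of two
horizontal strips. *)
Lemma swap_grow s1 s2 x y :
  wiso (fun z : {z | strip s1 x z /\ strip s2 z y} => boxes (sval z))
       (fun z : {z | strip s2 x z /\ strip s1 z y} => boxes x + boxes y - boxes (sval z)).
Proof.
have C u : boxes x + boxes y - (boxes x + boxes y - u) = u by rewrite opprB addrC subrK.
case: s1; case: s2.
- exact: swap_TT.
- have := wiso_comp (fun u => boxes x + boxes y - u) (swap_TF x y).
  by move/wiso_eq; apply => // z /=.
- exact/wiso_sym/swap_TF.
have H := swap_TT (transpose x) (transpose y).
apply: wiso_trans (wiso_trans _ H) _.
  apply: (wiso_map1 (g := transpose) (f' := boxes)) => [|z|z]; first exact: transposeK.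
    by rewrite !strip_transposeE.
  exact: boxes_transpose.
apply: (wiso_map1 (g := transpose) (f' := fun z => boxes x + boxes y - boxes z)
          (f := fun z => boxes (transpose x) + boxes (transpose y) - boxes z)) => [|z|z].
- exact: transposeK.
- by rewrite (strip_transposel _ x) (strip_transposer _ _ z).
- by rewrite !boxes_transpose.
Qed.

Lemma swap_same s1 s2 t x y :
  wiso (fun z : {z | trans s1 t x z /\ trans s2 t z y} => boxes (sval z))
       (fun z : {z | trans s2 t x z /\ trans s1 t z y} => boxes x + boxes y - boxes (sval z)).
Proof.
case: t => /=; last exact: swap_grow.
apply: wiso_trans (wiso_trans _ (swap_grow s2 s1 y x)) _.
  by apply: (wiso_map1 (g := id) (f := boxes) (f' := boxes)) => [//|z|//]; split=> -[? ?]; split.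
apply: (wiso_map1 (g := id) (f := fun z => boxes y + boxes x - boxes z)
   (f' := fun z => boxes x + boxes y - boxes z)) => [//|z|z]; first by split=> -[? ?]; split.
by rewrite [boxes x + _]addrC.
Qed.

(** The point is that X and v do not depend on x and y: they are the
scalar by which the two operators fail to commute. *)
Lemma swap_anti s1 s2 : exists (X : Type) (v : X -> nat), forall x y,
  wiso (fun z : {z | strip s1 x z /\ strip s2 y z} => boxes (sval z))
       (fun p : {p : young * X | strip s2 p.1 x /\ strip s1 p.1 y} =>
         boxes x + boxes y - boxes (sval p).1 + (v (sval p).2)%:Z).
Proof.
case: s1; case: s2.
- by exists nat, id => x y; exact: swap_TT_anti.
- by exists bool, nat_of_bool => x y; exact: swap_TF_anti.
- exists bool, nat_of_bool => x y.
  apply: wiso_trans (wiso_trans _ (swap_TF_anti y x)) _.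
    by apply: (wiso_map1 (g := id) (f := boxes) (f' := boxes)) => [//|z|//]; split=> -[? ?]; split.
  apply: (wiso_map (P := fun z => strip false z y /\ strip true z x)
    (Q := fun z => strip true z x /\ strip false z y) (g := id) nat_of_bool) => [//|z|//|]; last exact: addrC.
  by split=> -[? ?]; split.
exists nat, id => x y.
have H := swap_TT_anti (transpose x) (transpose y).
apply: wiso_trans (wiso_trans _ H) _.
  apply: (wiso_map1 (g := transpose) (f' := boxes)) => [|z|z]; first exact: transposeK.
    by rewrite !strip_transposeE.
  exact: boxes_transpose.
apply: (wiso_map (P := fun z => strip true z (transpose x) /\ strip true z (transpose y))
  (Q := fun z => strip false z x /\ strip false z y) (g := transpose) id) => [|z|z|].
- exact: transposeK.
- by rewrite (strip_transposer _ x) (strip_transposer _ y).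
- exact: boxes_transpose.
by rewrite !boxes_transpose.
Qed.

Section Paths.
Variable V : zmodType.

Record step := Step { kind : sign; shrinks : sign; weight : V }.
Implicit Types (o : step) (l r : seq step).

Definition steps o x y : Prop := trans (kind o) (shrinks o) x y.

(** Nested pairs rather than a list of diagrams with a property, so that two
consecutive steps can be exchanged inside fixed outer diagrams by
[wiso_sigma]. *)
Fixpoint path l x y : Type :=
  if l is o :: l' then {z : {z | steps o x z} & path l' (sval z) y} else {_ : unit | x = y}.

Fixpoint path_weight l x y : path l x y -> V :=
  match l return path l x y -> V with
  | [::] => fun=> 0
  | o :: l' => fun p => weight o *~ (boxes x - boxes (sval (projT1 p))) + path_weight (projT2 p)
  end.

(** Fiberwise bijections are glued by choice. *)
Lemma wiso_sigma A W (B B' : A -> Type) (f : forall a, B a -> W) (g : forall a, B' a -> W) :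
  (forall a, wiso (@f a) (@g a)) ->
  wiso (fun p : {a & B a} => f _ (projT2 p)) (fun p : {a & B' a} => g _ (projT2 p)).
Proof.
move=> h.
have h' a : exists phi : (B a -> B' a) * (B' a -> B a),
    [/\ cancel phi.1 phi.2, cancel phi.2 phi.1 & forall b, g a (phi.1 b) = f a b].
  by have [phi [psi K1 K2] E] := h a; exists (phi, psi).
pose F a := projT1 (cid (h' a)); have hF a := projT2 (cid (h' a)).
exists (fun p => existT B' (projT1 p) ((F _).1 (projT2 p))).
  exists (fun p => existT B (projT1 p) ((F _).2 (projT2 p))).
    by move=> [a b] /=; have [K _ _] := hF a; rewrite K.
  by move=> [a b] /=; have [_ K _] := hF a; rewrite K.
by move=> [a b] /=; have [_ _ ->] := hF a.
Qed.

Definition pequiv l l' : Prop := forall x y, wiso (@path_weight l x y) (@path_weight l' x y).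

(** The words l and l' are proportional as operators, with scalar the
generating series of [wY]. *)
Definition lequiv l l' (Y : Type) (wY : Y -> V) : Prop :=
  forall x y, wiso (@path_weight l x y) (fun p : path l' x y * Y => path_weight p.1 + wY p.2).

Lemma lequiv_trans l l' l'' Y wY Y' wY' : @lequiv l l' Y wY -> @lequiv l' l'' Y' wY' ->
  @lequiv l l'' (Y' * Y) (fun u => wY' u.1 + wY u.2).
Proof.
move=> h h' x y; apply: wiso_trans (h x y) _.
apply: wiso_trans (wiso_prod +%R (h' x y) (wiso_refl wY)) _.
exists (fun p => (p.1.1, (p.1.2, p.2))); last by move=> p; rewrite /= addrA.
by exists (fun p => ((p.1, p.2.1), p.2.2)) => [[[? ?] ?]|[? [? ?]]].
Qed.

Lemma pequiv_trans l l' l'' : pequiv l l' -> pequiv l' l'' -> pequiv l l''.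
Proof. by move=> h h' x y; apply: wiso_trans (h x y) (h' x y). Qed.

Lemma lequiv_cons o l l' Y wY : @lequiv l l' Y wY -> @lequiv (o :: l) (o :: l') Y wY.
Proof.
move=> h x y.
refine (wiso_trans (f := @path_weight (o :: l) x y) (@wiso_sigma {z | steps o x z} _
  (fun w => path l (sval w) y) (fun w => path l' (sval w) y * Y)%type
  (fun w p => weight o *~ (boxes x - boxes (sval w)) + path_weight p)
  (fun w p => weight o *~ (boxes x - boxes (sval w)) + path_weight p.1 + wY p.2) _) _).
  move=> z; have [phi b E] := h (sval z) y; exists phi => // p.
  by rewrite -E addrA.
exists (fun p : {z : {z | steps o x z} & (path l' (sval z) y * Y)%type} =>
  (existT (fun z : {z | steps o x z} => path l' (sval z) y) (projT1 p) (projT2 p).1, (projT2 p).2)) => //.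
by exists (fun p : path (o :: l') x y * Y => existT (fun z : {z | steps o x z} => path l' (sval z) y * Y)%type
  (projT1 p.1) (projT2 p.1, p.2)) => [[z [p u]]|[[z p] u]].
Qed.

Lemma pequiv_cons o l l' : pequiv l l' -> pequiv (o :: l) (o :: l').
Proof.
move=> h x y; apply: (@wiso_sigma {z | steps o x z} _ (fun w => path l (sval w) y) (fun w => path l' (sval w) y)
  (fun w p => weight o *~ (boxes x - boxes (sval w)) + path_weight p)
  (fun w p => weight o *~ (boxes x - boxes (sval w)) + path_weight p)) => z.
exact: (wiso_comp (fun u => weight o *~ (boxes x - boxes (sval z)) + u) (h _ y)).
Qed.

Definition and_l (P Q : Prop) (h : P /\ Q) : P := let: conj p _ := h in p.
Definition and_r (P Q : Prop) (h : P /\ Q) : Q := let: conj _ q := h in q.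

(** Groups the paths by the diagram reached after two steps, so
that the exchange happens in one fiber. *)
Lemma path_two_steps o o' l x y :
  wiso (@path_weight (o :: o' :: l) x y)
    (fun p : {z : young & ({u | steps o x u /\ steps o' u z} * path l z y)%type} =>
      weight o *~ (boxes x - boxes (sval (projT2 p).1)) +
      weight o' *~ (boxes (sval (projT2 p).1) - boxes (projT1 p)) + path_weight (projT2 p).2).
Proof.
exists (fun p : path (o :: o' :: l) x y =>
  existT (fun z => ({u | steps o x u /\ steps o' u z} * path l z y)%type)
    (sval (projT1 (projT2 p)))
    (exist (fun u => steps o x u /\ steps o' u (sval (projT1 (projT2 p)))) (sval (projT1 p))
      (conj (proj2_sig (projT1 p)) (proj2_sig (projT1 (projT2 p)))), projT2 (projT2 p))).
  exists (fun p : {z : young & ({u | steps o x u /\ steps o' u z} * path l z y)%type} =>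
    existT (fun u : {u | steps o x u} => path (o' :: l) (sval u) y)
     (exist (steps o x) (sval (projT2 p).1) (and_l (proj2_sig (projT2 p).1)))
     (existT (fun z : {z | steps o' (sval (projT2 p).1) z} => path l (sval z) y)
       (exist (steps o' (sval (projT2 p).1)) (projT1 p) (and_r (proj2_sig (projT2 p).1)))
       (projT2 p).2)).
    by case=> [[u hu] [[z hz] p]]; exact: erefl.
  by case=> [z [[u [h1 h2]] p]].
by case=> [[u hu] [[z hz] p]] /=; rewrite addrA.
Qed.

(** Exchanging the steps replaces a diagram of size c by one of size
a + b - c + n; the weight changes by (w' - w) n only. *)
Lemma swap_weight (w w' : V) (a b c n : int) :
  w *~ (a - (a + b - c + n)) + w' *~ (a + b - c + n - b) =
  w' *~ (a - c) + w *~ (c - b) + (w' - w) *~ n.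
Proof.
have -> : a - (a + b - c + n) = (c - b) - n by lia.
have -> : a + b - c + n - b = (a - c) + n by lia.
move: (c - b) (a - c) => A B.
rewrite mulrzBr mulrzDr mulrzBl addrC -!addrA; congr (_ + _).
by rewrite [LHS]addrCA.
Qed.

Lemma pequiv_swap o o' l : shrinks o = shrinks o' -> pequiv (o :: o' :: l) (o' :: o :: l).
Proof.
case: o o' => [k t w] [k' t' w'] /= E; subst t'.
set o := Step k t w; set o' := Step k' t w'.
move=> x y; apply: wiso_trans (path_two_steps o o' l x y) (wiso_trans _ (wiso_sym (path_two_steps o' o l x y))).
apply: (@wiso_sigma young _ (fun z => {u | steps o x u /\ steps o' u z} * path l z y)%type
  (fun z => {u | steps o' x u /\ steps o u z} * path l z y)%type
  (fun z p => w *~ (boxes x - boxes (sval p.1)) + w' *~ (boxes (sval p.1) - boxes z) + path_weight p.2)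
  (fun z p => w' *~ (boxes x - boxes (sval p.1)) + w *~ (boxes (sval p.1) - boxes z) + path_weight p.2)) => z.
apply: wiso_eq (wiso_prod (fun u v => w *~ (boxes x - u) + w' *~ (u - boxes z) + v)
  (swap_same k k' t x z) (wiso_refl (@path_weight l z y))) _ _ => // -[u p] /=.
move: (boxes (sval u)) => s; congr (_ + _).
have -> : boxes x - (boxes x + boxes z - s) = s - boxes z by lia.
have -> : boxes x + boxes z - s - boxes z = boxes x - s by lia.
by rewrite addrC.
Qed.

Lemma lequiv_swap o o' : shrinks o = false -> shrinks o' = true ->
  exists Y wY, forall l, @lequiv (o :: o' :: l) (o' :: o :: l) Y wY.
Proof.
case: o o' => [k t w] [k' t' w'] /= E E'; subst t t'.
set o := Step k false w; set o' := Step k' true w'.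
have [X [v H]] := swap_anti k k'.
pose wX j := (w' - w) *~ (v j)%:Z.
exists X, wX => l x y.
apply: wiso_trans (path_two_steps o o' l x y) _.
apply: wiso_trans _ (wiso_sym (wiso_prod +%R (path_two_steps o' o l x y) (wiso_refl wX))).
apply: wiso_trans (@wiso_sigma young _ (fun z => {u | steps o x u /\ steps o' u z} * path l z y)%type
  (fun z => {u : young * X | strip k' u.1 x /\ strip k u.1 z} * path l z y)%type
  (fun z p => w *~ (boxes x - boxes (sval p.1)) + w' *~ (boxes (sval p.1) - boxes z) + path_weight p.2)
  (fun z p => w' *~ (boxes x - boxes (sval p.1).1) + w *~ (boxes (sval p.1).1 - boxes z)
     + path_weight p.2 + wX (sval p.1).2) _) _.
  move=> z.
  apply: wiso_eq (wiso_prod (fun u v => w *~ (boxes x - u) + w' *~ (u - boxes z) + v)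
    (H x z) (wiso_refl (@path_weight l z y))) _ _ => // -[[[u j] ?] p] /=.
  rewrite [RHS]addrAC; congr (_ + _); exact: swap_weight.
exists (fun p : {z : young & ({u : young * X | strip k' u.1 x /\ strip k u.1 z} * path l z y)%type} =>
  (existT (fun z : young => ({u | steps o' x u /\ steps o u z} * path l z y)%type) (projT1 p)
     (exist (fun u => steps o' x u /\ steps o u (projT1 p)) (sval (projT2 p).1).1 (proj2_sig (projT2 p).1),
       (projT2 p).2), (sval (projT2 p).1).2)) => //.
exists (fun p => existT (fun z => {u : young * X | strip k' u.1 x /\ strip k u.1 z} * path l z y)%type
  (projT1 p.1) (exist (fun u : young * X => strip k' u.1 x /\ strip k u.1 (projT1 p.1))
     (sval (projT2 p.1).1, p.2) (proj2_sig (projT2 p.1).1), (projT2 p.1).2)).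
  by case=> [z [[[u j] h] p]].
by case=> [[z [[u h] p]] j].
Qed.

Lemma lequiv_refl l : @lequiv l l unit (fun=> 0).
Proof.
move=> x y; exists (fun p => (p, tt)); last by move=> p; rewrite /= addr0.
by exists fst => // -[p []].
Qed.

(** One scalar of [lequiv_swap] arises for each shrinking step that o passes. *)
Lemma lequiv_bubble o l r : shrinks o = false -> all shrinks l ->
  exists Y wY, @lequiv (o :: l ++ r) (l ++ o :: r) Y wY.
Proof.
move=> so; elim: l => [|o' l IH] /= => [_|/andP[so' /IH [Y [wY H]]]].
  by exists unit, (fun=> 0); exact: lequiv_refl.
have [Y' [wY' H']] := lequiv_swap so so'.
by exists (Y * Y')%type, (fun u => wY u.1 + wY' u.2); exact: lequiv_trans (H' _) (lequiv_cons o' H).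
Qed.

Definition shrink_first l : seq step := filter shrinks l ++ filter (predC shrinks) l.

(** Insertion sort. *)
Lemma lequiv_sort l : exists Y wY, @lequiv l (shrink_first l) Y wY.
Proof.
elim: l => [|o l [Y [wY H]]]; first by exists unit, (fun=> 0); exact: lequiv_refl.
have Ho := lequiv_cons o H; rewrite /shrink_first /=; case: ifP => so /=.
  by exists Y, wY.
have [|Y' [wY' H']] := @lequiv_bubble o (filter shrinks l) (filter (predC shrinks) l) so.
  exact: filter_all.
by exists (Y' * Y)%type, (fun u => wY' u.1 + wY u.2); exact: lequiv_trans Ho H'.
Qed.

Lemma pequiv_refl l : pequiv l l.
Proof. by move=> x y; exact: wiso_refl. Qed.

Lemma pequiv_cat l r r' : pequiv r r' -> pequiv (l ++ r) (l ++ r').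
Proof. by move=> h; elim: l => [//|o l IH] /=; exact: pequiv_cons. Qed.

Lemma pequiv_bubble o l r : all (fun o' => shrinks o' == shrinks o) l ->
  pequiv (o :: l ++ r) (l ++ o :: r).
Proof.
elim: l => [_|o' l IH] /=; first exact: pequiv_refl.
move=> /andP[/eqP so' /IH h]; apply: pequiv_trans (pequiv_swap _ _) (pequiv_cons o' h).
by rewrite so'.
Qed.

End Paths.
End Commutation.

(** * Laurent series and generating series *)
Section FormalSeries.
Local Open Scope classical_set_scope.
Section Series.
Variable l : nat.
Notation M := (mono l).
Implicit Types (m a b c : M) (f g h : series l) (d : {ffun var l -> int}) (N : int).

Lemma mdegD d m a : mdeg d (m + a) = mdeg d m + mdeg d a.
Proof. by rewrite /mdeg -big_split /=; apply: eq_bigr => v _; rewrite ffunE mulrDr. Qed.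

Lemma mdegN d m : mdeg d (- m) = - mdeg d m.
Proof. by rewrite /mdeg -sumrN; apply: eq_bigr => v _; rewrite ffunE mulrN. Qed.

Lemma mdegB d m a : mdeg d (m - a) = mdeg d m - mdeg d a.
Proof. by rewrite mdegD mdegN. Qed.

Lemma mdeg0 d : mdeg d 0 = 0.
Proof. by rewrite /mdeg big1 // => v _; rewrite ffunE mulr0. Qed.

Lemma mdegZ d m (n : int) : mdeg d (m *~ n) = n * mdeg d m.
Proof. by rewrite /mdeg mulr_sumr; apply: eq_bigr => v _; rewrite mulrzE mulrCA. Qed.

Lemma fsum_seq (T : choiceType) (V : nmodType) (P : set T) (F : T -> V) (r : seq T) : uniq r ->
  (forall x, P x -> F x != 0 -> x \in r) -> (forall x, x \in r -> ~ P x -> F x = 0) ->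
  \sum_(x \in P) F x = \sum_(x <- r) F x.
Proof.
move=> ur h h'; rewrite [RHS]fsbig_seq // [LHS]fsbig_mkcond [RHS]fsbig_mkcond.
apply: eq_fsbigr => x _; rewrite /patch; case: ifPn => [|nP]; case: ifPn => [|nr] //.
- by move: nr; rewrite notin_setE /= => /negP nr /set_mem Px; apply/eqP; apply: contraNT nr => /h; apply.
- by move/set_mem => /= xr; rewrite h' // => Px; move: nP; rewrite notin_setE.
Qed.

Lemma fsumT_seq (T : choiceType) (V : nmodType) (F : T -> V) (r : seq T) : uniq r ->
  (forall x, F x != 0 -> x \in r) -> \sum_(x \in [set: T]) F x = \sum_(x <- r) F x.
Proof. by move=> ur h; apply: fsum_seq => // [x _|x _ []] //; exact: h. Qed.

Lemma finite_set_seqP (T : choiceType) (A : set T) : finite_set A ->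
  exists2 r : seq T, uniq r & forall x, A x <-> x \in r.
Proof.
by move=> /finite_seqP [r ->]; exists (undup r) => [|x]; rewrite ?undup_uniq // mem_undup.
Qed.

Lemma laurent_ge d f : laurent d f -> exists B : int, 0 <= B /\ forall m, f m != 0 -> - B <= mdeg d m.
Proof.
move=> /(_ 0) /finite_set_seqP [r _ hr]; exists (\sum_(m <- r) `|mdeg d m|).
split=> [|m fm]; first exact: sumr_ge0.
case: (leP (mdeg d m) 0) => m0; last by apply: le_trans (ltW m0); rewrite oppr_le0 sumr_ge0.
have mr : m \in r by apply/hr.
rewrite lerNl (big_rem m) //= -[X in X <= _]addr0 lerD ?ler_normN ?sumr_ge0 //.
by rewrite -normrN ler_norm.
Qed.

Lemma laurent_seq d f N : laurent d f ->
  exists2 r : seq M, uniq r & forall m, (f m != 0 /\ mdeg d m <= N) <-> m \in r.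
Proof. by move=> /(_ N) /finite_set_seqP. Qed.

Lemma smulC f g : smul f g = smul g f.
Proof.
apply/funext => m; rewrite /smul (reindex_fsbigT (fun a => m - a)) /=.
  by apply: eq_fsbigr => a _; rewrite subKr mulrC.
by exists (fun a => m - a) => a; rewrite subKr.
Qed.

Lemma smul_seq f g m (r : seq M) : uniq r ->
  (forall a, f a != 0 -> g (m - a) != 0 -> a \in r) -> smul f g m = \sum_(a <- r) f a * g (m - a).
Proof.
by move=> ur h; apply: fsumT_seq => // a; rewrite mulf_eq0 negb_or => /andP[]; exact: h.
Qed.

Lemma smul_neq0 f g m : smul f g m != 0 -> exists a, f a != 0 /\ g (m - a) != 0.
Proof.
move=> nz; apply: contrapT => nex; move/eqP: nz; apply; apply: fsbig1 => a _; apply/eqP.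
by rewrite mulf_eq0 -[_ || _]negbK negb_or; apply/negP => /andP[? ?]; apply: nex; exists a.
Qed.

(** In each degree the sums are supported in finite sets [rf] and [rc]
common to both sides, because the supports are bounded below. *)
Lemma smulA d f g h : laurent d f -> laurent d g -> laurent d h ->
  smul (smul f g) h = smul f (smul g h).
Proof.
move=> lf lg lh; apply/funext => m.
have [A [A0 hA]] := laurent_ge lf; have [B [B0 hB]] := laurent_ge lg.
have [C [C0 hC]] := laurent_ge lh.
have [rf uf hf] := laurent_seq (mdeg d m + B + C) lf.
have [rg ug hg] := laurent_seq (mdeg d m + A + C) lg.
(* a stands for a monomial of f, and c for one of the product of f and g. *)
pose rc := undup [seq a + b | a <- rf, b <- rg].
have ac a c : f a != 0 -> g (c - a) != 0 -> h (m - c) != 0 -> a \in rf /\ c \in rc.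
  move=> fa gb hc; have := hA _ fa; have := hB _ gb; have := hC _ hc; rewrite !mdegB => h1 h2 h3.
  have ar : a \in rf by apply/hf; split=> //; lia.
  split=> //; rewrite mem_undup; apply/allpairsP; exists (a, c - a); split => //=.
    by apply/hg; split=> //; rewrite mdegB; lia.
  by rewrite addrC subrK.
transitivity (\sum_(c <- rc) \sum_(a <- rf) f a * g (c - a) * h (m - c)).
  rewrite (@smul_seq _ _ _ rc) ?undup_uniq //.
    apply: eq_big_seq => c _; case: (eqVneq (h (m - c)) 0) => [->|hc].
      by rewrite mulr0 big1 // => a _; rewrite mulr0.
    by rewrite (@smul_seq _ _ _ rf) // ?mulr_suml // => a fa gb; have [] := ac a c.
  move=> c fg hc; have [a [fa gb]] := smul_neq0 fg.
  by have [] := ac a c.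
rewrite exchange_big /= (@smul_seq _ _ _ rf) //.
  apply: eq_big_seq => a ar; case: (eqVneq (f a) 0) => [->|fa].
    by rewrite mul0r big1 // => c _; rewrite !mul0r.
  rewrite /smul (reindex_fsbigT (fun c => c - a)) /=; last by exists (fun c => c + a) => c; rewrite ?subrK ?addrK.
  rewrite (@fsumT_seq _ _ _ rc) ?undup_uniq //.
    by rewrite mulr_sumr; apply: eq_bigr => c _; rewrite mulrA; congr (_ * h _); rewrite opprB addrA subrK.
  move=> c; rewrite mulf_eq0 negb_or => /andP[gb].
  have -> : m - a - (c - a) = m - c by rewrite opprB addrA subrK.
  by move=> hc; have [] := ac a c.
move=> a fa gh; have [c [gb hc]] := smul_neq0 gh.
by have [] := ac a (a + c); rewrite // ?[a + c]addrC ?addrK // opprD addrCA addrC.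
Qed.

Lemma smul_sone f : smul (@sone l) f = f.
Proof.
apply/funext => m; rewrite (@smul_seq _ _ _ [:: 0]) // => [|a].
  by rewrite big_seq1 /sone eqxx mul1r subr0.
by rewrite /sone mem_seq1; case: (a == 0).
Qed.

Lemma quotient_unique d f g g' r : laurent d g -> laurent d g' -> laurent d r ->
  smul g g' = @sone l -> f = smul g r -> r = smul f g'.
Proof.
move=> lg lg' lr gg' ->; rewrite [smul g r]smulC (@smulA d) // gg' smulC.
by rewrite smul_sone.
Qed.

Lemma laurent_smul d f g : laurent d f -> laurent d g -> laurent d (smul f g).
Proof.
move=> lf lg N; have [A [A0 hA]] := laurent_ge lf; have [B [B0 hB]] := laurent_ge lg.
have [rf uf hf] := laurent_seq (N + B) lf; have [rg ug hg] := laurent_seq (N + A) lg.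
apply: (@sub_finite_set _ _ [set` [seq a + b | a <- rf, b <- rg]]); last exact: finite_seq.
move=> m /= [fg dm]; have [a [fa gb]] := smul_neq0 fg.
have := hA _ fa; have := hB _ gb; rewrite mdegB => h1 h2.
apply/allpairsP; exists (a, m - a); split => /=.
- by apply/hf; split=> //; lia.
- by apply/hg; split=> //; rewrite mdegB; lia.
by rewrite addrC subrK.
Qed.

Section Inverse.
Variables (d : {ffun var l -> int}) (g : series l) (p : M).
Hypotheses (lg : laurent d g) (gp : g p = 1)
  (g_lead : forall m, g m != 0 -> m = p \/ mdeg d p < mdeg d m).

(** g is the product of the monomial p and of 1 - y, and y only has monomials of
positive degree, so that the geometric series of y converges. *)
Let y : series l := fun m => (m == 0)%:R - g (m + p).

Lemma y_pos m : y m != 0 -> 0 < mdeg d m.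
Proof.
rewrite /y; case: (m =P 0) => [->|/eqP m0]; first by rewrite add0r gp subrr eqxx.
rewrite sub0r oppr_eq0 => /g_lead [/eqP|]; last by rewrite mdegD; lia.
by rewrite -subr_eq0 addrK (negPf m0).
Qed.

Lemma laurent_y : laurent d y.
Proof.
move=> N; have [r _ hr] := laurent_seq (N + mdeg d p) lg.
apply: (@sub_finite_set _ _ [set` 0 :: [seq m - p | m <- r]]); last exact: finite_seq.
move=> m /= [ym dm]; rewrite inE; case: (m =P 0) => //= m0.
apply/mapP; exists (m + p); last by rewrite addrK.
apply/hr; rewrite mdegD; split; last by lia.
by move: ym; rewrite /y; case: (m =P 0) => // _; rewrite sub0r oppr_eq0.
Qed.

(** Partial sums of the geometric series of y. *)
Fixpoint iter_inv (n : nat) : series l :=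
  if n is n'.+1 then fun m => sone m + smul y (iter_inv n') m else fun=> 0.

Lemma iter_inv_supp n m : iter_inv n m != 0 -> 0 <= mdeg d m.
Proof.
elim: n m => [//|n IH] m /=.
rewrite /sone; case: (m =P 0) => [->|m0]; first by rewrite mdeg0.
rewrite add0r => nz; have [a [fa gb]] := smul_neq0 nz.
by have := y_pos fa; have := IH _ gb; rewrite mdegB; lia.
Qed.

Lemma laurent_sone : laurent d (@sone l).
Proof.
move=> N; apply: (@sub_finite_set _ _ [set 0]); last exact: finite_set1.
by move=> m /= []; rewrite /sone; case: (m =P 0).
Qed.

Lemma laurentD f h : laurent d f -> laurent d h -> laurent d (fun m => f m + h m).
Proof.
move=> lf lh N; pose S f := [set m : M | f m != 0 /\ mdeg d m <= N].
apply: (@sub_finite_set _ _ (S f `|` S h)).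
  move=> m /= [fh dm]; case: (eqVneq (f m) 0) => [f0|fm]; last by left.
  by right; split=> //; move: fh; rewrite f0 add0r.
by rewrite finite_setU; split; [exact: lf|exact: lh].
Qed.

Lemma laurent_iter n : laurent d (iter_inv n).
Proof.
elim: n => [|n IH]; first by move=> N; apply: (@sub_finite_set _ _ set0) => // m /= [].
by apply: laurentD; [exact: laurent_sone|apply: laurent_smul => //; exact: laurent_y].
Qed.

(** A product of n monomials of y has degree at least n, so the
coefficients in degree less than n do not change after n iterations. *)
Lemma iter_inv_stable n k m : mdeg d m < n%:Z -> (n <= k)%N -> iter_inv k m = iter_inv n m.
Proof.
elim: n k m => [|n IH] k m dm nk.
  apply/eqP; rewrite /=; apply: contraTT dm => /iter_inv_supp; lia.
case: k nk => // k nk /=; congr (_ + _).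
apply: eq_fsbigr => a _; case: (eqVneq (y a) 0) => [->|/y_pos da]; first by rewrite !mul0r.
by congr (_ * _); apply: IH => //; rewrite mdegB; lia.
Qed.

Let v : series l := fun m => iter_inv `|mdeg d m|.+1 m.

Lemma v_iter n m : mdeg d m < n%:Z -> v m = iter_inv n m.
Proof.
move=> h; rewrite /v; case: (leqP n `|mdeg d m|.+1) => hn; first exact: iter_inv_stable.
by symmetry; apply: iter_inv_stable; lia.
Qed.

Lemma laurent_v : laurent d v.
Proof.
move=> N; apply: sub_finite_set (laurent_iter `|N|.+1 N) => m [vm dm].
by split=> //; rewrite -v_iter //; lia.
Qed.

Lemma v_rec m : v m = sone m + smul y v m.
Proof.
rewrite /v /=; congr (_ + _); apply: eq_fsbigr => a _.
case: (eqVneq (y a) 0) => [->|/y_pos da]; first by rewrite !mul0r.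
by congr (_ * _); symmetry; apply: v_iter; rewrite mdegB; lia.
Qed.

Lemma series_inverse : exists2 g', laurent d g' & smul g g' = @sone l.
Proof.
exists (fun m => v (m + p)).
  move=> N; have [r _ hr] := laurent_seq (N + mdeg d p) laurent_v.
  apply: (@sub_finite_set _ _ [set` [seq m - p | m <- r]]); last exact: finite_seq.
  move=> m /= [vm dm]; apply/mapP; exists (m + p); last by rewrite addrK.
  by apply/hr; rewrite mdegD; split=> //; lia.
apply/funext => m.
have -> : smul g (fun m => v (m + p)) m = smul (fun b => g (b + p)) v m.
  rewrite /smul (reindex_fsbigT (fun b => b + p)) /=; last by exists (fun b => b - p) => b; rewrite ?addrK ?subrK.
  by apply: eq_fsbigr => b _; congr (_ * v _); rewrite opprD addrA subrK.
have [r ur hr] := laurent_seq (mdeg d m) laurent_y.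
have rP a : y a != 0 -> v (m - a) != 0 -> a \in r.
  move=> ya va; apply/hr; split=> //.
  have /iter_inv_supp : iter_inv `|mdeg d (m - a)|.+1 (m - a) != 0 by exact: va.
  by rewrite mdegB; lia.
pose r0 := undup (0 :: r).
have r0P a : y a != 0 -> v (m - a) != 0 -> a \in r0.
  by move=> ya va; rewrite mem_undup inE (rP a) ?orbT.
have := v_rec m; rewrite (@smul_seq y v m r0) ?undup_uniq // => E.
rewrite (@smul_seq _ v m r0) ?undup_uniq //; last first.
  move=> a ga va; case: (eqVneq (y a) 0) => [|ya]; last exact: r0P.
  rewrite /y; case: (a =P 0) => [-> _|_]; first by rewrite mem_undup inE eqxx.
  by move/eqP; rewrite sub0r oppr_eq0 (negPf ga).
have -> : \sum_(a <- r0) g (a + p) * v (m - a) =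
    \sum_(a <- r0) (a == 0)%:R * v (m - a) - \sum_(a <- r0) y a * v (m - a).
  by rewrite -sumrB; apply: eq_bigr => a _; rewrite -mulrBl /y subKr.
have -> : \sum_(a <- r0) (a == 0)%:R * v (m - a) = v m.
  rewrite (bigD1_seq 0) ?undup_uniq ?mem_undup ?inE ?eqxx //= mul1r subr0 big1 ?addr0 // => a.
  by move/negPf => ->; rewrite mul0r.
by rewrite E addrK.
Qed.

End Inverse.

Section Count.
Variable d : {ffun var l -> int}.

(** Defined on an arbitrary type, for which [{classic T}] provides the
choice structure that finitely supported sums need. *)
Definition gen_series (T : Type) (f : T -> M) : series l :=
  fun m => \sum_(x \in [set x : {classic T} | f x = m]) (1 : int).

(** Makes all coefficients of [gen_series f] genuine finite counts. *)
Definition tame (T : Type) (f : T -> M) : Prop :=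
  forall N, finite_set [set x : {classic T} | mdeg d (f x) <= N].

Lemma gen_series_wiso T U (f : T -> M) (g : U -> M) : wiso f g -> gen_series f = gen_series g.
Proof.
move=> [phi [psi K1 K2] E]; apply/funext => m.
rewrite /gen_series (reindex_fsbig (phi : {classic T} -> {classic U}) [set x | f x = m]) //.
split.
- by move=> x /= <-; rewrite E.
- by move=> x x' _ _ /(can_inj K1).
- by move=> u /= gm; exists (psi u) => //=; rewrite -E K2.
Qed.

Lemma tame_wiso T U (f : T -> M) (g : U -> M) : wiso f g -> tame f -> tame g.
Proof.
move=> [phi [psi K1 K2] E] h N; apply: sub_finite_set (finite_image (phi : {classic T} -> {classic U}) (h N)).
by move=> u /= du; exists (psi u); rewrite ?K2 //= -E K2.
Qed.

Lemma gen_series_seq T (f : T -> M) m (r : seq {classic T}) : uniq r ->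
  (forall x, f x = m -> (x : {classic T}) \in r) -> gen_series f m = \sum_(x <- r) (f x == m)%:R.
Proof.
move=> ur h; rewrite /gen_series fsbig_mkcond (@fsumT_seq _ _ _ r) //.
  by apply: eq_bigr => x _; rewrite /patch; case: ifPn => [/set_mem /= ->|]; rewrite ?eqxx // notin_setE /= => /eqP /negPf ->.
by move=> x; rewrite /patch; case: ifPn => [/set_mem /h //|]; rewrite eqxx.
Qed.

Lemma tame_seq T (f : T -> M) (K : int) : tame f -> exists2 r : seq {classic T}, uniq r &
  (forall x, x \in r <-> mdeg d (f x) <= K) /\
  forall m, mdeg d m <= K -> gen_series f m = \sum_(x <- r) (f x == m)%:R.
Proof.
move=> /(_ K) /finite_set_seqP [r ur hr]; exists r => //; split=> [x|m dm]; first by have [] := hr x.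
by rewrite (gen_series_seq ur) // => x E; apply/hr; rewrite /= E.
Qed.

Lemma tame_ge T (f : T -> M) : tame f -> exists B : int, 0 <= B /\ forall x, - B <= mdeg d (f x).
Proof.
move=> /(_ 0) /finite_set_seqP [r _ hr]; exists (\sum_(x <- r) `|mdeg d (f x)|).
split=> [|x]; first exact: sumr_ge0.
case: (leP (mdeg d (f x)) 0) => m0; last by apply: le_trans (ltW m0); rewrite oppr_le0 sumr_ge0.
have mr : (x : {classic T}) \in r by apply/hr.
rewrite lerNl (big_rem _ mr) /= -[X in X <= _]addr0 lerD ?sumr_ge0 //.
by rewrite -normrN ler_norm.
Qed.

Lemma gen_series_neq0 T (f : T -> M) m : gen_series f m != 0 -> exists x, f x = m.
Proof.
move=> nz; apply: contrapT => nex; move/eqP: nz; apply; apply: fsbig1 => x /= E.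
by case: nex; exists x.
Qed.

Lemma laurent_gen_series T (f : T -> M) : tame f -> laurent d (gen_series f).
Proof.
move=> h N; apply: sub_finite_set (finite_image (f : {classic T} -> M) (h N)) => m /= [/gen_series_neq0 [x <-] dm].
by exists x.
Qed.

(** Tameness bounds the degrees below, so that a monomial of the product
comes from finitely many pairs. *)
Lemma gen_seriesM T U (f : T -> M) (g : U -> M) : tame f -> tame g ->
  gen_series (fun p : T * U => f p.1 + g p.2) = smul (gen_series f) (gen_series g).
Proof.
move=> tf tg; apply/funext => m.
have [A [A0 hA]] := tame_ge tf; have [B [B0 hB]] := tame_ge tg.
have [rf uf [hf cf]] := tame_seq (mdeg d m + B) tf.
have [rg ug [hg cg]] := tame_seq (mdeg d m + A) tg.
pose ra := undup [seq f x | x <- rf].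
pose rp : seq {classic T * U} := [seq ((x, y) : {classic T * U}) | x <- rf, y <- rg].
transitivity (\sum_(p <- rp) ((f p.1 + g p.2) == m)%:R : int).
  apply: gen_series_seq => [|[x y] /= E].
    apply: (@allpairs_uniq {classic T} {classic U} {classic T * U} (fun x y => (x, y)) rf rg uf ug).
    by move=> -[x1 y1] [x2 y2].
  have := hA x; have := hB y; move: (congr1 (mdeg d) E); rewrite mdegD => E' h1 h2.
  have xr : x \in rf by apply/hf; lia.
  have yr : y \in rg by apply/hg; lia.
  exact: (@allpairs_f {classic T} {classic U} {classic T * U} (fun x y => (x, y))).
rewrite big_allpairs_dep /= (@smul_seq _ _ _ ra) ?undup_uniq //; last first.
  move=> a /gen_series_neq0 [x E] /gen_series_neq0 [y Ey]; rewrite mem_undup -E.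
  have xr : x \in rf by apply/hf; have := hB y; rewrite Ey mdegB E; lia.
  exact: (@map_f {classic T} M f).
have ra_deg a : a \in ra -> - A <= mdeg d a <= mdeg d m + B.
  by rewrite mem_undup => /(@mapP {classic T} M f)[x /hf xr ->]; have := hA x; lia.
transitivity (\sum_(a <- ra) \sum_(x <- rf) \sum_(y <- rg) ((f x == a)%:R * (g y == m - a)%:R : int)).
  rewrite [RHS]exchange_big /=; apply: (@eq_big_seq _ _ _ {classic T}) => x xr.
  rewrite [RHS]exchange_big /=; apply: eq_bigr => y _.
  rewrite (bigD1_seq (f x)) ?undup_uniq ?mem_undup ?(@map_f {classic T} M f) //= eqxx mul1r.
  rewrite big1 ?addr0 => [|a]; last by rewrite eq_sym => /negPf ->; rewrite mul0r.
  by rewrite [in RHS]eq_sym subr_eq [m == _]eq_sym addrC.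
apply: eq_big_seq => a /ra_deg ha; rewrite cf ?cg ?mdegB; try lia.
by rewrite mulr_suml; apply: eq_bigr => x _; rewrite mulr_sumr.
Qed.

End Count.
End Series.
End FormalSeries.

(** * Paths as sequences of diagrams *)
Section FrozenPaths.
Local Open Scope classical_set_scope.
Implicit Types (x y z : young).

Lemma strip_refl s x : strip s x x.
Proof.
move=> a; split=> //; case: s.
  by case: (young_step x a) => ->; lia.
by have := young_step x (a - 1); rewrite subrK; lia.
Qed.

Lemma young_le_empty x : (forall a, x a <= young0 a) -> x = young0.
Proof. by move=> h; apply: young_eq => a; have := h a; have := young_ge x a; rewrite /=; lia. Qed.

Lemma sval2_eq A T (P : A -> Prop) (Q : A -> T -> Prop)
    (p q : {z : {z | P z} & {K | Q (sval z) K}}) :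
  sval (projT1 p) = sval (projT1 q) -> sval (projT2 p) = sval (projT2 q) -> p = q.
Proof.
case: p q => [[z hz] [K hK]] [[z' hz'] [K' hK']] /= E E'; subst z' K'.
by rewrite (Prop_irrelevance hz' hz) (Prop_irrelevance hK' hK).
Qed.

Section Windows.
Variable V : zmodType.
Implicit Types (o : step V) (r : seq (step V)).

Lemma steps_refl o x : steps o x x.
Proof. by rewrite /steps /trans; case: ifP => _; exact: strip_refl. Qed.

Variable op : int -> step V.

Definition window (g0 : int) (n : nat) : seq (step V) := [seq op (g0 + i%:Z) | i <- iota 0 n].

Lemma window_S g0 n : window g0 n.+1 = op g0 :: window (g0 + 1) n.
Proof.
rewrite /window /= addr0; congr cons; rewrite -[1%N]/(1 + 0)%N iotaDl -map_comp.
by apply: eq_map => i /=; congr op; lia.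
Qed.

Definition frozen (g0 : int) (n : nat) x y (K : int -> young) : Prop :=
  [/\ forall g : int, g <= g0 -> K g = x, forall g : int, g0 + n%:Z <= g -> K g = y &
      forall g : int, steps (op g) (K g) (K (g + 1))].

Definition cost (K : int -> young) (g : int) : V :=
  weight (op g) *~ (boxes (K g) - boxes (K (g + 1))).

(** Finite paths in terms of functions on the integers, in which
windows of different lengths can be compared. *)
Lemma path_frozen g0 n x y :
  wiso (@path_weight V (window g0 n) x y)
       (fun K : {K | frozen g0 n x y K} => \sum_(i < n) cost (sval K) (g0 + i%:Z)).
Proof.
elim: n g0 x => [|n IH] g0 x.
  have F0 (p : path (window g0 0) x y) : frozen g0 0 x y (fun=> x).
    by case: p => _ E; split=> // g; exact: steps_refl.
  exists (fun p => exist _ (fun=> x) (F0 p)); last by move=> p; rewrite big_ord0.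
  have Exy (K : {K | frozen g0 0 x y K}) : x = y.
    by have [h1 h2 _] := svalP K; rewrite -(h1 g0) ?h2 //; lia.
  exists (fun K => exist _ tt (Exy K)).
    by move=> [[] E]; apply: sval_eq.
  move=> [K [h1 h2 h3]]; apply: sval_eq; apply/funext => g /=.
  case: (leP g g0) => hg; first by rewrite h1.
  by rewrite h2; [rewrite -(h1 g0) ?h2 //; lia|lia].
rewrite window_S.
refine (wiso_trans (f := @path_weight V (op g0 :: window (g0 + 1) n) x y) (@wiso_sigma {z | steps (op g0) x z} V
  (fun w => path (window (g0 + 1) n) (sval w) y)
  (fun w => {K | frozen (g0 + 1) n (sval w) y K})
  (fun w p => weight (op g0) *~ (boxes x - boxes (sval w)) + path_weight p)
  (fun w K => weight (op g0) *~ (boxes x - boxes (sval w)) +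
     \sum_(i < n) cost (sval K) (g0 + 1 + i%:Z)) _) _).
  move=> z; exact: (wiso_comp (fun u => weight (op g0) *~ (boxes x - boxes (sval z)) + u) (IH (g0 + 1) (sval z))).
pose ext (K : int -> young) := fun g : int => if g <= g0 then x else K g.
pose res (K : int -> young) := fun g : int => if g <= g0 + 1 then K (g0 + 1) else K g.
have extP z K : steps (op g0) x z -> frozen (g0 + 1) n z y K -> frozen g0 n.+1 x y (ext K).
  move=> hz [h1 h2 h3]; split=> g; rewrite /ext.
  - by move->.
  - by move=> hg; rewrite ifF; [apply: h2|]; lia.
  case: (leP g g0) => hg; last by rewrite ifF //; lia.
  case: (leP (g + 1) g0) => hg'; first exact: steps_refl.
  have -> : g = g0 by lia.
  by rewrite h1.
have resP K : frozen g0 n.+1 x y K -> steps (op g0) x (K (g0 + 1)) /\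
    frozen (g0 + 1) n (K (g0 + 1)) y (res K).
  move=> [h1 h2 h3]; split; first by have := h3 g0; rewrite (h1 g0).
  split=> g; rewrite /res.
  - by move=> ->.
  - move=> hg; case: ifP => hg'; last by apply: h2; lia.
    by apply: h2; lia.
  case: (leP g (g0 + 1)) => hg; last by rewrite ifF //; lia.
  case: (leP (g + 1) (g0 + 1)) => hg'; first exact: steps_refl.
  by have -> : g = g0 + 1 by lia.
exists (fun p : {z : {z | steps (op g0) x z} & {K | frozen (g0 + 1) n (sval z) y K}} =>
  exist _ (ext (sval (projT2 p))) (extP _ _ (proj2_sig (projT1 p)) (proj2_sig (projT2 p)))).
  exists (fun K : {K | frozen g0 n.+1 x y K} =>
     existT (fun z : {z | steps (op g0) x z} => {K | frozen (g0 + 1) n (sval z) y K})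
      (exist _ (sval K (g0 + 1)) (and_l (resP _ (proj2_sig K))))
      (exist _ (res (sval K)) (and_r (resP _ (proj2_sig K))))).
    move=> [[z hz] [K hK]] /=.
    have [h1 h2 h3] := hK.
    have E : ext K (g0 + 1) = z by rewrite /ext ifF ?h1 //; lia.
    have E' : res (ext K) = K.
      apply/funext => g; rewrite /res /ext; case: (leP g (g0 + 1)) => hg.
        by rewrite ifF ?h1 //; lia.
      by rewrite ifF //; lia.
    exact: (@sval2_eq _ _ (steps (op g0) x) (fun z K => frozen (g0 + 1) n z y K)).
  move=> [K [h1 h2 h3]]; apply: sval_eq; apply/funext => g /=; rewrite /ext /res.
  case: (leP g g0) => hg; first by rewrite h1.
  by case: ifP => // hg'; congr K; lia.
move=> [[z hz] [K [h1 h2 h3]]] /=; rewrite big_ord_recl /=; congr (_ + _).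
  rewrite /cost addr0; congr (_ *~ (boxes _ - boxes _)); rewrite /ext ?lexx //.
  by rewrite ifF ?h1 //; lia.
apply: eq_bigr => i _; rewrite /cost /bump /= add1n.
have -> : g0 + i.+1%:Z = g0 + 1 + i%:Z by lia.
by congr (_ *~ (boxes _ - boxes _)); rewrite /ext ifF //; lia.
Qed.

End Windows.
End FrozenPaths.

(** * Bi-infinite sequences and their degrees *)
Section Sequences.
Local Open Scope classical_set_scope.
Implicit Types (x y z : young).

(** The rows 0 to i are at least as long as row i, which bounds both its
length and the number of nonempty rows. *)
Lemma row_le_boxes x i : (row x i)%:Z <= boxes x /\ (boxes x <= i%:Z -> row x i = 0%N).
Proof.
have [N h] := row_far x.
have mono j k : (j <= k)%N -> (row x k <= row x j)%N.
  by move=> /subnK <-; elim: (k - j)%N => // n IH; exact: leq_trans (row_noninc _ _) IH.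
case: (ltnP i N) => iN; last by rewrite h //; have := boxes_ge0 x; lia.
rewrite (sum_rows h).
have -> : \sum_(j < N) (row x j)%:Z = \sum_(0 <= j < i.+1) (row x j)%:Z + \sum_(i.+1 <= j < N) (row x j)%:Z.
  by rewrite -big_cat_nat // big_mkord.
have h1 : 0 <= \sum_(i.+1 <= j < N) (row x j)%:Z by apply: sumr_ge0.
have h2 : (row x i)%:Z * i.+1%:Z <= \sum_(0 <= j < i.+1) (row x j)%:Z.
  rewrite big_mkord -[X in X <= _]/((row x i)%:Z * i.+1%:Z) mulrC.
  have -> : i.+1%:Z * (row x i)%:Z = \sum_(j < i.+1) (row x i)%:Z.
    by rewrite sumr_const card_ord -mulr_natl natz.
  by apply: ler_sum => j _; have := mono j i; have := ltn_ord j; lia.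
by nia.
Qed.

Lemma finite_young (S : nat) : finite_set [set x : {classic young} | boxes x <= S%:Z].
Proof.
pose dec (f : {ffun 'I_S -> 'I_S.+1}) : {classic young} := mkyoung (fun i => if insub i is Some j then f j : nat else 0%N).
apply: sub_finite_set (finite_image dec (@finite_finset _ setT)) => x /= xS.
exists [ffun i : 'I_S => inord (row x i)] => //.
apply: mkyoung_row => i; case: insubP => [j _ <-|].
  by rewrite ffunE inordK //; have := (row_le_boxes x j).1; lia.
by rewrite -leqNgt => Si; rewrite (row_le_boxes x i).2 //; lia.
Qed.

(** Only the first N0 terms can be negative, by at most A each. *)
Lemma sum_pos_part (f : nat -> int) (N0 M : nat) (A : int) : 0 <= A ->
  (forall i, (i < N0)%N -> - A <= f i) -> (forall i, (N0 <= i)%N -> 0 <= f i) ->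
  \sum_(i < M) (if 0 <= f i then f i else 0) <= \sum_(i < M) f i + N0%:Z * A.
Proof.
move=> A0 h1 h2.
suff H : \sum_(i < M) (if 0 <= f i then f i else 0) <= \sum_(i < M) f i + (minn N0 M)%:Z * A.
  by apply: le_trans H _; rewrite lerD2l ler_wpM2r //; lia.
elim: M => [|M IH]; first by rewrite !big_ord0 minn0 mul0r.
rewrite !big_ord_recr /=; case: (ltnP M N0) => MN.
  have := h1 M MN; have -> : minn N0 M.+1 = (minn N0 M).+1 by lia.
  have aux (S S' P F G : int) : S <= S' + P -> G <= F + A -> S + G <= S' + F + (A + P) by lia.
  move=> h; rewrite intS mulrDl mul1r; apply: aux => //; case: ifP; lia.
have := h2 M MN; have -> : minn N0 M.+1 = minn N0 M by lia.
have aux (S S' P F : int) : S <= S' + P -> S + F <= S' + F + P by lia.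
by move=> fM; rewrite fM; exact: aux.
Qed.

Lemma sum_ge_count (f : nat -> int) (N0 k M : nat) : (k <= M)%N ->
  (forall i, 0 <= f i) -> (forall i, (N0 <= i < k)%N -> 1 <= f i) ->
  (k - N0)%N%:Z <= \sum_(i < M) f i.
Proof.
move=> kM h1 h2.
suff H : (minn k M - N0)%N%:Z <= \sum_(i < M) f i by move: H; have -> : minn k M = k by lia.
elim: {kM}M => [|M IH]; first by rewrite big_ord0 minn0 sub0n.
rewrite big_ord_recr /=; have := h1 M; have := h2 M; move: IH.
by move: (\sum_(i < M) f i) (f M) => S F; lia.
Qed.

Lemma sum_ge_term (f : nat -> int) (j M : nat) : (j < M)%N ->
  (forall i, 0 <= f i) -> f j <= \sum_(i < M) f i.
Proof.
move=> jM h; rewrite (bigD1 (Ordinal jM)) //= -[X in X <= _]addr0 lerD2l.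
by apply: sumr_ge0.
Qed.
Section Seqs.
Variable l : nat.
Variables (op : int -> step (mono l)) (d : {ffun var l -> int}) (C : int) (N0 : nat).
Hypotheses (deg_op : forall g : int, mdeg d (weight (op g)) = 2 * g + C)
  (op_right : forall g : int, N0%:Z <= g -> shrinks (op g) = true)
  (op_left : forall g : int, g < - N0%:Z -> shrinks (op g) = false).
Implicit Types (K : int -> young) (nu : young * young).

Definition frozen_at (M : nat) nu K : Prop := frozen op (- M%:Z) (2 * M) nu.2 nu.1 K.
(** Sequences in the order of the columns: nu.2 is nu_-, the diagram on the
left, and nu.1 is nu_+. *)
Definition is_seq nu K : Prop := exists M, frozen_at M nu K.
Definition total K : mono l := \sum_(g \in [set: int]) cost op K g.

Lemma frozen_atP M nu K : frozen_at M nu K <->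
  [/\ forall g : int, g <= - M%:Z -> K g = nu.2, forall g : int, M%:Z <= g -> K g = nu.1 &
      forall g : int, steps (op g) (K g) (K (g + 1))].
Proof.
by split=> -[h1 h2 h3]; split=> // g hg; apply: h2; lia.
Qed.

Lemma totalE M nu K : frozen_at M nu K ->
  total K = \sum_(i < 2 * M) cost op K (- M%:Z + i%:Z).
Proof.
move=> /frozen_atP [h1 h2 _].
rewrite /total (@fsumT_seq _ _ _ [seq - M%:Z + i%:Z | i <- iota 0 (2 * M)]).
- by rewrite big_map -(big_mkord xpredT (fun i : nat => cost op K (- M%:Z + i%:Z))) /index_iota subn0.
- by rewrite map_inj_uniq ?iota_uniq // => i j; lia.
move=> g; rewrite /cost => nz; apply/mapP; exists `|(g + M%:Z)%R|%N.
  rewrite mem_iota; case: (ltP g (- M%:Z)) => gM.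
    by move: nz; rewrite !h1 ?subrr ?mulr0z ?eqxx //; lia.
  case: (leP M%:Z g) => gM'; last by lia.
  by move: nz; rewrite !h2 ?subrr ?mulr0z ?eqxx //; lia.
case: (ltP g (- M%:Z)) => gM; last by lia.
by move: nz; rewrite !h1 ?subrr ?mulr0z ?eqxx //; lia.
Qed.

Lemma abel (s : int -> int) (g0 : int) (n : nat) :
  \sum_(i < n) (s (g0 + i%:Z) - s (g0 + i%:Z + 1)) * (2 * (g0 + i%:Z) + C) =
  (2 * g0 + C) * s g0 - (2 * (g0 + n%:Z) + C) * s (g0 + n%:Z) + 2 * \sum_(i < n) s (g0 + i%:Z + 1).
Proof.
elim: n => [|n IH].
  have -> : g0 + 0%N%:Z = g0 by lia.
  by rewrite !big_ord0 subrr mulr0 addr0.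
rewrite !big_ord_recr /= IH.
have -> : g0 + n.+1%:Z = g0 + n%:Z + 1 by lia.
move: (g0 + n%:Z) => h; move: (s g0) (s h) (s (h + 1)) (\sum_(i < n) _) => a b c S.
ring.
Qed.

Lemma mdeg_sum (I : Type) (r : seq I) (F : I -> mono l) :
  mdeg d (\sum_(i <- r) F i) = \sum_(i <- r) mdeg d (F i).
Proof. by rewrite (big_morph (mdeg d) (mdegD d) (mdeg0 d)). Qed.

(** Because the degree of the weight grows by 2 from each column to the
next, Abel summation turns the sum of the differences of sizes into the sum of
the sizes themselves. *)
Lemma deg_total M nu K : frozen_at M nu K ->
  mdeg d (total K) = C * (boxes nu.2 - boxes nu.1) +
    2 * (\sum_(i < M) (boxes (K (- i%:Z)) - boxes nu.2) + \sum_(i < M) (boxes (K (1 + i%:Z)) - boxes nu.1)).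
Proof.
move=> fr; rewrite (totalE fr) mdeg_sum.
have /frozen_atP [h1 h2 _] := fr.
under eq_bigr do rewrite mdegZ deg_op.
rewrite (abel (fun g => boxes (K g))) (h1 (- M%:Z)) // (h2 (- M%:Z + (2 * M)%N%:Z)); last by lia.
have -> : \sum_(i < 2 * M) boxes (K (- M%:Z + i%:Z + 1)) =
    \sum_(i < M) boxes (K (- i%:Z)) + \sum_(i < M) boxes (K (1 + i%:Z)).
  rewrite mul2n -addnn big_split_ord /=; congr (_ + _).
    rewrite (reindex_inj rev_ord_inj) /=; apply: eq_bigr => i _; congr (boxes (K _)).
    by have := ltn_ord i; lia.
  by apply: eq_bigr => i _; congr (boxes (K _)); lia.
have cst (x : int) : \sum_(i < M) x = M%:Z * x by rewrite sumr_const card_ord -mulr_natl natz.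
rewrite !sumrB !cst.
move: (\sum_(i < M) _) (\sum_(i < M) _) => X Y.
have -> : (2 * M)%N%:Z = 2 * M%:Z by lia.
ring.
Qed.

Lemma boxes_mono K (lo hi : int) :
  (forall g : int, lo <= g -> g < hi -> forall a, K g a <= K (g + 1) a) ->
  forall g g' : int, lo <= g -> g <= g' -> g' <= hi ->
  boxes (K g) <= boxes (K g') /\ (K g <> K lo -> boxes (K lo) < boxes (K g')).
Proof.
move=> mono.
have grow (g g' : int) : lo <= g -> g <= g' -> g' <= hi -> forall a, K g a <= K g' a.
  move=> lg gg' hg'; have -> : g' = g + `|(g' - g)%R|%N%:Z by lia.
  have : g + `|(g' - g)%R|%N%:Z <= hi by lia.
  elim: `|(g' - g)%R|%N => [|n IH] hn a; first by rewrite addr0.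
  apply: le_trans (IH _ a) _; first by lia.
  have -> : g + n.+1%:Z = g + n%:Z + 1 by lia.
  by apply: mono; lia.
move=> g g' lg gg' hg'; split; first exact/boxes_le/grow.
move=> ne; apply: (@lt_le_trans _ _ (boxes (K g))); last exact/boxes_le/grow.
have le := grow lo g (lexx _) lg (le_trans gg' hg').
rewrite lt_neqAle boxes_le // andbT; apply/eqP => E; apply: ne.
by rewrite (boxes_eq le E).
Qed.

(** Left of - N0 all steps add boxes. *)
Lemma boxes_mono_left M nu K : frozen_at M nu K -> forall g g' : int, g <= g' -> g' <= - N0%:Z ->
  boxes (K g) <= boxes (K g') /\ (K g <> nu.2 -> boxes nu.2 < boxes (K g')).
Proof.
move=> /frozen_atP [h1 _ h3] g g' gg' hg'; pose lo := - `|g| - M%:Z.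
have <- : K lo = nu.2 by apply: h1; rewrite /lo; lia.
apply: (@boxes_mono K lo (- N0%:Z)) => // [c _ hc a|]; last by rewrite /lo; lia.
by have := h3 c; rewrite /steps /trans op_left // => /strip_leE.
Qed.

Lemma boxes_mono_right M nu K : frozen_at M nu K -> forall g g' : int, g <= g' -> N0%:Z <= g ->
  boxes (K g') <= boxes (K g) /\ (K g' <> nu.1 -> boxes nu.1 < boxes (K g)).
Proof.
move=> /frozen_atP [_ h2 h3] g g' gg' hg'; pose lo := - `|g'| - M%:Z.
have E : K (- lo) = nu.1 by apply: h2; rewrite /lo; lia.
have := @boxes_mono (fun c => K (- c)) lo (- N0%:Z) _ (- g') (- g); rewrite !opprK E; apply.
- move=> c _ hc a; have := h3 (- (c + 1)); rewrite /steps /trans op_right; last by lia.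
  have -> : - (c + 1) + 1 = - c by lia.
  by move/strip_leE; exact.
- by rewrite /lo; lia.
- by lia.
by lia.
Qed.

(** In [deg_total] only the columns with |g| <= N0 can contribute a negative
amount, and it is bounded.  A column that differs from its limit makes all
columns between it and this central region larger than the limit, so that a
sequence of bounded degree has a bounded support and bounded diagrams. *)
Lemma seq_bound nu : exists D : int, 0 <= D /\ forall M K (T : nat), frozen_at M nu K ->
  mdeg d (total K) + D <= T%:Z ->
  (forall g, boxes (K g) <= boxes nu.1 + boxes nu.2 + T%:Z) /\ frozen_at (N0 + T).+1 nu K.
Proof.
have A0 := boxes_ge0 nu.2; have B0 := boxes_ge0 nu.1.
exists (`|C * (boxes nu.2 - boxes nu.1)| + 2 * (N0%:Z * boxes nu.2 + N0%:Z * boxes nu.1)); split.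
  by rewrite addr_ge0 // mulr_ge0 // addr_ge0 // mulr_ge0.
move=> M K T fr; rewrite (deg_total fr) => degT.
have /frozen_atP [h1 h2 h3] := fr.
pose f (i : nat) := boxes (K (- i%:Z)) - boxes nu.2.
pose f' (i : nat) := boxes (K (1 + i%:Z)) - boxes nu.1.
pose pos (f : nat -> int) i := if 0 <= f i then f i else 0.
have pos0 u i : 0 <= pos u i by rewrite /pos; case: ifP.
have hf i : (i < N0)%N -> - boxes nu.2 <= f i by have := boxes_ge0 (K (- i%:Z)); rewrite /f; lia.
have hf2 i : (N0 <= i)%N -> 0 <= f i.
  move=> Ni; rewrite /f subr_ge0; case: (leP M i) => Mi; first by rewrite h1 //; lia.
  by have [||+ _] := boxes_mono_left fr (g := - M%:Z) (g' := - i%:Z); [lia|lia|rewrite h1].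
have hf' i : (i < N0)%N -> - boxes nu.1 <= f' i by have := boxes_ge0 (K (1 + i%:Z)); rewrite /f'; lia.
have hf'2 i : (N0 <= i)%N -> 0 <= f' i.
  move=> Ni; rewrite /f' subr_ge0; case: (leP M%:Z (1 + i%:Z)) => Mi; first by rewrite h2.
  by have [||+ _] := boxes_mono_right fr (g := 1 + i%:Z) (g' := M%:Z); [lia|lia|rewrite h2].
have S1 := sum_pos_part M A0 hf hf2; have S2 := sum_pos_part M B0 hf' hf'2.
rewrite -/(pos f _) in S1.
have X0 : \sum_(i < M) pos f i + \sum_(i < M) pos f' i <= T%:Z.
  move: S1 S2 degT; rewrite -[\sum_(i < M) (if _ then f i else _)]/(\sum_(i < M) pos f i)
   -[\sum_(i < M) (if _ then f' i else _)]/(\sum_(i < M) pos f' i)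
   -[\sum_(i < M) (boxes (K (- _)) - _)]/(\sum_(i < M) f i)
   -[\sum_(i < M) (boxes (K (1 + _)) - _)]/(\sum_(i < M) f' i).
  have X1 : 0 <= \sum_(i < M) pos f i by apply: sumr_ge0.
  have X2 : 0 <= \sum_(i < M) pos f' i by apply: sumr_ge0.
  move: (\sum_(i < M) pos f i) (\sum_(i < M) pos f' i) (\sum_(i < M) f i) (\sum_(i < M) f' i) X1 X2 => a b a' b' X1 X2.
  move: (N0%:Z * boxes nu.2) (N0%:Z * boxes nu.1) (C * _) => P Q c.
  have aux (u v u' v' : int) : 0 <= u -> 0 <= v -> u <= u' + P -> v <= v' + Q ->
    c + 2 * (u' + v') + (`|c| + 2 * (P + Q)) <= T%:Z -> u + v <= T%:Z by lia.
  exact: aux.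
have X1 : 0 <= \sum_(i < M) pos f i by apply: sumr_ge0.
have X2 : 0 <= \sum_(i < M) pos f' i by apply: sumr_ge0.
have Xf : \sum_(i < M) pos f i <= T%:Z by apply: le_trans X0; rewrite lerDl.
have Xf' : \sum_(i < M) pos f' i <= T%:Z by apply: le_trans X0; rewrite lerDr.
split=> [g|].
  case: (leP g 0) => g0.
    case: (leP M `|g|%N) => gM; first by rewrite h1; lia.
    have := le_trans (sum_ge_term gM (pos0 f)) Xf; rewrite /pos /f.
    have -> : - `|g|%N%:Z = g by lia.
    by case: ifP; lia.
  case: (leP M `|g|%N) => gM; first by rewrite h2; lia.
  have gM' : (`|g|.-1 < M)%N by lia.
  have := le_trans (sum_ge_term gM' (pos0 f')) Xf'; rewrite /pos /f'.
  have -> : 1 + `|g|.-1%:Z = g by lia.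
  by case: ifP; lia.
apply/frozen_atP; split=> // g hg.
  apply: contrapT => ne; have gM : (`|g|.+1 <= M)%N.
    by rewrite ltnNge; apply/negP => Mg; apply: ne; apply: h1; lia.
  have : (`|g|.+1 - N0)%N%:Z <= T%:Z; last by lia.
  apply: le_trans Xf; apply: (sum_ge_count gM (pos0 f)) => i hi.
  have [||_ /(_ ne) h] := boxes_mono_left fr (g := g) (g' := - i%:Z); [lia|lia|].
  by rewrite /pos /f; case: ifP; lia.
apply: contrapT => ne; have gM : (`|g| <= M)%N.
  by rewrite leqNgt; apply/negP => Mg; apply: ne; apply: h2; lia.
have : (`|g| - N0)%N%:Z <= T%:Z; last by lia.
apply: le_trans Xf'; apply: (sum_ge_count gM (pos0 f')) => i hi.
have [||_ /(_ ne) h] := boxes_mono_right fr (g := 1 + i%:Z) (g' := g); [lia|lia|].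
by rewrite /pos /f'; case: ifP; lia.
Qed.

Definition weight_of nu (K : {K | is_seq nu K}) : mono l := total (sval K).

Lemma frozen_mono M M' nu K : (M <= M')%N -> frozen_at M nu K -> frozen_at M' nu K.
Proof.
move=> MM /frozen_atP [h1 h2 h3]; apply/frozen_atP.
by split=> // g hg; [apply: h1|apply: h2]; lia.
Qed.

Lemma tame_weight nu : tame d (@weight_of nu).
Proof.
move=> N; have [D [D0 hD]] := seq_bound nu.
pose T := `|(N + D)%R|%N; pose M := (N0 + T).+1.
have [rY _ hY] := finite_set_seqP (finite_young `|(boxes nu.1 + boxes nu.2 + T%:Z)%R|%N).
pose dec (f : {ffun 'I_(2 * M) -> 'I_(size rY)}) (g : int) : young :=
  if g <= - M%:Z then nu.2 else if M%:Z <= g then nu.1 else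
  if insub `|(g + M%:Z)%R|%N is Some j then nth young0 rY (f j) else young0.
have := @finite_preimage {classic {K | is_seq nu K}} _ (dec @` [set: _]) (fun u => sval u).
move=> /(_ _ (finite_image _ (@finite_finset _ setT))) fin.
apply: (sub_finite_set _ (fin _)) => [K|]; last by move=> K K' _ _; exact: sval_eq.
move=> /= dK; have [M' fr] := proj2_sig K.
have [|szK fr'] := hD _ _ T fr; first by move: dK; rewrite /weight_of /T; lia.
have /frozen_atP [h1 h2 _] := fr'.
have inY g : (sval K g : {classic young}) \in rY by apply/hY; have := szK g; have := boxes_ge0 nu.1; have := boxes_ge0 nu.2; rewrite /=; lia.
have idxP (i : 'I_(2 * M)) : (index (sval K (i%:Z - M%:Z)%R : {classic young}) rY < size rY)%N by rewrite index_mem.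
exists [ffun i => Ordinal (idxP i)] => //.
apply/funext => g; rewrite /dec; case: (leP g (- M%:Z)) => hg; first by rewrite h1.
case: (leP M%:Z g) => hg'; first by rewrite h2.
case: insubP => [j _ Ej|]; last by rewrite -leqNgt; lia.
rewrite ffunE /=; apply: etrans (@nth_index {classic young} young0 _ _ (inY _)) _.
congr (sval K); rewrite Ej.
have : 0 <= g + M%:Z by lia.
by move=> /gez0_abs ->; rewrite addrK.
Qed.
End Seqs.
End Sequences.

(** * Factorization of finite paths and degree bounds *)
Section Degrees.
Local Open Scope classical_set_scope.
Section Sig.
Variables (l : nat) (d : {ffun var l -> int}).

Lemma gen_series_sig (T : Type) (P : T -> Prop) (f : T -> mono l) m :
  gen_series (fun x : {x | P x} => f (sval x)) m = \sum_(x \in [set x : {classic T} | P x /\ f x = m]) (1 : int).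
Proof.
rewrite /gen_series (@reindex_fsbig _ _ _ {classic {x | P x}} {classic T} (fun u => sval u) [set u | f (sval u) = m]) //.
split.
- by move=> [x p] /= E.
- by move=> x x' _ _; exact: sval_eq.
- by move=> x /= [p E]; exists (exist _ x p).
Qed.

Lemma tame_sub (T : Type) (P Q : T -> Prop) (f : T -> mono l) : (forall x, Q x -> P x) ->
  tame d (fun x : {x | P x} => f (sval x)) -> tame d (fun x : {x | Q x} => f (sval x)).
Proof.
move=> QP h N.
apply: (@finite_preimage {classic {x | Q x}} {classic {x | P x}} _
   (fun u => exist _ (sval u) (QP _ (proj2_sig u))) _ (h N)).
by move=> x x' _ _ [E]; exact: sval_eq.
Qed.

Lemma gen_series_restrict (T : Type) (P : T -> Prop) (f : T -> mono l) m :
  (forall x, f x = m -> P x) -> gen_series f m = gen_series (fun x : {x | P x} => f (sval x)) m.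
Proof.
move=> h; rewrite gen_series_sig /gen_series; apply: eq_fsbigl; apply/seteqP; split=> x /=; last by case.
by move=> E; split=> //; exact: h.
Qed.

Lemma tame_fst (T U : Type) (f : T -> mono l) (g : U -> mono l) (u0 : U) :
  tame d (fun p : T * U => f p.1 + g p.2) -> tame d f.
Proof.
move=> h N.
apply: sub_finite_set (@finite_preimage {classic T} {classic T * U} _ (fun u => (u, u0)) _ (h (N + mdeg d (g u0)))).
  by move=> x /= dx; rewrite mdegD lerD2r.
by move=> x x' _ _ [].
Qed.
End Sig.

Implicit Types (x y z : young).
Section Paths.
Variables (l : nat) (d : {ffun var l -> int}).
Local Notation step := (step (mono l)).
Implicit Types (o : step) (r : seq step).

Lemma steps_le o x y : steps o x y ->
  if shrinks o then forall a, y a <= x a else forall a, x a <= y a.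
Proof. by rewrite /steps /trans; case: ifP => _; exact: strip_leE. Qed.

Lemma path_grow_le r x y : all (predC (@shrinks _)) r -> path r x y -> forall a, x a <= y a.
Proof.
elim: r x => [|o r IH] x /= => [_ [_ ->] //|/andP[so hr] [[z hz] p] a].
apply: le_trans (IH _ hr p a); have := steps_le hz; rewrite (negPf so); exact.
Qed.

(** Starting from the empty diagram, shrinking steps cannot leave it;
growing steps cannot come back to it. *)
Lemma path_vac r r' : all (@shrinks _) r -> all (predC (@shrinks _)) r' ->
  wiso (@path_weight _ (r ++ r') young0 young0) (fun _ : unit => (0 : mono l)).
Proof.
move=> hr hr'.
suff [p0 [hp w0]] : exists p0 : path (r ++ r') young0 young0, (forall p, p = p0) /\ path_weight p0 = 0.
  exists (fun=> tt); last by move=> p; rewrite (hp p).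
  by exists (fun=> p0) => [p|[]]; rewrite ?(hp p).
have K o s : (forall x : {x | steps o young0 x}, path s (sval x) young0 -> sval x = young0) ->
  (exists p0 : path s young0 young0, (forall p, p = p0) /\ path_weight p0 = 0) ->
  exists p0 : path (o :: s) young0 young0, (forall p, p = p0) /\ path_weight p0 = 0.
  move=> h [p0 [hp w0]].
  exists (existT (fun x : {x | steps o young0 x} => path s (sval x) young0)
    (exist (steps o young0) young0 (steps_refl o young0)) p0); split=> [[[x hx] p]|]; last first.
    by rewrite /= subrr mulr0z add0r.
  have E := h (exist _ x hx) p; rewrite /= in E; subst x.
  by rewrite (Prop_irrelevance hx (steps_refl o young0)) (hp p).
elim: r hr => [_|o r IH /= /andP[so /IH h]]; last first.
  apply: K h => -[x hx] /= _; apply: young_le_empty => a.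
  by have := steps_le hx; rewrite so; exact.
elim: r' hr' => [_|o r IH /= /andP[so hr]].
  exists (exist _ tt erefl : path [::] young0 young0); split=> // p.
  by apply: sval_eq; case: (sval p).
by apply: K (IH hr) => -[x hx] /= /(path_grow_le hr); exact: young_le_empty.
Qed.

(** Sorting costs the same scalar for (x, y) as for two empty diagrams,
where the sorted word has a single path by [path_vac]; so this scalar is the
generating series of the paths of r from the empty diagram to itself. *)
Lemma path_factor r x y :
  wiso (@path_weight _ r x y)
    (fun p : path (shrink_first r) x y * path r young0 young0 => path_weight p.1 + path_weight p.2).
Proof.
have [Y [wY H]] := lequiv_sort r.
apply: wiso_trans (H x y) _.
apply: wiso_prod (wiso_refl _) (wiso_sym _).
apply: wiso_trans (H young0 young0) _.
apply: wiso_trans (wiso_prod +%R (path_vac (filter_all _ _) (filter_all _ _)) (wiso_refl wY)) _.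
exists (fun p => p.2); last by move=> p; rewrite /= add0r.
by exists (fun u => (tt, u)) => [[[] ?]|?].
Qed.

(** The degree contributed by one box: a shrinking step multiplies by its
weight for each box removed, a growing step divides by it for each box added. *)
Definition box_degree o : int := if shrinks o then mdeg d (weight o) else - mdeg d (weight o).

Section Bound.
Variable E : int.
Hypothesis E0 : 0 <= E.
Let tolerable o := - E <= box_degree o.

Lemma grow_degree r x y (p : path r x y) : all (predC (@shrinks _)) r -> all tolerable r ->
  - E * (boxes y - boxes x) <= mdeg d (path_weight p).
Proof.
elim: r x p => [|o r IH] x /= p; first by case: p => _ -> _ _; rewrite subrr mulr0 mdeg0.
case: p => [[z hz] p] /= /andP[so hr] /andP[to tr].
have := IH _ p hr tr; have /boxes_le := path_grow_le hr p; rewrite mdegD mdegZ.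
have := steps_le hz; move: to; rewrite /tolerable /box_degree (negPf so) => to /boxes_le.
rewrite -[sval _]/z; move: (mdeg d (weight o)) (mdeg d (path_weight p)) (boxes x) (boxes y) (boxes z) to => D G a b c to.
by nia.
Qed.

(** The paths of a sorted word remove boxes of x and then add boxes of
y, hence move at most |x| + |y| boxes. *)
Lemma path_degree r r' x y (p : path (r ++ r') x y) :
  all (@shrinks _) r -> all (predC (@shrinks _)) r' -> all tolerable r -> all tolerable r' ->
  - E * (boxes x + boxes y) <= mdeg d (path_weight p).
Proof.
move=> hr hr' tr tr'; elim: r x p hr tr => [|o r IH] x /= p.
  move=> _ _; apply: le_trans (grow_degree p hr' tr').
  by have := boxes_ge0 x; have := boxes_ge0 y; nia.
case: p => [[z hz] p] /= /andP[so hr] /andP[to tr].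
have := IH _ p hr tr; rewrite mdegD mdegZ.
have := steps_le hz; move: to; rewrite /tolerable /box_degree so => to /boxes_le.
rewrite -[sval _]/z; move: (mdeg d (weight o)) (mdeg d (path_weight p)) (boxes x) (boxes y) (boxes z) to => D G a b c to.
by nia.
Qed.

Fixpoint idle r o r' x y : path (r ++ o :: r') x y -> Prop :=
  match r return path (r ++ o :: r') x y -> Prop with
  | [::] => fun p => sval (projT1 p) = x
  | o' :: r => fun p => idle (projT2 p)
  end.

Lemma idle_iso r o r' x y :
  wiso (fun p : {p : path (r ++ o :: r') x y | idle p} => path_weight (sval p)) (@path_weight _ (r ++ r') x y).
Proof.
elim: r x => [|o' r IH] x /=.
  apply: wiso_sym.
  exists (fun p : path r' x y => exist (fun q : path (o :: r') x y => sval (projT1 q) = x)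
    (existT (fun z : {z | steps o x z} => path r' (sval z) y) (exist (steps o x) x (steps_refl o x)) p) erefl); last first.
    by move=> p /=; rewrite subrr mulr0z add0r.
  exists (fun q : {q : path (o :: r') x y | sval (projT1 q) = x} =>
     eq_rect _ (fun z => path r' z y) (projT2 (sval q)) _ (proj2_sig q)) => //.
  move=> [[[z hz] p] /= Ez]; subst z.
  by apply: sval_eq => /=; rewrite (Prop_irrelevance hz (steps_refl o x)).
refine (wiso_trans (f := fun p : {p : path ((o' :: r) ++ o :: r') x y | idle (r := o' :: r) p} => path_weight (sval p)) _
 (@wiso_sigma {z | steps o' x z} _
  (fun w => {p : path (r ++ o :: r') (sval w) y | idle p}) (fun w => path (r ++ r') (sval w) y)
  (fun w p => weight o' *~ (boxes x - boxes (sval w)) + path_weight (sval p))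
  (fun w p => weight o' *~ (boxes x - boxes (sval w)) + path_weight p) _)); last first.
  move=> w; exact: (wiso_comp (fun u => weight o' *~ (boxes x - boxes (sval w)) + u) (IH (sval w))).
exists (fun p : {p : path ((o' :: r) ++ o :: r') x y | idle (r := o' :: r) p} =>
  existT (fun w : {z | steps o' x z} => {p : path (r ++ o :: r') (sval w) y | idle p})
    (projT1 (sval p)) (exist _ (projT2 (sval p)) (proj2_sig p))) => //.
exists (fun p : {w : {z | steps o' x z} & {p : path (r ++ o :: r') (sval w) y | idle p}} =>
  exist (fun q : path ((o' :: r) ++ o :: r') x y => idle (r := o' :: r) q)
   (existT (fun z : {z | steps o' x z} => path (r ++ o :: r') (sval z) y) (projT1 p) (sval (projT2 p)))
   (proj2_sig (projT2 p))).
  by move=> [[w p] h].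
by move=> [w [p h]].
Qed.

Lemma boxes_lt_ne o x z : steps o x z -> z <> x ->
  if shrinks o then boxes z < boxes x else boxes x < boxes z.
Proof.
move=> /steps_le; case: ifP => _ le ne; rewrite lt_neqAle boxes_le // andbT; apply/eqP => H.
  by apply: ne; exact: boxes_eq.
by apply: ne; symmetry; exact: boxes_eq.
Qed.

(** If the inserted step moves a box, this box has degree at least
B and the other ones at least - E each. *)
Lemma busy_degree_grow r o r' x y (p : path (r ++ o :: r') x y) (B : int) :
  all (@shrinks _) r -> shrinks o = false -> all (predC (@shrinks _)) r' -> all tolerable r -> all tolerable r' ->
  0 <= B -> B <= box_degree o -> ~ idle p -> B - E * (boxes x + boxes y) <= mdeg d (path_weight p).
Proof.
move=> hr so hr' tr tr' B0 Bo; elim: r x p hr tr => [|o' r IH] x /= p.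
  case: p => [[z hz] p] /= _ _ ne; have := boxes_lt_ne hz ne; rewrite so.
  have := grow_degree p hr' tr'; have /boxes_le := path_grow_le hr' p; rewrite mdegD mdegZ.
  have := boxes_ge0 x; have := boxes_ge0 y; move: Bo; rewrite /box_degree so -[sval _]/z.
  move: (mdeg d (weight o)) (mdeg d (path_weight p)) (boxes x) (boxes y) (boxes z) => D G a b c.
  by nia.
case: p => [[z hz] p] /= /andP[so' hr] /andP[to tr] ne.
have := IH _ p hr tr ne; rewrite mdegD mdegZ.
have := steps_le hz; move: to; rewrite /tolerable /box_degree so' => to /boxes_le.
rewrite -[sval _]/z; move: (mdeg d (weight o')) (mdeg d (path_weight p)) (boxes x) (boxes y) (boxes z) to => D G a b c to.
by nia.
Qed.

Lemma busy_degree_shrink o r r' x y (p : path (o :: r ++ r') x y) (B : int) :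
  shrinks o = true -> all (@shrinks _) r -> all (predC (@shrinks _)) r' -> all tolerable r -> all tolerable r' ->
  0 <= B -> B <= box_degree o -> ~ idle (r := [::]) p -> B - E * (boxes x + boxes y) <= mdeg d (path_weight p).
Proof.
move=> so hr hr' tr tr' B0 Bo; case: p => [[z hz] p] /= ne; have := boxes_lt_ne hz ne; rewrite so.
have := path_degree p hr hr' tr tr'; rewrite mdegD mdegZ.
have := boxes_ge0 x; have := boxes_ge0 y; have := boxes_ge0 z; move: Bo; rewrite /box_degree so -[sval _]/z.
move: (mdeg d (weight o)) (mdeg d (path_weight p)) (boxes x) (boxes y) (boxes z) => D G a b c.
by nia.
Qed.

End Bound.
End Paths.
End Degrees.

(** * The infinite product *)
Section Limit.
Local Open Scope classical_set_scope.
Definition vac : young * young := (young0, young0).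

Section Open.
Variables (l : nat) (oph : int -> step (mono l)).
Implicit Types (A : seq int) (nu : young * young).

(** No scalar arises, because [swap_same] has none. *)
Lemma pequiv_perm (t : bool) A A' r : perm_eq A A' -> all (fun a => shrinks (oph a) == t) A ->
  pequiv (map oph A ++ r) (map oph A' ++ r).
Proof.
elim: A A' => [|a A IH] A'; first by rewrite perm_sym => /perm_nilP -> _; exact: pequiv_refl.
move=> pA; have aA' : a \in A' by rewrite -(perm_mem pA) inE eqxx.
case/splitPr: aA' pA => u v pA /= /andP[/eqP sa hA].
have pA1 : perm_eq A (u ++ v).
  by rewrite -(perm_cons a); apply: perm_trans pA _; rewrite -cat1s perm_catCA perm_refl.
have hu : all (fun a => shrinks (oph a) == t) u.
  by move: hA; rewrite (perm_all _ pA1) all_cat => /andP[].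
apply: pequiv_trans (pequiv_cons (oph a) (IH _ pA1 hA)) _.
rewrite !map_cat -!catA /=; apply: pequiv_bubble.
by rewrite all_map; apply: sub_all hu => b /=; rewrite sa.
Qed.

Lemma pequiv_perm_sort A A' : perm_eq A A' ->
  pequiv (shrink_first (map oph A)) (shrink_first (map oph A')).
Proof.
move=> pA; rewrite /shrink_first !filter_map.
have pf (q : pred int) : perm_eq (filter q A) (filter q A') by exact: perm_filter.
apply: pequiv_trans (pequiv_perm (t := true) _ (pf _) _) _.
  by apply/allP => a; rewrite mem_filter => /andP[/= ->].
apply: pequiv_cat; rewrite -[X in pequiv X]cats0 -[X in pequiv _ X]cats0.
apply: (pequiv_perm (t := false)); first exact: pf.
by apply/allP => a; rewrite mem_filter => /andP[/= /negPf ->].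
Qed.

(** Paths of a sorted word.  Its steps are given by a list A of
half-integers, whose order is irrelevant by [open_perm]. *)
Definition open_series A nu : series l := gen_series (@path_weight _ (shrink_first (map oph A)) nu.2 nu.1).
Local Notation R := open_series.

Lemma open_perm A A' nu : perm_eq A A' -> R A nu = R A' nu.
Proof. by move=> /pequiv_perm_sort h; exact: gen_series_wiso. Qed.

Section Stable.
Variables (d : {ffun var l -> int}) (E : int).
Hypotheses (E0 : 0 <= E) (deg_ge : forall a : int, - E <= box_degree d (oph a)).

Lemma tolerable A (q : pred (step (mono l))) :
  all (fun o => - E <= box_degree d o) (filter q (map oph A)).
Proof. by rewrite filter_map all_map; apply/allP => a _ /=; exact: deg_ge. Qed.

Lemma open_degree A nu m : R A nu m != 0 -> - E * (boxes nu.2 + boxes nu.1) <= mdeg d m.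
Proof.
move=> /gen_series_neq0 [p <-].
by apply: (path_degree E0) => //; rewrite ?filter_all //; exact: tolerable.
Qed.

(** Below degree [B - E * (|nu_-| + |nu_+|)] a step whose boxes have degree
at least B must be idle. *)
Lemma open_insert a A nu (B : int) m : 0 <= B -> B <= box_degree d (oph a) ->
  mdeg d m < B - E * (boxes nu.2 + boxes nu.1) -> R (a :: A) nu m = R A nu m.
Proof.
move=> B0 Ba dm; rewrite /open_series /shrink_first /=; case: ifP => so /=.
  rewrite (@gen_series_restrict _ _ (fun p => idle (r := [::]) p)).
    exact: (congr1 (fun f => f m) (gen_series_wiso (idle_iso [::] (oph a) _ _ _))).
  move=> p wp; apply: contrapT => ne; move: dm; rewrite -wp ltNge => /negP; apply.
  exact: (busy_degree_shrink E0 so (filter_all _ _) (filter_all _ _) (tolerable _ _) (tolerable _ _) B0 Ba ne).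
rewrite (@gen_series_restrict _ _ (fun p => idle p)).
  exact: (congr1 (fun f => f m) (gen_series_wiso (idle_iso _ _ _ _ _))).
move=> p wp; apply: contrapT => ne; move: dm; rewrite -wp ltNge => /negP; apply.
exact: (busy_degree_grow E0 (filter_all _ _) so (filter_all _ _) (tolerable _ _) (tolerable _ _) B0 Ba ne).
Qed.

Lemma open_stable (M0 : nat) (B : int) A nu m : 0 <= B ->
  (forall a : int, M0%:Z < `|a| -> B <= box_degree d (oph a)) ->
  mdeg d m < B - E * (boxes nu.2 + boxes nu.1) ->
  uniq A -> {subset irange M0 <= A} -> R A nu m = R (irange M0) nu m.
Proof.
move=> B0 hB dm uA sub.
pose A1 := [seq a <- A | a \notin irange M0].
have -> : R A nu = R (A1 ++ irange M0) nu.
  apply: open_perm; apply: uniq_perm => //.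
    rewrite cat_uniq filter_uniq // irange_uniq andbT andTb.
    by apply/hasPn => a ha; rewrite mem_filter ha.
  move=> a; rewrite mem_cat mem_filter; case: (boolP (a \in irange M0)) => ha /=; last by rewrite orbF.
  by rewrite sub.
have : all (fun a => a \notin irange M0) A1 by exact: filter_all.
elim: (A1) => [//|a r IH] /= /andP[na /IH <-].
apply: (@open_insert a (r ++ irange M0) nu B m) => //; apply: hB.
by rewrite ltNge -mem_irange.
Qed.

End Stable.

(** The value taken for all large n, which exists under the hypotheses of
[limit_stable].  The definition refers neither to an order of the half-integers
nor to a grading. *)
Definition open_limit nu : series l :=
  fun m => xget 0 [set v | exists n0 : nat, forall n, (n0 <= n)%N -> R (irange n) nu m = v].

Lemma open_limitE nu m v (n0 : nat) : (forall n, (n0 <= n)%N -> R (irange n) nu m = v) ->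
  open_limit nu m = v.
Proof.
move=> h; rewrite /open_limit; case: xgetP => [u -> [n1 hu]|/(_ v)]; last by case; exists n0.
by rewrite -(hu (maxn n0 n1)) ?h //; rewrite ?leq_maxl ?leq_maxr.
Qed.
End Open.

Fixpoint path_refl (V : zmodType) (r : seq (step V)) x : path r x x :=
  match r return path r x x with
  | [::] => exist _ tt erefl
  | o :: r' => existT (fun z : {z | steps o x z} => path r' (sval z) x)
      (exist (steps o x) x (steps_refl o x)) (path_refl r' x)
  end.

Lemma irange_sub (n n' : nat) : (n <= n')%N -> {subset irange n <= irange n'}.
Proof. by move=> h a; rewrite !mem_irange; lia. Qed.

Lemma bounded_range (P : int -> nat -> Prop) (M : nat) :
  (forall g, exists N, P g N) -> (forall g N N', (N <= N')%N -> P g N -> P g N') ->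
  exists N, forall g : int, `|g| <= M%:Z -> P g N.
Proof.
move=> h mono; elim: M => [|M [N IH]].
  by have [N hN] := h 0; exists N => g hg; have -> : g = 0 by lia.
have [A hA] := h M.+1%:Z; have [B hB] := h (- M.+1%:Z).
exists (N + A + B)%N => g hg; case: (leP `|g| M%:Z) => gM.
  by apply: mono (IH g gM); lia.
have [->|->] : g = M.+1%:Z \/ g = - M.+1%:Z by lia.
  by apply: mono hA; lia.
by apply: mono hB; lia.
Qed.

Lemma bounded_abs (f : int -> int) (M : nat) :
  exists n : nat, forall g : int, `|g| <= M%:Z -> `|f g| <= n%:Z.
Proof. by apply: bounded_range => [g|g N N' NN]; [exists `|f g|%N|]; lia. Qed.

Section Ratio.
Variables (l : nat) (oph : int -> step (mono l)) (th thi : int -> int).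
Hypotheses (thK : cancel th thi) (thiK : cancel thi th).
Variables (d : {ffun var l -> int}) (C : int) (N0 : nat).
Let op g := oph (th g).
Hypotheses (deg_op : forall g : int, mdeg d (weight (op g)) = 2 * g + C)
  (op_right : forall g : int, N0%:Z <= g -> shrinks (op g) = true)
  (op_left : forall g : int, g < - N0%:Z -> shrinks (op g) = false).
Implicit Types (nu : young * young).

Let E : int := 2 * N0%:Z + `|C|.

Lemma E_ge0 : 0 <= E. Proof. by rewrite /E; lia. Qed.

Lemma deg_ge a : - E <= box_degree d (oph a).
Proof.
rewrite -[a]thiK -/(op (thi a)) /box_degree deg_op /E.
have := op_right (g := thi a); have := op_left (g := thi a).
case: (leP N0%:Z (thi a)) => hb h1 h2; first by rewrite h2 //; lia.
case: (ltP (thi a) (- N0%:Z)) => ha; first by rewrite h1 //; lia.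
by case: ifP; lia.
Qed.

Lemma deg_far (B : int) : exists M0 : nat, forall a : int, M0%:Z < `|a| -> B <= box_degree d (oph a).
Proof.
pose G := (N0 + `|B| + `|C|)%N; have [n hn] := bounded_abs th G.
exists n => a ha; rewrite -[a]thiK -/(op (thi a)) /box_degree deg_op.
have aG : G%:Z < `|thi a|.
  by rewrite ltNge; apply/negP => /hn; rewrite thiK; lia.
case: (leP N0%:Z (thi a)) => hb; first by rewrite op_right //; rewrite /G in aG; lia.
by rewrite op_left; rewrite /G in aG; lia.
Qed.

(** Far half-integers have boxes of high degree, so inserting them does
not change the coefficients of bounded degree. *)
Lemma limit_stable nu (N : int) : exists M0 : nat, forall A m, uniq A -> {subset irange M0 <= A} ->
  mdeg d m <= N -> open_series oph A nu m = open_limit oph nu m.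
Proof.
pose S := boxes nu.2 + boxes nu.1; have S0 : 0 <= E * S by rewrite mulr_ge0 ?E_ge0 ?addr_ge0 ?boxes_ge0.
pose B := `|N| + 1 + E * S.
have [M0 hM0] := deg_far B; exists M0 => A m uA sA dm.
have B0 : 0 <= B by rewrite /B; lia.
have dmB : mdeg d m < B - E * S by rewrite /B; lia.
have st A' : uniq A' -> {subset irange M0 <= A'} -> open_series oph A' nu m = open_series oph (irange M0) nu m.
  exact: (open_stable E_ge0 deg_ge B0 hM0 dmB).
rewrite st //; symmetry; apply: (@open_limitE _ _ _ _ _ M0) => n hn.
by apply: st; [exact: irange_uniq|exact: irange_sub].
Qed.

Lemma limit_degree nu m : open_limit oph nu m != 0 -> - E * (boxes nu.2 + boxes nu.1) <= mdeg d m.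
Proof.
have [M0 h] := limit_stable nu (mdeg d m).
rewrite -(h (irange M0)) ?irange_uniq //; exact: (open_degree E_ge0 deg_ge).
Qed.

Definition heights (M : nat) : seq int := [seq th (- M%:Z + i%:Z) | i <- iota 0 (2 * M)].

Lemma heights_window M : map oph (heights M) = window op (- M%:Z) (2 * M).
Proof. by rewrite /heights /window -map_comp. Qed.

Lemma heights_uniq M : uniq (heights M).
Proof. by rewrite map_inj_uniq ?iota_uniq // => i j /(can_inj thK); lia. Qed.

Lemma heights_sub M0 : exists M1 : nat, forall M, (M1 <= M)%N -> {subset irange M0 <= heights M}.
Proof.
have [n hn] := bounded_abs thi M0; exists n.+1 => M hM a; rewrite mem_irange => /hn ha.
apply/mapP; exists `|(thi a + M%:Z)%R|%N; first by rewrite mem_iota; lia.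
by rewrite -[LHS]thiK; congr th; lia.
Qed.

Lemma window_frozen M nu :
  wiso (@path_weight _ (window op (- M%:Z) (2 * M)) nu.2 nu.1)
       (fun K : {K | frozen_at op M nu K} => total op (sval K)).
Proof.
apply: wiso_eq (path_frozen op (- M%:Z) (2 * M) nu.2 nu.1) _ _ => // K.
by rewrite -(totalE (proj2_sig K)).
Qed.

Lemma tame_window M nu : tame d (@path_weight _ (window op (- M%:Z) (2 * M)) nu.2 nu.1).
Proof.
apply: tame_wiso (wiso_sym (window_frozen M nu)) _.
apply: (@tame_sub _ _ _ (is_seq op nu)); first by move=> K; exists M.
exact: (tame_weight deg_op op_right op_left).
Qed.

(** By [seq_bound] the sequences of bounded degree are constant outside
a common window. *)
Lemma window_stable nu (N : int) : exists M0 : nat, forall M m, (M0 <= M)%N -> mdeg d m <= N ->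
  gen_series (@path_weight _ (window op (- M%:Z) (2 * M)) nu.2 nu.1) m = gen_series (@weight_of _ op nu) m.
Proof.
have [D [D0 hD]] := seq_bound deg_op op_right op_left nu.
pose T := `|(N + D)%R|%N; exists (N0 + T).+1 => M m hM dm.
rewrite (gen_series_wiso (window_frozen M nu)) gen_series_sig /weight_of gen_series_sig.
apply: eq_fsbigl; apply/seteqP; split=> K /= [h1 h2]; split=> //; first by exists M.
have [M' fr] := h1; apply: (frozen_mono hM).
by have [|//] := hD _ _ T fr; rewrite h2 /T; lia.
Qed.

Lemma window_factor M nu : gen_series (@path_weight _ (window op (- M%:Z) (2 * M)) nu.2 nu.1) =
  smul (gen_series (@path_weight _ (window op (- M%:Z) (2 * M)) young0 young0)) (open_series oph (heights M) nu).
Proof.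
have iso := path_factor (window op (- M%:Z) (2 * M)) nu.2 nu.1.
rewrite (gen_series_wiso iso) smulC /open_series heights_window.
have t0 := tame_window M vac.
have := tame_wiso iso (tame_window M nu).
case: (pselect (exists p : path (window op (- M%:Z) (2 * M)) young0 young0, True)) => [[p0 _]|ne].
  by move=> /(tame_fst p0) t1; apply: (@gen_seriesM _ d).
by case: ne; exists (path_refl _ _).
Qed.

(** [path_factor] for a window large enough for the three series at
once.  The vacuum series has nonnegative degrees and the open series has degrees
at least - E (|nu_-| + |nu_+|), so that only a bounded range of degrees of each
enters the coefficient of m. *)
Theorem series_factor nu : gen_series (@weight_of _ op nu) =
  smul (gen_series (@weight_of _ op vac)) (open_limit oph nu).
Proof.
apply/funext => m.
pose S := boxes nu.2 + boxes nu.1; have S0 : 0 <= E * S by rewrite mulr_ge0 ?E_ge0 ?addr_ge0 ?boxes_ge0.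
have [M1 h1] := window_stable nu (mdeg d m).
have [M2 h2] := window_stable vac (mdeg d m + E * S).
have [M3 h3] := limit_stable nu (mdeg d m).
have [M4 h4] := heights_sub M3.
pose M := (M1 + M2 + M4)%N.
rewrite -(h1 M m) ?window_factor //; last by rewrite /M; lia.
have vac_ge a : gen_series (@weight_of _ op vac) a != 0 -> 0 <= mdeg d a.
  move=> /gen_series_neq0 [[K [M' fr]] <-]; rewrite /weight_of (deg_total deg_op fr) /=.
  by rewrite subrr mulr0 add0r mulr_ge0 // addr_ge0 // sumr_ge0 // => i _; rewrite boxes0 subr0 boxes_ge0.
have win_ge a : gen_series (@path_weight _ (window op (- M%:Z) (2 * M)) young0 young0) a != 0 -> 0 <= mdeg d a.
  rewrite (gen_series_wiso (window_frozen M vac)) => /gen_series_neq0 [[K fr] <-]; rewrite (deg_total deg_op fr) /=.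
  by rewrite subrr mulr0 add0r mulr_ge0 // addr_ge0 // sumr_ge0 // => i _; rewrite boxes0 subr0 boxes_ge0.
apply: eq_fsbigr => a _.
case: (ltP (mdeg d a) 0) => a0.
  have -> : gen_series (@path_weight _ (window op (- M%:Z) (2 * M)) young0 young0) a = 0.
    by apply/eqP; apply: contraTT a0 => /win_ge; rewrite -leNgt.
  have -> : gen_series (@weight_of _ op vac) a = 0.
    by apply/eqP; apply: contraTT a0 => /vac_ge; rewrite -leNgt.
  by rewrite !mul0r.
have -> : open_series oph (heights M) nu (m - a) = open_limit oph nu (m - a).
  apply: h3; [exact: heights_uniq|apply: h4; rewrite /M; lia|rewrite mdegB; lia].
case: (eqVneq (open_limit oph nu (m - a)) 0) => [->|/limit_degree]; first by rewrite !mulr0.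
rewrite mdegB mulNr -/S => dma; congr (_ * _); apply: (h2 M a); first by rewrite /M; lia.
lia.
Qed.

Lemma laurent_limit nu : laurent d (open_limit oph nu).
Proof.
move=> N; have [M3 h3] := limit_stable nu N; have [M4 h4] := heights_sub M3.
have t : tame d (@path_weight _ (shrink_first (map oph (heights M4))) nu.2 nu.1).
  rewrite heights_window.
  have iso := path_factor (window op (- M4%:Z) (2 * M4)) nu.2 nu.1.
  exact: (tame_fst (path_refl _ _) (tame_wiso iso (tame_window M4 nu))).
apply: sub_finite_set (laurent_gen_series t N) => m /= [nz dm]; split=> //.
by move: nz; rewrite -(h3 (heights M4)) ?heights_uniq //; apply: h4.
Qed.

(** For empty nu the degree of a sequence is twice the total number of its
boxes, by [deg_total]. *)
Lemma vac_lead : gen_series (@weight_of _ op vac) 0 = 1 /\ forall m, gen_series (@weight_of _ op vac) m != 0 -> m = 0 \/ 0 < mdeg d m.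
Proof.
clear op_right op_left E N0.
have key K : is_seq op vac K -> K = (fun=> young0) \/ 0 < mdeg d (total op K).
  move=> [M fr]; rewrite (deg_total deg_op fr) /= subrr mulr0 add0r.
  case: (pselect (K = fun=> young0)) => [|ne]; [by left|right].
  have [g hg] : exists g, K g <> young0.
    by apply: contrapT => nex; apply: ne; apply/funext => g; apply: contrapT => h; apply: nex; exists g.
  have sg : 0 < boxes (K g) by rewrite lt_neqAle boxes_ge0 andbT eq_sym; apply/eqP => /boxes_eq0.
  have /frozen_atP [f1 f2 _] := fr.
  rewrite mulr_gt0 //; case: (leP g 0) => g0.
    have gM : (`|g| < M)%N by rewrite ltnNge; apply/negP => Mg; apply: hg; apply: f1; lia.
    apply: ltr_wpDr; first by apply: sumr_ge0 => i _; rewrite boxes0 subr0 boxes_ge0.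
    apply: (lt_le_trans _ (@sum_ge_term (fun i => boxes (K (- i%:Z)) - boxes young0) _ _ gM _)).
      by rewrite boxes0 subr0; have -> : - `|g|%N%:Z = g by lia.
    by move=> i; rewrite boxes0 subr0 boxes_ge0.
  have gM : (`|g|.-1 < M)%N.
    by rewrite ltnNge; apply/negP => Mg; apply: hg; apply: f2; lia.
  apply: ltr_wpDl; first by apply: sumr_ge0 => i _; rewrite boxes0 subr0 boxes_ge0.
  apply: (lt_le_trans _ (@sum_ge_term (fun i => boxes (K (1 + i%:Z)) - boxes young0) _ _ gM _)).
    by rewrite boxes0 subr0; have -> : 1 + `|g|.-1%:Z = g by lia.
  by move=> i; rewrite boxes0 subr0 boxes_ge0.
have fr0 : frozen_at op 0 vac (fun=> young0) by apply/frozen_atP; split=> // g; exact: steps_refl.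
have t0 : total op (fun=> young0) = 0.
  by rewrite /total fsbig1 // => g _; rewrite /cost subrr mulr0z.
split; last first.
  move=> m /gen_series_neq0 [[K hK] <-]; rewrite /weight_of /=.
  by have [->|] := key K hK; [left|right].
rewrite gen_series_sig (_ : [set K | _] = [set (fun=> young0 : young) : {classic int -> young}]) ?fsbig_set1 //.
apply/seteqP; split=> K /= => [[hK tK]|->]; last by split=> //; exists 0%N.
by have [//|] := key K hK; rewrite tK mdeg0.
Qed.

End Ratio.
End Limit.

(** * Perfect matchings as local conditions *)
Section Matchings.
Local Open Scope classical_set_scope.
(** Combinatorics of a vertex of degree 3: one of its edges against the
other two. *)
Lemma unique3 (T : Type) (P : T -> Prop) (a b c : T) : a <> b -> a <> c -> b <> c ->
  (exists! e, P e /\ [\/ e = a, e = b | e = c]) <->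
  (P a <-> ~ (P b \/ P c)) /\ ~ (P b /\ P c).
Proof.
move=> ab ac bc; split=> [[e [[Pe he] u]]|[h1 h2]].
  have n p q : p <> q -> [\/ p = a, p = b | p = c] -> [\/ q = a, q = b | q = c] -> ~ (P p /\ P q).
    by move=> pq hp hq [Pp Pq]; apply: pq; rewrite -(u p) ?(u q).
  have ia : [\/ a = a, a = b | a = c] by constructor 1.
  have ib : [\/ b = a, b = b | b = c] by constructor 2.
  have ic : [\/ c = a, c = b | c = c] by constructor 3.
  have := n _ _ ab ia ib; have := n _ _ ac ia ic; have := n _ _ bc ib ic.
  by case: he Pe => -> Pe; tauto.
have [p|na] := pselect (P a); [exists a|have [p|nb] := pselect (P b); [exists b|exists c; have p : P c by apply: contrapT; tauto]].
all: split; first by split; [tauto|do ?[by constructor 1|by constructor 2|by constructor 3]].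
all: by move=> e' [pe [E|E|E]]; subst e' => //; tauto.
Qed.

Lemma unique4 (T : Type) (P : T -> Prop) (a b c d : T) :
  a <> b -> a <> c -> a <> d -> b <> c -> b <> d -> c <> d ->
  (exists! e, P e /\ [\/ e = a, e = b, e = c | e = d]) <->
  [/\ (P a \/ P b) <-> ~ (P c \/ P d), ~ (P a /\ P b) & ~ (P c /\ P d)].
Proof.
move=> ab ac ad bc bd cd; split=> [[e [[Pe he] u]]|[h1 h2 h3]].
  have n p q : p <> q -> [\/ p = a, p = b, p = c | p = d] ->
      [\/ q = a, q = b, q = c | q = d] -> ~ (P p /\ P q).
    by move=> pq hp hq [Pp Pq]; apply: pq; rewrite -(u p) ?(u q).
  have [ia ib] : [\/ a = a, a = b, a = c | a = d] /\ [\/ b = a, b = b, b = c | b = d].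
    by split; [constructor 1|constructor 2].
  have [ic id] : [\/ c = a, c = b, c = c | c = d] /\ [\/ d = a, d = b, d = c | d = d].
    by split; [constructor 3|constructor 4].
  have := n _ _ ab ia ib; have := n _ _ ac ia ic; have := n _ _ ad ia id.
  have := n _ _ bc ib ic; have := n _ _ bd ib id; have := n _ _ cd ic id.
  by case: he Pe => -> Pe; split; tauto.
have [p|na] := pselect (P a); [exists a|have [p|nb] := pselect (P b); [exists b|
  have [p|nc] := pselect (P c); [exists c|
  exists d; have p : P d by apply: contrapT; tauto]]].
all: split; first by split; [tauto|do ?[by constructor 1|by constructor 2|by constructor 3|by constructor 4]].
all: by move=> e' [pe [E|E|E|E]]; subst e' => //; tauto.
Qed.

Lemma hbelow_inj (a b : int) : hbelow a = hbelow b -> a = b.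
Proof. exact: addIr. Qed.

Section Graph.
Variables (l : nat) (sigma : 'I_l.+1 -> sign) (theta : Theta l).
Local Notation ts := (tsigma sigma theta).
Local Notation inH := (inH sigma theta).
Local Notation is_edge := (is_edge sigma theta).
Local Notation is_vertex := (is_vertex sigma theta).
Local Notation color := (color sigma theta).
Local Notation left_end := (left_end sigma theta).
Local Notation right_end := (right_end sigma theta).
Local Notation joined := (joined sigma theta).
Local Notation perfect_matching := (perfect_matching sigma theta).
Local Notation Vset := (Vset sigma theta).
Implicit Types (D : set edge) (e : edge) (v : vertex) (h k n m : int).

(** The left end of the edges of column h at height m, whether the site is
split or not; [rvert] is the right end. *)
Definition lvert h m := if inH h then Vr h m else V h m.
Definition rvert h m := if inH (h + 1) then Vl h m else V (h + 1) m.

Lemma left_endE h k : left_end (Es h k) = lvert h (if oddz (h - k) then k else k + 1).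
Proof. by []. Qed.

Lemma right_endE h k : right_end (Es h k) = rvert h (if oddz (h - k) then k + 1 else k).
Proof. by []. Qed.

Lemma lvert_inj h m h' m' : lvert h m = lvert h' m' -> h = h' /\ m = m'.
Proof. by rewrite /lvert; case: ifP => _; case: ifP => _ []. Qed.

Lemma rvert_inj h m h' m' : rvert h m = rvert h' m' -> h = h' /\ m = m'.
Proof. by rewrite /rvert; case: ifP => _; case: ifP => _ [] // E ->; split=> //; lia. Qed.

Lemma lrvert h m h' m' : lvert h m = rvert h' m' -> h = h' + 1.
Proof. by rewrite /lvert /rvert; case: ifP => _; case: ifP => _ []. Qed.

Lemma ends_inj e e' : left_end e = left_end e' -> right_end e = right_end e' -> e = e'.
Proof.
case: e => [n m|h k]; case: e' => [n' m'|h' k'].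
- by move=> [/hbelow_inj -> ->].
- by rewrite left_endE /lvert /=; case: ifP.
- by rewrite left_endE /lvert /=; case: ifP.
rewrite !left_endE !right_endE => /lvert_inj [-> E1] /rvert_inj [_ E2].
by congr Es; move: E1 E2; case: ifP => _; case: ifP => _; lia.
Qed.

(** Twice the abscissa, which tells the two ends of an edge apart. *)
Definition vx v : int :=
  match v with V n _ => 2 * n | Vl h _ => 2 * (h : int) + 1 | Vr h _ => 2 * (h : int) + 1 end.

Lemma ends_cross e e' : left_end e = right_end e' -> right_end e = left_end e' -> False.
Proof.
case: e => [n m|h k]; case: e' => [n' m'|h' k'].
- by [].
- rewrite left_endE right_endE /= /lvert /rvert => /(congr1 vx) E1 /(congr1 vx) E2.
  by move: E1 E2; rewrite /hbelow /habove; repeat (case: ifP => _ /=); unfold halfint in *; lia.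
- rewrite left_endE right_endE /= /lvert /rvert => /(congr1 vx) E1 /(congr1 vx) E2.
  by move: E1 E2; rewrite /hbelow /habove; repeat (case: ifP => _ /=); unfold halfint in *; lia.
rewrite !left_endE !right_endE => /lrvert E1 E2.
by have := lrvert (esym E2); lia.
Qed.

Lemma ends_valid e : is_edge e -> [/\ is_vertex (left_end e), is_vertex (right_end e) &
  color (right_end e) = ~~ color (left_end e)].
Proof.
case: e => [n m|h k] /=.
  move=> /andP[hn on]; rewrite /above /hbelow /habove /below subrK hn on; split=> //.
  by rewrite negbK.
move=> _; rewrite -/(lvert _ _) -/(rvert _ _) /below /above.
have o1 : oddz (h - (if oddz (h - k) then k else k + 1)).
  by case: ifP => // /negbT; rewrite /oddz; lia.
have o2 : oddz (h + 1 - (if oddz (h - k) then k + 1 else k)).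
  by case: ifP => [|/negbT]; rewrite /oddz; lia.
have cl m : color (lvert h m) = ts h.
  by rewrite /lvert; case: ifP.
have cr m : color (rvert h m) = ~~ ts h.
  rewrite /rvert; case hh : (inH (h + 1)); move: hh; rewrite /Defs.inH /hbelow /habove addrK /=.
    by rewrite /tsigmaH /habove /above => /eqP ->.
  by rewrite /habove; case: (ts h); case: (ts (h + 1)).
split; last by rewrite cr cl.
  move: (if oddz (h - k) then k else k + 1) o1 => m o.
  by rewrite /lvert; case: ifP => hh /=; rewrite /below hh.
move: (if oddz (h - k) then k + 1 else k) o2 => m o.
by rewrite /rvert; case: ifP => hh /=; rewrite /above hh.
Qed.

Definition incident e v : Prop := left_end e = v \/ right_end e = v.

(** The graph has no multiple edges, so a unique neighbour is a unique incident
edge. *)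
Lemma star D c v : (forall e, D e -> is_edge e) -> is_vertex v -> color v = c ->
  (exists! w, Vset (~~ c) w /\ joined D v w) <-> (exists! e, D e /\ incident e v).
Proof.
move=> De vv cv; split.
  move=> [w [[[ww cw] [e hD ends]] uw]]; exists e; split.
    by split=> //; case: ends => -[? ?]; [left|right].
  move=> e' [hD' inc]; have [vl vr co] := ends_valid (De _ hD').
  have : exists w', Vset (~~ c) w' /\ ((left_end e' = v /\ right_end e' = w') \/ (left_end e' = w' /\ right_end e' = v)).
    case: inc => E; [exists (right_end e')|exists (left_end e')]; split=> //; try by [left|right].
      by split=> //; rewrite co E cv.
    by split=> //; rewrite -cv -E co negbK.
  move=> [w' [hw' ends']]; have /uw E : Vset (~~ c) w' /\ joined D v w' by split=> //; exists e'.
  subst w'; case: ends => -[E1 E2]; case: ends' => -[E1' E2'].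
  - by apply: ends_inj; rewrite ?E1 ?E2.
  - by case: (@ends_cross e e'); rewrite ?E1 ?E2.
  - by case: (@ends_cross e e'); rewrite ?E1 ?E2.
  - by apply: ends_inj; rewrite ?E1 ?E2.
move=> [e [[hD inc] ue]]; have [vl vr co] := ends_valid (De _ hD).
have uniq w : joined D v w -> (left_end e = v /\ right_end e = w) \/ (left_end e = w /\ right_end e = v).
  move=> [e' hD' ends]; have -> : e = e'; last exact: ends.
  by apply: ue; split=> //; case: ends => -[? ?]; [left|right].
case: inc => E.
  exists (right_end e); split; first by split; [split=> //; rewrite co E cv|exists e => //; left].
  move=> w [[_ cw] /uniq []] [] // E1 E2; move: co; rewrite E E2.
  by case: (color v).
exists (left_end e); split; first by split; [split=> //; rewrite -cv -E co negbK|exists e => //; right].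
move=> w [[_ cw] /uniq []] [] // E1 E2; move: co; rewrite E E1.
by case: (color v).
Qed.

Lemma joinedC D u v : joined D u v <-> joined D v u.
Proof. by split=> -[e hD ends]; exists e => //; tauto. Qed.

Lemma perfect_matchingP D : perfect_matching D <->
  (forall e, D e -> is_edge e) /\
  forall v, is_vertex v -> exists! e, D e /\ incident e v.
Proof.
have jC u : joined D u = joined D^~ u by apply/funext => v; exact/propext/joinedC.
split=> [[De h1 h2]|[De h]].
  split=> // v vv; case E : (color v).
    by apply/(star De vv E); apply: h1.
  by apply/(star De vv E); have := h2 v; rewrite jC; apply.
split=> // [u [vu cu]|v [vv cv]]; first by have := (star De vu cu).2 (h u vu).
by have := (star De vv cv).2 (h v vv); rewrite jC.
Qed.

Lemma inc_V n m e : ~~ inH n -> oddz (n - m) -> incident e (V n m) <->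
  [\/ e = Es n m, e = Es n (m - 1), e = Es (n - 1) m | e = Es (n - 1) (m - 1)].
Proof.
move=> hn on; have lE m' : lvert n m' = V n m' by rewrite /lvert (negPf hn).
have rE m' : rvert (n - 1) m' = V n m' by rewrite /rvert subrK (negPf hn).
rewrite /incident; split.
  case: e => [n' m'|h k]; first by case.
  rewrite left_endE right_endE => -[].
    rewrite -lE => /lvert_inj [-> <-].
    by case: ifP => o; [constructor 1|constructor 2; rewrite addrK].
  rewrite -rE => /rvert_inj [-> <-].
  by case: ifP => o; [constructor 4; rewrite addrK|constructor 3].
have o1 : oddz (n - (m - 1)) = false by move: on; rewrite /oddz; lia.
have o2 : oddz (n - 1 - m) = false by move: on; rewrite /oddz; lia.
have o3 : oddz (n - 1 - (m - 1)) by move: on; rewrite /oddz; lia.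
by case=> ->; [left|left|right|right]; rewrite ?left_endE ?right_endE ?on ?o1 ?o2 ?o3 ?lE ?rE ?subrK.
Qed.

Lemma inc_Vr n m e : inH n -> oddz (n - m) -> is_edge e -> incident e (Vr n m) <->
  [\/ e = Eh n m, e = Es n m | e = Es n (m - 1)].
Proof.
move=> hn on _; have lE m' : lvert n m' = Vr n m' by rewrite /lvert hn.
rewrite /incident; split.
  case: e => [n' m'|h k]; first by case=> // -[E ->]; constructor 1; rewrite -E.
  rewrite left_endE right_endE => -[]; last by rewrite /rvert; case: ifP.
  rewrite -lE => /lvert_inj [-> <-].
  by case: ifP => o; [constructor 2|constructor 3; rewrite addrK].
have o1 : oddz (n - (m - 1)) = false by move: on; rewrite /oddz; lia.
by case=> ->; [right|left|left]; rewrite ?left_endE ?on ?o1 ?lE ?subrK.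
Qed.

Lemma inc_Vl n m e : inH n -> oddz (n - m) -> is_edge e -> incident e (Vl (n - 1) m) <->
  [\/ e = Eh n m, e = Es (n - 1) m | e = Es (n - 1) (m - 1)].
Proof.
move=> hn on _; have rE m' : rvert (n - 1) m' = Vl (n - 1) m' by rewrite /rvert subrK hn.
rewrite /incident; split.
  case: e => [n' m'|h k]; first by case=> // -[E ->]; constructor 1; rewrite (hbelow_inj (E : hbelow n' = hbelow n)).
  rewrite left_endE right_endE => -[]; first by rewrite /lvert; case: ifP.
  rewrite -rE => /rvert_inj [-> <-].
  by case: ifP => o; [constructor 3; rewrite addrK|constructor 2].
have o2 : oddz (n - 1 - m) = false by move: on; rewrite /oddz; lia.
have o3 : oddz (n - 1 - (m - 1)) by move: on; rewrite /oddz; lia.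
by case=> ->; [left|right|right]; rewrite ?right_endE ?o2 ?o3 ?rE ?subrK.
Qed.

(** For each m exactly one of (h, m) and (h + 1, m) is a site, and its edges in
column h are [Es h m] and [Es h (m - 1)]. *)
Definition touches D h m : Prop := D (Es h m) \/ D (Es h (m - 1)).

(** Each vertex is matched once.  A site with n in H consists of two
vertices joined by [Eh n m]: either this edge is used, or both vertices are
matched in the columns on their side.  Other sites are matched on exactly one
side. *)
Lemma matching_local D : perfect_matching D <->
  [/\ forall n m, D (Eh n m) -> inH n && oddz (n - m),
      forall h m, ~ (D (Es h m) /\ D (Es h (m - 1))) &
      forall n m, oddz (n - m) ->
        if inH n then (D (Eh n m) <-> ~ touches D n m) /\ (D (Eh n m) <-> ~ touches D (n - 1) m)
        else touches D n m <-> ~ touches D (n - 1) m].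
Proof.
have Esne h k k' : k <> k' -> Es h k <> Es h k' by move=> ne [].
have Esne' h h' k k' : h <> h' -> Es h k <> Es h' k' by move=> ne [].
have exP (P Q : edge -> Prop) : (forall e, P e <-> Q e) -> (exists! e, P e) <-> (exists! e, Q e).
  by move=> PQ; have -> : P = Q by apply/funext => e; apply/propext.
rewrite perfect_matchingP.
have mm (m : int) : m <> m - 1 by lia.
have nn (n : int) : n <> n - 1 by lia.
have V4 n m : ~~ inH n -> oddz (n - m) -> (exists! e, D e /\ incident e (V n m)) <->
    [/\ touches D n m <-> ~ touches D (n - 1) m, ~ (D (Es n m) /\ D (Es n (m - 1))) &
        ~ (D (Es (n - 1) m) /\ D (Es (n - 1) (m - 1)))].
  move=> hn on; rewrite -unique4; try by [apply: Esne|apply: Esne'].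
  by apply: exP => e; rewrite inc_V.
split=> [[De h]|[De ex h]].
  have Vr3 n m : inH n -> oddz (n - m) ->
      (D (Eh n m) <-> ~ touches D n m) /\ ~ (D (Es n m) /\ D (Es n (m - 1))).
    move=> hn on; rewrite -(@unique3 _ D) //; last exact: Esne.
    have := h (Vr n m); rewrite /= /below hn on => /(_ isT); apply: (exP _ _ _).1 => e.
    by split=> -[p q]; split=> //; move: q; rewrite inc_Vr //; exact: De.
  have Vl3 n m : inH n -> oddz (n - m) ->
      (D (Eh n m) <-> ~ touches D (n - 1) m) /\ ~ (D (Es (n - 1) m) /\ D (Es (n - 1) (m - 1))).
    move=> hn on; rewrite -(@unique3 _ D) //; last exact: Esne.
    have := h (Vl (n - 1) m); rewrite /= /above subrK hn on => /(_ isT); apply: (exP _ _ _).1 => e.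
    by split=> -[p q]; split=> //; move: q; rewrite inc_Vl //; exact: De.
  split=> [n m /De //|c m|n m on].
    case: (boolP (oddz (c - m))) => on.
      case: (boolP (inH c)) => hc; first by have [] := Vr3 _ _ hc on.
      have := h (V c m); rewrite /= (negPf hc) on => /(_ isT) /V4.
      by case.
    have on' : oddz (c + 1 - m) by move: on; rewrite /oddz; lia.
    case: (boolP (inH (c + 1))) => hc; first by have := Vl3 _ _ hc on'; rewrite addrK => -[].
    have := h (V (c + 1) m); rewrite /= (negPf hc) on' => /(_ isT) /V4; rewrite addrK.
    by case.
  case: ifP => hn; first by split; [have [] := Vr3 _ _ hn on|have [] := Vl3 _ _ hn on].
  by have := h (V n m); rewrite /= hn on => /(_ isT) /V4; rewrite hn; case.
split=> [[n m|//] /De //|]; case=> [n m|c m|c m] /= /andP[hc on].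
- by apply/V4 => //; have := h n m on; rewrite (negPf hc); split.
- have := h (c + 1) m on; rewrite [inH _]hc => -[_ hl].
  have on' : oddz (c + 1 - m) by exact: on.
  have : (exists! e, D e /\ [\/ e = Eh (c + 1) m, e = Es (c + 1 - 1) m | e = Es (c + 1 - 1) (m - 1)]).
    by apply/unique3 => //; exact: Esne.
  apply: (exP _ _ _).1 => e.
  have iE := @inc_Vl (c + 1) m e hc on'.
  rewrite addrK in iE *; split=> -[p q]; split=> //; apply/iE => //;
    by case: e p {q iE} => [? ? /De|].
have := h c m on; rewrite [inH _]hc => -[hr _].
have on' : oddz (c - m) by exact: on.
have : (exists! e, D e /\ [\/ e = Eh c m, e = Es c m | e = Es c (m - 1)]).
  by apply/unique3 => //; exact: Esne.
apply: (exP _ _ _).1 => e.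
have iE := @inc_Vr c m e hc on'.
by split=> -[p q]; split=> //; apply/iE => //; case: e p {q iE} => [? ? /De|].
Qed.
End Graph.
End Matchings.

(** * Columns of the dimer graph *)
Section Columns.
Local Open Scope classical_set_scope.
Lemma slopeE (e : young) (k : int) : slope e k = (e (k + 1) == e k + 1).
Proof. by rewrite /slope /above /below; apply/eqP/eqP; move: (e k) (e (k + 1)) => u v; lia. Qed.

Lemma young_slope_eq (e f : young) : (forall k : int, slope e k = slope f k) -> e = f.
Proof.
move=> h; have [N hN] : exists N : nat, forall a : int, N%:Z <= `|a| -> e a = f a.
  by have [N h1] := young_far e; have [M h2] := young_far f; exists (maxn N M) => a ha; rewrite h1 ?h2 //; lia.
apply: young_eq => a; case: (leP (- N%:Z) a) => ha; last by apply: hN; lia.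
move: a ha; apply: int_ind_from; first by apply: hN; lia.
move=> a _ E; have := h a; rewrite !slopeE.
have := young_step e a; have := young_step f a; move: (e (a + 1)) (f (a + 1)) => u v; rewrite E.
by lia.
Qed.

Section Column.
Variables (l : nat) (sigma : 'I_l.+1 -> sign) (lam : halfint -> sign) (theta : Theta l).
Local Notation ts := (tsigma sigma theta).
Local Notation tl := (tlam lam theta).
Local Notation inH := (inH sigma theta).
Local Notation F := (F lam theta).
Implicit Types (K : int -> young) (h k n m u a : int) (e f : young).

Lemma F_next h : F (h + 1) = F h - sgn (tl h).
Proof. by rewrite F_rec addrK /hbelow addrK. Qed.

(** So F n is an admissible origin for the heights over n, up to the shift
by one in [site]. *)
Lemma F_parity n : oddz (F n - n) = false.
Proof.
have step h : oddz (F (h + 1) - (h + 1)) = oddz (F h - h).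
  by rewrite F_next /oddz /sgn; case: (tl h); lia.
have up (j : nat) : oddz (F j%:Z - j%:Z) = false.
  elim: j => [|j IH]; first by rewrite F0 subrr.
  by rewrite -addn1 PoszD step.
have down (j : nat) : oddz (F (- j%:Z) - (- j%:Z)) = false.
  elim: j => [|j IH]; first by rewrite oppr0 F0 subrr.
  by rewrite -step; have -> : - j.+1%:Z + 1 = - j%:Z by lia.
by case: n => j; [exact: up|rewrite NegzE; exact: down].
Qed.

(** The sites over n, numbered relatively to the path F: in this numbering the
boundary conditions no longer depend on n. *)
Definition site n k : int := F n + 2 * k + 1.

Lemma site_odd n k : oddz (n - site n k).
Proof. by have := F_parity n; rewrite /site /oddz; lia. Qed.

Lemma siteP n m : oddz (n - m) -> exists k, m = site n k.
Proof.
move=> o; exists ((m - F n) %/ 2)%Z; have := F_parity n; move: o; rewrite /site /oddz; lia.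
Qed.

Lemma site_inj n k k' : site n k = site n k' -> k = k'.
Proof. by rewrite /site; lia. Qed.

(** The edges of column h, numbered so that [slot h (2 * a)] are the odd edges
and that [slot h (2 * k + 1)] joins the sites number k on both sides
([touches_left], [touches_right]). *)
Definition slot h u : int := F h + u - (tl h : nat)%:Z.

Lemma slot_inj h u u' : slot h u = slot h u' -> u = u'.
Proof. by rewrite /slot; lia. Qed.

Lemma slotP h k : exists u, k = slot h u.
Proof. by exists (k - F h + (tl h : nat)%:Z); rewrite /slot; lia. Qed.

Lemma slot_pred h u : slot h u - 1 = slot h (u - 1).
Proof. by rewrite /slot; lia. Qed.

Lemma dbl_slot h u : dbl (slot h u) = F (below h) + F (above h) + 2 * u.
Proof. by rewrite /dbl /slot /below /above F_next /sgn; case: (tl h) => /=; lia. Qed.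

Lemma odd_slot h u : odd_edge lam theta h (slot h u) = ~~ oddz u.
Proof.
have := F_parity h; rewrite /odd_edge /signed /slot; case: (tl h) => /=; rewrite /oddz; lia.
Qed.

Lemma touches_left D h k : touches D h (site h k) <->
  D (Es h (slot h (2 * k + 1))) \/ D (Es h (slot h (2 * k + 1 + sgn (tl h)))).
Proof.
rewrite /touches /site /slot; case: (tl h) => /=.
  have -> : F h + 2 * k + 1 - 1 = F h + (2 * k + 1) - 1%:Z by lia.
  have -> : F h + 2 * k + 1 = F h + (2 * k + 1 + 1) - 1%:Z by lia.
  by tauto.
have -> : F h + 2 * k + 1 - 1 = F h + (2 * k + 1 - 1) - 0%:Z by lia.
by have -> : F h + 2 * k + 1 = F h + (2 * k + 1) - 0%:Z by lia.
Qed.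

Lemma touches_right D h k : touches D h (site (h + 1) k) <->
  D (Es h (slot h (2 * k + 1))) \/ D (Es h (slot h (2 * k + 1 - sgn (tl h)))).
Proof.
rewrite /touches /site /slot F_next; case: (tl h) => /=.
  have -> : F h - 1 + 2 * k + 1 - 1 = F h + (2 * k + 1 - 1) - 1%:Z by lia.
  have -> : F h - 1 + 2 * k + 1 = F h + (2 * k + 1) - 1%:Z by lia.
  by tauto.
have -> : F h - - 1 + 2 * k + 1 - 1 = F h + (2 * k + 1) - 0%:Z by lia.
have -> : F h - - 1 + 2 * k + 1 = F h + (2 * k + 1 - - 1) - 0%:Z by lia.
by tauto.
Qed.

(** The odd edge number 2 a of the column is used when the profile moves at
a. *)
Definition moved e f a : bool := e a != f a.
(** The even edge number 2 k + 1 of the column is used when the step k of the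
profile has the sign s on both sides.  Testing one of the two ends of the step is
enough, see [column_facts]. *)
Definition stays (s t : sign) e f k : bool :=
  (slope e k == s) && ~~ moved e f (if t then k + 1 else k).

(** If the profile moves at a, the strip condition and parity force the
step of e on one side of a and the step of f on the other side to have sign s;
which sides they are only depends on t.  All other steps of sign s are common to
e and f. *)
Lemma column_facts (s t : sign) e f k : trans s (s == t) e f ->
  [/\ (slope e k == s) = stays s t e f k || moved e f (if t then k + 1 else k),
      (slope f k == s) = stays s t e f k || moved e f (if t then k else k + 1),
      ~~ (stays s t e f k && moved e f k) &
      ~~ (stays s t e f k && moved e f (k + 1))].
Proof.
rewrite /trans /strip /stays /moved !slopeE.
have := young_step e k; have := young_step f k.
have [k1 E1] := young_parity e k; have [k2 E2] := young_parity f k.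
case: s; case: t => /= sf se h; have := h k; have := h (k + 1); clear h; rewrite ?addrK ?eqb_id ?eqbF_neg;
  move: (e (k + 1)) (f (k + 1)) (e (k + 1 + 1)) (f (k + 1 + 1)) (e (k - 1)) (f (k - 1)) (e k) (f k) E1 E2 sf se;
  move=> e1 f1 e2 f2 e_ f_ e0 f0 E1 E2 s1 s2 h1 h2; clear - E1 E2 s1 s2 h1 h2; split; lia.
Qed.

(** Conversely the used edges of a column and the diagram on its left
determine the diagram on its right: move the profile at the odd edges. *)
Lemma column_step (s t : sign) (x : int -> bool) (e : young) :
  (forall u, ~~ (x u && x (u - 1))) ->
  (exists N : nat, forall a, N%:Z <= `|a| -> x (2 * a) = false) ->
  (forall k, (slope e k == s) = x (2 * k + 1) || x (2 * k + 1 + sgn t)) ->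
  exists f : young, trans s (s == t) e f /\ forall k,
    [/\ moved e f k = x (2 * k), stays s t e f k = x (2 * k + 1) &
        (slope f k == s) = x (2 * k + 1) || x (2 * k + 1 - sgn t)].
Proof.
move=> adj [N xfar] left.
(* Heights change by two units, downwards when the strip is removed. *)
pose d : int := if s == t then -2 else 2.
pose g a : int := e a + (if x (2 * a) then d else 0).
have left' k : ((e (k + 1) == e k + 1) == s) = x (2 * k + 1) || x (2 * (if t then k + 1 else k)).
  by rewrite -slopeE left; case: (t) => /=; congr (_ || x _); lia.
have adj' k : ~~ (x (2 * k + 1) && x (2 * k)) /\ ~~ (x (2 * (k + 1)) && x (2 * k + 1)).
  have := adj (2 * k + 1); have := adj (2 * (k + 1)).
  have -> : 2 * k + 1 - 1 = 2 * k by lia.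
  by have -> : 2 * (k + 1) - 1 = 2 * k + 1 by lia.
have step k : g k - g (k - 1) = 1 \/ g k - g (k - 1) = -1.
  have := left' (k - 1); have [] := adj' (k - 1); have := young_step e (k - 1); rewrite !subrK /g /d.
  clear left' g d; move: left => _; case: (s); case: (t) => /=; rewrite ?eqb_id ?eqbF_neg;
  move: (e k) (e (k - 1)) (x (2 * (k - 1) + 1)) (x (2 * (k - 1))) (x (2 * k)) => e1 e0 [] [] [] /=; lia.
have far : exists N : int, forall n : int, N < `|n| -> g n = `|n|.
  have [M h] := young_far e; exists (N%:Z + M%:Z) => n hn.
  by rewrite /g xfar ?h ?addr0 //; lia.
pose f := Young far step.
have tr : trans s (s == t) e f.
  rewrite /trans /strip; move: left'; rewrite /f /= /g /d; clear - adj' => left'.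
  case: (s) (t) left' => -[] /= left' a.
  1,2: have := left' a; have [] := adj' a; have := young_step e a; rewrite ?eqb_id ?eqbF_neg;
    by move: (e a) (e (a + 1)) (x (2 * a + 1)) (x (2 * a)) (x (2 * (a + 1))) => e0 e1 [] [] [] /=; lia.
  1,2: have := left' (a - 1); have [] := adj' (a - 1); have := young_step e (a - 1);
    rewrite !subrK ?eqb_id ?eqbF_neg;
    by move: (e a) (e (a - 1)) (x (2 * (a - 1) + 1)) (x (2 * (a - 1))) (x (2 * a)) => e0 e1 [] [] [] /=; lia.
have mv k : moved e f k = x (2 * k).
  rewrite /moved /f /= /g /d; case: (x (2 * k)); last by rewrite addr0 eqxx.
  by apply/eqP; case: ifP => _; lia.
have st k : stays s t e f k = x (2 * k + 1).
  rewrite /stays mv slopeE left'; have [] := adj' k.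
  by case: (t) => /=; case: (x (2 * k + 1)); case: (x (2 * k)); case: (x (2 * (k + 1))).
exists f; split=> // k; split=> //.
have [_ -> _ _] := column_facts k tr; rewrite mv st; congr (_ || x _).
by case: (t) => /=; lia.
Qed.

(** The edge [Eh n m] is used when its site is matched in neither of the two
adjacent columns, that is when the step of the profile has the sign opposite to
[ts n]. *)
Definition edges_of K : set edge := [set e | match e with
  | Eh n m => inH n /\ exists2 k, m = site n k & slope (K n) k != ts n
  | Es h k' => exists k, k' = slot h (2 * k) /\ moved (K h) (K (h + 1)) k \/
      k' = slot h (2 * k + 1) /\ stays (ts h) (tl h) (K h) (K (h + 1)) k
  end].

Lemma edges_of_moved K h k :
  edges_of K (Es h (slot h (2 * k))) <-> moved (K h) (K (h + 1)) k.
Proof.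
split=> [[k' []] [/slot_inj E]|mv]; last by exists k; left.
  by have -> : k = k' by lia.
by lia.
Qed.

Lemma edges_of_stays K h k :
  edges_of K (Es h (slot h (2 * k + 1))) <-> stays (ts h) (tl h) (K h) (K (h + 1)) k.
Proof.
split=> [[k' []] [/slot_inj E]|st]; last by exists k; right.
  by lia.
by have -> : k = k' by lia.
Qed.

Lemma edges_of_site K n k :
  edges_of K (Eh n (site n k)) <-> inH n /\ slope (K n) k != ts n.
Proof.
split=> [[hn [k' /site_inj ->]]|[hn E]]; first by [].
by split=> //; exists k.
Qed.

Lemma parity_cases u : exists k, u = 2 * k \/ u = 2 * k + 1.
Proof. by exists (u %/ 2)%Z; lia. Qed.

Definition walk K : Prop := forall h, trans (ts h) (ts h == tl h) (K h) (K (h + 1)).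

Section Walk.
Variable K : int -> young.
Hypothesis wK : walk K.

Lemma walk_left n k : touches (edges_of K) n (site n k) <-> slope (K n) k == ts n.
Proof.
rewrite touches_left edges_of_stays; have [-> _ _ _] := column_facts k (wK n).
have -> : 2 * k + 1 + sgn (tl n) = 2 * (if tl n then k + 1 else k) by case: (tl n) => /=; lia.
by rewrite edges_of_moved; split=> [|/orP //] [] -> //; rewrite orbT.
Qed.

Lemma walk_right n k : touches (edges_of K) (n - 1) (site n k) <-> slope (K n) k == ts (n - 1).
Proof.
have := touches_right (edges_of K) (n - 1) k; have [_ + _ _] := column_facts k (wK (n - 1)).
rewrite subrK => -> ->; rewrite edges_of_stays subrK.
have -> : 2 * k + 1 - sgn (tl (n - 1)) = 2 * (if tl (n - 1) then k else k + 1).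
  by case: (tl _) => /=; lia.
by rewrite edges_of_moved subrK; split=> [|/orP //] [] -> //; rewrite orbT.
Qed.

(** Site k over n is matched in the column on the right (on the left) if
and only if the step k of [K n] has sign [ts n] (of sign [ts (n - 1)]).  These
signs agree for n in H and are opposite otherwise, which is [matching_local]. *)
Lemma walk_matching : perfect_matching sigma theta (edges_of K).
Proof.
apply/matching_local; split=> [n m [hn [k -> _]]|h m|n m on].
- by rewrite hn site_odd.
- have [u ->] := slotP h m; rewrite slot_pred.
  have [k [->|->]] := parity_cases u.
    have -> : 2 * k - 1 = 2 * (k - 1) + 1 by lia.
    rewrite edges_of_moved edges_of_stays => -[h1 h2].
    by have [_ _ _] := column_facts (k - 1) (wK h); rewrite subrK h1 h2.
  rewrite addrK edges_of_moved edges_of_stays => -[h1 h2].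
  by have [_ _ +  _] := column_facts k (wK h); rewrite h1 h2.
have [k ->] := siteP on.
rewrite (propext (walk_left n k)) (propext (walk_right n k)) (propext (edges_of_site K n k)).
rewrite /Defs.inH /hbelow /habove; case: ifP => [/eqP ->|].
  by rewrite eqxx; split; split=> [[_ /negP]|/negP] //; split.
by case: (ts n); case: (ts (n - 1)); case: (slope (K n) k); intuition.
Qed.

End Walk.

Lemma edges_of_ext K K' n : K n = K' n -> forall m, edges_of K (Eh n m) <-> edges_of K' (Eh n m).
Proof. by move=> E m; rewrite /edges_of /= E. Qed.

Lemma edges_of_ext2 K K' h : K h = K' h -> K (h + 1) = K' (h + 1) ->
  forall k, edges_of K (Es h k) <-> edges_of K' (Es h k).
Proof. by move=> E E' k; rewrite /edges_of /= E E'. Qed.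

(** The boundary condition is the configuration of a constant
sequence. *)
Lemma Pyoung_const e : Pyoung sigma lam theta e = edges_of (fun=> e).
Proof.
apply/seteqP; split=> -[n m|h k'] /=.
- move=> [k [hn sn ->]]; split=> //; exists k; first by rewrite /site /dbl; lia.
  by move: sn; rewrite /tsigmaH /habove => ->; case: (slope e k).
- move=> [k [sh E]]; exists k; right; split; last first.
    by rewrite /stays /moved eqxx sh eqxx.
  have [u Eu] := slotP h k'; move: E; rewrite Eu dbl_slot => E; congr slot.
  by move: E; rewrite /dbl; move: (F (below h) + F (above h)) => B; lia.
- move=> [hn [k -> E]]; exists k; split=> //; last by rewrite /site /dbl; lia.
  by move: E; rewrite /tsigmaH /habove; case: (slope e k); case: (ts n).
move=> [k [] [-> ]]; rewrite /stays /moved eqxx // andbT => /eqP E.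
by exists k; split; rewrite ?E // dbl_slot /dbl; lia.
Qed.
End Column.
End Columns.

(** * Dimer configurations are sequences of diagrams *)
Section Dimers.
Local Open Scope classical_set_scope.
Definition far (N : nat) (e : young) : Prop := forall a : int, N%:Z <= `|a| -> e a = `|a|.

Lemma far_le (N N' : nat) e : (N <= N')%N -> far N e -> far N' e.
Proof. by move=> NN h a ha; apply: h; lia. Qed.

Lemma slope_far (N : nat) (e : young) (k : int) : far N e ->
  (N%:Z <= k -> slope e k = true) /\ (k < - N%:Z -> slope e k = false).
Proof.
by move=> h; split=> hk; rewrite slopeE !h; lia.
Qed.

(** Parity excludes larger differences of heights. *)
Lemma strip_excess (s : sign) (e f : young) (a : int) : strip s e f ->
  excess f a - excess e a = (e a != f a : nat)%:Z.
Proof.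
move=> h; have [k1 E1] := young_parity e a; have [k2 E2] := young_parity f a.
have := excessE e a; have := excessE f a; have [] := h a.
have := young_step e a; have := young_step e (a - 1); rewrite subrK.
move: (excess e a) (excess f a) => x y.
by clear h; case: s => /=; move: (e a) (f a) E1 E2 (e (a + 1)) (e (a - 1)) => e0 f0 E1 E2 u v; lia.
Qed.

Lemma trans_boxes (s t : sign) (N : nat) (e f : young) : far N e -> far N f -> trans s (s == t) e f ->
  boxes e - boxes f = sgn s * sgn t * \sum_(a <- irange N) (moved e f a : nat)%:Z.
Proof.
move=> he hf tr.
have out a : N%:Z < `|a| -> excess e a = 0 /\ excess f a = 0.
  by move=> ha; have := excessE e a; have := excessE f a; rewrite he ?hf; lia.
have E : sgn s * sgn t = if s == t then 1 else -1 by case: (s); case: (t).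
rewrite E boxes_diff (@fsum_irange _ _ N); last by move=> a /out [-> ->].
rewrite big_distrr /=; apply: eq_bigr => a _; rewrite /moved.
move: tr; rewrite /trans; case: (s == t) => h.
  by rewrite (strip_excess a h) eq_sym mul1r.
by rewrite -opprB (strip_excess a h) mulN1r.
Qed.

Section Correspondence.
Variables (l : nat) (sigma : 'I_l.+1 -> sign) (lam : halfint -> sign) (theta : Theta l).
Local Notation ts := (tsigma sigma theta).
Local Notation tl := (tlam lam theta).
Local Notation inH := (inH sigma theta).
Local Notation F := (F lam theta).
Local Notation slot := (slot lam theta).
Local Notation site := (site lam theta).
Local Notation walk := (walk sigma lam theta).
Local Notation edges_of := (edges_of sigma lam theta).
Implicit Types (K : int -> young) (h k n m u a : int) (e f : young) (nu : young * young).

(** The step attached to a half-integer, independently of theta. *)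
Definition column_op (h : int) : step (mono l) :=
  Step (sigma (proj l h)) (sigma (proj l h) == lam h) (wt sigma lam h).

Definition theta_op (g : int) : step (mono l) := column_op (theta g).

Lemma seq_walk nu K : is_seq theta_op nu K -> walk K.
Proof. by move=> [M /frozen_atP [_ _ h]] g; exact: h. Qed.

Lemma seq_far M nu K : frozen_at theta_op M nu K -> exists N, forall g, far N (K g).
Proof.
move=> /frozen_atP [h1 h2 _].
have [N hN] : exists N, forall g : int, `|g| <= M%:Z -> far N (K g).
  apply: bounded_range => [g|g N N']; last exact: far_le.
  by have [N h] := young_far (K g); exists N.
exists N => g; case: (leP g (- M%:Z)) => hg.
  by rewrite h1 // -(h1 (- M%:Z)) //; apply: hN; lia.
case: (leP M%:Z g) => hg'; last by apply: hN; lia.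
by rewrite h2 // -(h2 M%:Z) //; apply: hN; lia.
Qed.

(** In the middle strip, finitely many diagrams are involved; above
and below all of them their profiles are the lines of slope 1 and -1, as
prescribed by [Pinf]. *)
Lemma edges_of_dimer nu K : is_seq theta_op nu K -> dimer sigma lam theta nu (edges_of K).
Proof.
move=> sK; have wK := seq_walk sK; have [M fr] := sK; have [N hN] := seq_far fr.
have /frozen_atP [h1 h2 _] := fr; split; first exact: walk_matching.
exists M%:Z; split.
- by move=> [n m|h k] /= hx; rewrite Pyoung_const; [apply: edges_of_ext|apply: edges_of_ext2];
  apply: h2; move: hx; rewrite ?/dbl; unfold halfint in *; lia.
- by move=> [n m|h k] /= hx; rewrite Pyoung_const; [apply: edges_of_ext|apply: edges_of_ext2];
  apply: h1; move: hx; rewrite ?/dbl; unfold halfint in *; lia.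
have [B hB] := bounded_abs F M.
(* Over |n| <= M, site k and the slots 2 k and 2 k + 1 lie at height 2 k up to an error of B + 1. *)
exists (2 * N%:Z + B%:Z + 5); case=> [n m|h k'] /= hx.
  have hn : `|F n| <= B%:Z by apply: hB; lia.
  have key s k : slope (K n) k = s -> edges_of K (Eh n (site n k)) <->
      (inH n && oddz (n - site n k) /\ tsigmaH sigma theta n = ~~ s).
    move=> E; rewrite edges_of_site E site_odd andbT /tsigmaH /habove.
    by case: (s); case: (ts n); intuition.
  have out m' : ~~ oddz (n - m') -> forall s, edges_of K (Eh n m') <->
      (inH n && oddz (n - m') /\ tsigmaH sigma theta n = ~~ s).
    move=> /negP o s; split=> [[hn' [k E]]|[/andP[_ /o]]] //.
    by case: o; rewrite E site_odd.
  case: (boolP (oddz (n - m))) => [o|o]; last by split=> _; exact: out.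
  have [k Ek] := siteP lam theta o; rewrite Ek.
  have [s1 s2] := slope_far k (hN n); split=> hy; apply: key.
    by apply: s1; move: hy; rewrite /site; lia.
  by apply: s2; move: hy; rewrite /site; lia.
have hh : `|h| <= M%:Z /\ `|h + 1| <= M%:Z /\ `|F h| <= B%:Z.
  have : `|h| <= M%:Z by move: hx; rewrite /dbl; unfold halfint in *; lia.
  by move=> ?; split=> //; split; [move: hx; rewrite /dbl; unfold halfint in *; lia|exact: hB].
have [hM [hM' hF]] := hh; have [u Eu] := slotP lam theta h k'; rewrite Eu.
have even s k : N%:Z <= `|k| -> edges_of K (Es h (slot h (2 * k))) <->
    (true /\ ts h = s /\ ~~ odd_edge lam theta h (slot h (2 * k))).
  move=> hk; rewrite edges_of_moved odd_slot /moved !hN // eqxx.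
  by split=> // -[_ [_]]; rewrite /oddz; lia.
have odd s k : N%:Z <= `|k| -> N%:Z <= `|k + 1| -> slope (K h) k = s ->
    edges_of K (Es h (slot h (2 * k + 1))) <->
    (true /\ ts h = s /\ ~~ odd_edge lam theta h (slot h (2 * k + 1))).
  move=> hk hk' E; have hif : N%:Z <= `|if tl h then k + 1 else k| by case: (tl h).
  rewrite edges_of_stays odd_slot /stays E /moved !hN //.
  rewrite eqxx andbT negbK; have -> : oddz (2 * k + 1) by rewrite /oddz; lia.
  by split=> [/eqP ->|[_ [->]]].
have [j Ej] := parity_cases u; case: Ej => Ek; rewrite Ek.
  by split=> hy; apply: even; move: hy; rewrite ?Ek /dbl /slot; unfold halfint in *; case: (tl h) => /=; lia.
have [s1 s2] := slope_far j (hN h).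
split=> hy; move: hy; rewrite ?Ek /dbl /slot; unfold halfint in * => hy.
  have hk : N%:Z <= j by move: hy; case: (tl h) => /=; lia.
  by apply: odd; [lia|lia|exact: s1].
have hk : j < - N%:Z - 1 by move: hy; case: (tl h) => /=; lia.
by apply: odd; [lia|lia|apply: s2; lia].
Qed.

(** The matched sites over n give the signs of all steps of [K n]. *)
Lemma edges_of_inj K K' : walk K -> walk K' -> edges_of K = edges_of K' -> K = K'.
Proof.
move=> wK wK' E.
apply/funext => n; apply: young_slope_eq => k.
have := walk_left wK n k; rewrite E => /propext; rewrite (propext (walk_left wK' n k)).
move=> /propeqP [p q].
by case: (slope (K n) k) p q; case: (slope (K' n) k); case: (ts n) => /= p q //; first [have := p isT | have := q isT].
Qed.

(** Only odd edges have a weight, and those of a column are the boxes of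
its strip, added or removed according to [sgn (ts h) * sgn (tl h)]. *)
Lemma weight_edges_of nu K : is_seq theta_op nu K ->
  \sum_(e \in edges_of K) edge_weight sigma lam theta e = total theta_op K.
Proof.
move=> sK; have wK := seq_walk sK; have [M fr] := sK; have [N hN] := seq_far fr.
have /frozen_atP [h1 h2 _] := fr.
rewrite (totalE fr) fsbig_mkcond.
pose r := [seq Es (- M%:Z + i%:Z)%R (slot (- M%:Z + i%:Z)%R (2 * a)) | i <- iota 0 (2 * M), a <- irange N].
rewrite (@fsumT_seq _ _ _ r).
- rewrite /r big_allpairs_dep -(big_mkord xpredT (fun i : nat => cost theta_op K (- M%:Z + i%:Z))) /index_iota subn0.
  apply: eq_bigr => i _; move: (- M%:Z + i%:Z) => h.
  rewrite /cost /= (trans_boxes (hN h) (hN (h + 1)) (wK h)) mulrzA mulrz_sumr.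
  apply: eq_bigr => a _; rewrite /patch.
  have -> : (Es h (slot h (2 * a)) \in edges_of K) = moved (K h) (K (h + 1)) a.
    by apply/idP/idP => [/set_mem /edges_of_moved|/edges_of_moved /mem_set].
  have o : odd_edge lam theta h (slot h (2 * a)) by rewrite odd_slot /oddz; lia.
  by case: (moved _ _ _); rewrite ?mulr1z ?mulr0z //= o.
- apply: allpairs_uniq; [exact: iota_uniq|exact: irange_uniq|].
  move=> [i a] [j b] _ _ [E E2]; have Eij : i = j by lia.
  by subst j; move: E2 => /slot_inj E2; congr pair; lia.
case=> [n m|h k']; rewrite /patch; first by case: ifP; rewrite /= ?eqxx.
case: ifP => [/set_mem|_]; last by rewrite eqxx.
have [u ->] := slotP lam theta h k'; have [k [->|->]] := parity_cases u; last first.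
  have o : odd_edge lam theta h (slot h (2 * k + 1)) = false by rewrite odd_slot /oddz; lia.
  by move=> _; rewrite /= o eqxx.
rewrite edges_of_moved => mv _; apply/allpairsP.
have hM : - M%:Z <= h < M%:Z.
  case: (ltP h (- M%:Z)) => hh; first by move: mv; rewrite /moved !h1 ?eqxx //; lia.
  case: (ltP h M%:Z) => hh' //; by move: mv; rewrite /moved !h2 ?eqxx //; lia.
exists (`|(h + M%:Z)%R|%N, k); rewrite /= mem_iota mem_irange; split; first by lia.
  by rewrite leNgt; apply/negP => hk; move: mv; rewrite /moved !hN ?eqxx //; lia.
by have -> : - M%:Z + `|(h + M%:Z)%R|%N%:Z = h by lia.
Qed.

Section Inverse.
Variables (nu : young * young) (D : set edge).
Hypothesis dD : dimer sigma lam theta nu D.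

(** The sites over n matched in the column on their right are the steps of sign
[ts n] of e: this determines e ([reads_unique]). *)
Definition reads n e : Prop := forall k, touches D n (site n k) <-> slope e k == ts n.

Lemma reads_unique n e f : reads n e -> reads n f -> e = f.
Proof.
move=> he hf; apply: young_slope_eq => k; have := he k; rewrite (propext (hf k)).
by case: (slope e k); case: (slope f k); case: (ts n) => /= -[p q] //; first [have := p isT | have := q isT].
Qed.

Definition uses h u : bool := `[< D (Es h (slot h u)) >].

Lemma usesP h u : reflect (D (Es h (slot h u))) (uses h u).
Proof. exact: asboolP. Qed.

Lemma uses_adj h u : ~~ (uses h u && uses h (u - 1)).
Proof.
have [/matching_local [_ h2 _] _] := dD.
by apply/negP => /andP[/usesP p /usesP q]; apply: (h2 h (slot h u)); rewrite slot_pred.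
Qed.

(** The two cases of [matching_local] at once. *)
Lemma touches_next n k : touches D (n + 1) (site (n + 1) k) <->
  (touches D n (site (n + 1) k) <-> ts n == ts (n + 1)).
Proof.
have [/matching_local [_ _ h3] _] := dD.
have := h3 (n + 1) (site (n + 1) k) (site_odd _ _ _ _); rewrite addrK /Defs.inH /hbelow /habove addrK.
have yes : is_true true by []. have no : ~ is_true false by [].
have [p|p] := pselect (touches D n (site (n + 1) k));
have [q|q] := pselect (touches D (n + 1) (site (n + 1) k));
by case: (ts n == ts (n + 1)); tauto.
Qed.

(** Each column meets one of the boundary conditions on the right, on
the left, or at the top and bottom, and none of them uses odd edges. *)
Lemma column_bound h : exists N : nat, forall a, N%:Z <= `|a| -> uses h (2 * a) = false.
Proof.
have [_ [m1 [h1 h2 [m2 h3]]]] := dD.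
have young_even e a : ~ Pyoung sigma lam theta e (Es h (slot h (2 * a))).
  by rewrite Pyoung_const edges_of_moved /moved eqxx.
have inf_even s a : ~ Pinf sigma lam theta s (Es h (slot h (2 * a))).
  by move=> [_ [_]]; rewrite odd_slot /oddz; lia.
case: (ltP (2 * m1) (dbl h)) => hr.
  exists 0%N => a _; apply/usesP; rewrite h1 //; exact: young_even.
case: (ltP (2 * m1) (- dbl h)) => hl.
  exists 0%N => a _; apply/usesP; rewrite h2 //; exact: young_even.
exists (`|m2| + `|F h| + 2)%N => a ha; apply/usesP.
have hx : `|xpos (Es h (slot h (2 * a)))| <= 2 * m1 by move: hr hl; rewrite /xpos; unfold halfint in *; lia.
have [p q] := h3 _ hx.
case: (ltP 0 a) => a0; [rewrite p|rewrite q]; try exact: inf_even; rewrite /ypos /dbl /slot; case: (tl h) => /=; lia.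
Qed.

(** The next diagram exists by [column_step]. *)
Lemma reads_next n e : reads n e -> exists f, [/\ reads (n + 1) f, trans (ts n) (ts n == tl n) e f &
  forall k, moved e f k = uses n (2 * k) /\ stays (ts n) (tl n) e f k = uses n (2 * k + 1)].
Proof.
move=> he; have left k : (slope e k == ts n) = uses n (2 * k + 1) || uses n (2 * k + 1 + sgn (tl n)).
  by apply/idP/orP => [/he/touches_left|] h; [|apply/he/touches_left]; case: h => /usesP; tauto.
have [f [tr h]] := column_step (@uses_adj n) (column_bound n) left.
exists f; split=> // k; last by have [] := h k.
have [_ _ E] := h k; have : touches D n (site (n + 1) k) <-> slope f k == ts n.
  rewrite touches_right E; split=> [|/orP] [] /usesP; try tauto; first by move->.
  by move->; rewrite orbT.
rewrite (propext (touches_next n k)) => ->.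
by case: (slope f k); case: (ts n); case: (ts (n + 1)); intuition.
Qed.

Lemma reads_const (n : int) e : (forall k, touches D n (site n k) <-> touches (edges_of (fun=> e)) n (site n k)) ->
  reads n e.
Proof.
move=> h k; rewrite h; apply: walk_left => g.
by rewrite /trans; case: ifP => _; exact: strip_refl.
Qed.

(** The diagrams are constructed from the left, starting with nu_-; on the
right they are equal to nu_+ because they are determined by the configuration. *)
Lemma dimer_edges_of : exists K, is_seq theta_op nu K /\ edges_of K = D.
Proof.
have [_ [m1 [h1 h2 _]]] := dD; pose M := `|m1|.+1.
(* m1 may be negative, hence the absolute value in M. *)
have right n : M%:Z <= n -> reads n nu.1.
  move=> hn; apply: reads_const => k; rewrite -Pyoung_const /touches.
  by rewrite !h1 // /xpos /dbl; lia.
have left n : n <= - M%:Z -> reads n nu.2.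
  move=> hn; apply: reads_const => k; rewrite -Pyoung_const /touches.
  by rewrite !h2 // /xpos /dbl; lia.
have /choice [K hK] : forall n, exists e, reads n e.
  move=> n; case: (leP n (- M%:Z)) => hn; first by exists nu.2; exact: left.
  move/ltW: hn; move: n; apply: int_ind_from; first by exists nu.2; exact: left.
  by move=> n _ [e he]; have [f [hf _ _]] := reads_next he; exists f.
have next n : trans (ts n) (ts n == tl n) (K n) (K (n + 1)) /\ forall k,
    moved (K n) (K (n + 1)) k = uses n (2 * k) /\ stays (ts n) (tl n) (K n) (K (n + 1)) k = uses n (2 * k + 1).
  by have [f [hf tr h]] := reads_next (hK n); rewrite (reads_unique (hK (n + 1)) hf).
have wK : walk K by move=> n; have [] := next n.
exists K; split.
  exists M; apply/frozen_atP; split=> // n hn; apply: reads_unique (hK n) _; [exact: left|exact: right].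
have [/matching_local [hE _ h3] _] := dD.
apply/seteqP; split=> -[n m|h k'].
- move=> [hn [k -> E]]; have := h3 n (site n k) (site_odd _ _ _ _); rewrite hn => -[-> _].
  by rewrite (propext (hK n k)); apply/negP.
- have [u ->] := slotP lam theta h k'; have [k [->|->]] := parity_cases u.
    by move=> /edges_of_moved; rewrite ((next h).2 k).1 => /usesP.
  by move=> /edges_of_stays; rewrite ((next h).2 k).2 => /usesP.
- move=> DE; have /andP[hn on] := hE _ _ DE; have [k Ek] := siteP lam theta on; subst m.
  apply/edges_of_site; split=> //; apply/negP => /(hK n k).
  by have := h3 n _ on; rewrite hn => -[[+ _] _]; exact.
have [u ->] := slotP lam theta h k'; have [k [->|->]] := parity_cases u => /usesP.
  by rewrite -((next h).2 k).1 => /edges_of_moved.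
by rewrite -((next h).2 k).2 => /edges_of_stays.
Qed.
End Inverse.

Lemma dimers_are_sequences nu :
  wiso (fun K : {K | is_seq theta_op nu K} => prefactor sigma lam theta + @weight_of _ theta_op nu K)
       (fun D : {D | dimer sigma lam theta nu D} => dimer_weight sigma lam theta (sval D)).
Proof.
have /choice [psi psiP] : forall D, exists K, dimer sigma lam theta nu D ->
    is_seq theta_op nu K /\ edges_of K = D.
  by move=> D; have [/dimer_edges_of [K hK]|nD] := pselect (dimer sigma lam theta nu D);
    [exists K|exists (fun=> young0)].
apply: (@wiso_sig _ _ _ (is_seq theta_op nu) (dimer sigma lam theta nu)
  (fun K => prefactor sigma lam theta + total theta_op K) _ edges_of psi) => [K sK|D /psiP //].
have dK := edges_of_dimer sK; have [sK' E] := psiP _ dK; split=> //.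
  exact: edges_of_inj (seq_walk sK') (seq_walk sK) E.
by rewrite /dimer_weight (weight_edges_of sK).
Qed.

End Correspondence.
End Dimers.

(** * Gradings adapted to theta and the quotient *)
Section Conclusion.
Local Open Scope classical_set_scope.
Section Grading.
Variables (l : nat) (b : nat -> int).
Local Notation L := l.+1.

(** q_+ and q_- have the same degree.  The parameters b leave one constant
free for each class of half-integers modulo L, up to a common one, while the
total degree of Q_+ and Q_- is fixed to 2 L. *)
Definition grading : {ffun var l -> int} := [ffun v : var l => (match v with
  | inl _ => L%:Z - (b l - b 0%N)
  | inr i => 2 * (b (i : nat).+1 - b i) end : int)].

Lemma mdeg_grading (m : mono l) : mdeg grading m =
  (L%:Z - (b l - b 0%N)) * (m (inl true) + m (inl false)) +
  \sum_(i < l) 2 * (b (i : nat).+1 - b i) * m (inr i).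
Proof.
rewrite /mdeg big_sumType /= big_bool /= !ffunE mulrDr; congr (_ + _).
by apply: eq_bigr => i _; rewrite ffunE.
Qed.

Lemma telescope (j : nat) : (j <= l)%N ->
  \sum_(i < l) 2 * (b (i : nat).+1 - b i) * (i < j)%N%:R = 2 * (b j - b 0%N).
Proof.
move=> jl; rewrite -(big_mkord xpredT (fun i => 2 * (b i.+1 - b i) * (i < j)%N%:R)).
rewrite (big_cat_nat (n := j)) //= [X in _ + X]big1_seq ?addr0; last first.
  by move=> i /=; rewrite mem_index_iota => /andP[ji _]; rewrite ltnNge ji mulr0.
elim: j {jl} => [|j IH]; first by rewrite big_geq // subrr mulr0.
rewrite big_nat_recr //= ltnSn mulr1.
rewrite (@eq_big_nat _ _ _ _ _ _ (fun i => 2 * (b i.+1 - b i) * (i < j)%N%:R)).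
  by rewrite IH; lia.
by move=> i /andP[_ ij]; rewrite ij ltnS (ltnW ij).
Qed.

Lemma telescope_all : \sum_(i < l) 2 * (b (i : nat).+1 - b i) = 2 * (b l - b 0%N).
Proof. by rewrite -(telescope (leqnn l)); apply: eq_bigr => i _; rewrite ltn_ord mulr1. Qed.

Lemma mdeg_Q s (x : int) (j : 'I_L) : mdeg grading (Qsg l s *~ x + qsgj s j) =
  2 * L%:Z * x + (L%:Z + b 0%N - b l) + 2 * (b j - b 0%N).
Proof.
rewrite mdeg_grading !QsgE.
under eq_bigr do rewrite QsgE mulrDr.
have jl : (j <= l)%N by rewrite -ltnS.
rewrite big_split /= (telescope jl) -mulr_suml telescope_all.
by case: s => /=; rewrite ?mul1r ?mul0r; ring.
Qed.

Lemma mdeg_q s1 s2 : mdeg grading (qsg l s1 + qsg l s2 + \sum_(i < l) qn i) = 2 * L%:Z.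
Proof.
rewrite mdeg_grading !qstepE.
under eq_bigr do rewrite qstepE mulr1.
by rewrite telescope_all; case: s1; case: s2 => /=; ring.
Qed.

(** Known far on the right by the asymptotics of w, and then everywhere
because w(h) / w(h - L) always has degree 2 L. *)
Lemma mdeg_wt (sigma : 'I_L -> sign) (lam : halfint -> sign) (h : int) : asymptotics sigma lam ->
  mdeg grading (wt sigma lam h) =
  2 * L%:Z * (quo l h - c_lam sigma lam (proj l h)) + (L%:Z + b 0%N - b l) + 2 * (b (proj l h) - b 0%N).
Proof.
move=> /wtP [[N h1] h2].
have key (k : nat) (g : int) : N < g + k%:Z * L%:Z -> mdeg grading (wt sigma lam g) =
   2 * L%:Z * (quo l g - c_lam sigma lam (proj l g)) + (L%:Z + b 0%N - b l) + 2 * (b (proj l g) - b 0%N).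
  elim: k g => [|k IH] g hg; first by rewrite (h1 g).1 ?mdeg_Q //; lia.
  have := IH (g + L%:Z); have -> : g + L%:Z + k%:Z * L%:Z = g + k.+1%:Z * L%:Z by lia.
  move=> /(_ hg); have := congr1 (mdeg grading) (h2 (g + L%:Z)).
  have := quo_shift l (g + L%:Z); have := proj_shift l (g + L%:Z).
  rewrite addrK mdegB mdeg_q => -> -> E.
  move: E; move: (mdeg _ _) (mdeg _ _) => u v; move: (2 * _) => D.
  move: (quo _ _) (c_lam _ _ _) (_ + _ - _) (2 * _) => q c X Y E E'.
  have -> : u = v - D by rewrite -E subKr.
  by rewrite E'; ring.
by apply: (key `|(N - h)%R|.+1); nia.
Qed.
End Grading.

Section Theta.
Variables (l : nat) (theta : Theta l).
Local Notation L := l.+1.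

Lemma shift_mul (f : int -> int) : (forall h, f (h + L%:Z) = f h + L%:Z) ->
  forall (k h : int), f (h + k * L%:Z) = f h + k * L%:Z.
Proof.
move=> fL; have up (k : nat) h : f (h + k%:Z * L%:Z) = f h + k%:Z * L%:Z.
  elim: k h => [|k IH] h; first by rewrite !mul0r !addr0.
  have E (x : int) : x + k.+1%:Z * L%:Z = x + k%:Z * L%:Z + L%:Z by lia.
  by rewrite !E fL IH.
case=> k h; first exact: up.
have := up k.+1 (h + Negz k * L%:Z); rewrite NegzE.
have -> : h + - k.+1%:Z * L%:Z + k.+1%:Z * L%:Z = h by lia.
by move=> ->; lia.
Qed.

(** [theta g - g] is periodic. *)
Lemma theta_near : exists B : nat, forall g : int, `|theta g - g| <= B%:Z.
Proof.
have [B hB] := bounded_abs (fun g => theta g - g) L.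
exists B => g; have E := quo_proj l g.
have := shift_mul (theta_shift theta) (quo l g) (proj l g : nat)%:Z.
rewrite [X in theta X]addrC -E => ->.
have := hB (proj l g : nat)%:Z; have := ltn_ord (proj l g); move: E.
move: (quo l g * _) (theta _) => u v; move: (proj l g : nat) => p; unfold halfint in *.
by lia.
Qed.

Lemma theta_inverse : exists thi : int -> int, [/\ cancel theta thi, cancel thi theta &
  forall (k h : int), thi (h + k * L%:Z) = thi h + k * L%:Z].
Proof.
have [thi K1 K2] := theta_bij theta; exists thi; split=> // k h.
by rewrite -{1}(K2 h) -(shift_mul (theta_shift theta)) K1.
Qed.

Variables (sigma : 'I_L -> sign) (lam : halfint -> sign).
Hypothesis asy : asymptotics sigma lam.

(** On the class of j modulo L both sides are affine of slope 2 L in the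
quotient, and the constants agree for b j = theta^-1(j) + L c_lam(j). *)
Lemma theta_graded : exists d C, forall g : int,
  mdeg d (weight (theta_op sigma lam theta g)) = 2 * g + C.
Proof.
have [thi [K1 K2 sh]] := theta_inverse.
pose b (j : nat) : int := thi j%:Z + L%:Z * c_lam sigma lam (inord j).
exists (grading l b), (L%:Z - b 0%N - b l) => g; rewrite /= mdeg_wt //.
have := K1 g; rewrite {1}(quo_proj l (theta g)) addrC sh => E.
rewrite -[in RHS]E /b inord_val.
by ring.
Qed.

Lemma theta_shrinks : exists N0 : nat,
  (forall g : int, N0%:Z <= g -> shrinks (theta_op sigma lam theta g) = true) /\
  (forall g : int, g < - N0%:Z -> shrinks (theta_op sigma lam theta g) = false).
Proof.
have [B hB] := theta_near; have [N hN] := asy; exists (`|N| + B + 1)%N; split=> g hg /=.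
  have hN' : N < theta g by have := hB g; move: (theta g) => t; unfold halfint in *; lia.
  by have [/(_ hN') -> _] := hN (theta g); rewrite eqxx.
have hN' : theta g < - N by have := hB g; move: (theta g) => t; unfold halfint in *; lia.
by have [_ /(_ hN') ->] := hN (theta g); case: (sigma _).
Qed.
End Theta.

Section Shift.
Variables (l : nat) (p : mono l).

Lemma gen_series_shift (T : Type) (f : T -> mono l) m : gen_series (fun x => p + f x) m = gen_series f (m - p).
Proof.
rewrite /gen_series; apply: eq_fsbigl; apply/seteqP; split=> x /=; first by move=> <-; rewrite addrC addKr.
by move=> ->; rewrite addrC subrK.
Qed.

Lemma smul_shift (f g : series l) :
  smul (fun m => f (m - p)) g = (fun m => smul f g (m - p)).
Proof.
apply/funext => m; rewrite /smul.
rewrite (@reindex_fsbig _ _ _ _ _ (fun a : mono l => a + p) setT setT); last first.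
  split=> [//|a a' _ _ /addIr //|a _]; first by exists (a - p) => //; rewrite subrK.
by apply: eq_fsbigr => a _; rewrite addrK opprD addrA (addrAC m).
Qed.

Lemma tame_shift d (T : Type) (f : T -> mono l) : tame d f -> tame d (fun x => p + f x).
Proof.
move=> h N; apply: sub_finite_set (h (N - mdeg d p)) => x /=; rewrite mdegD; lia.
Qed.
End Shift.

Section Quotient.
Variables (l : nat) (sigma : 'I_l.+1 -> sign) (lam : halfint -> sign).
Hypothesis asy : asymptotics sigma lam.
Variable theta : Theta l.
Local Notation op := (theta_op sigma lam theta).
Local Notation p := (prefactor sigma lam theta).
Implicit Types (nu : young * young).

Lemma Z_gen_series nu : Z sigma lam theta nu = fun m => gen_series (@weight_of _ op nu) (m - p).
Proof.
apply/funext => m; rewrite -gen_series_shift (gen_series_wiso (dimers_are_sequences sigma lam theta nu)).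
rewrite gen_series_sig /Z; apply: (@reindex_fsbig _ _ _ {classic (set edge)} _ id).
by split=> // D /= h; exists D.
Qed.

(** The series [open_limit (column_op sigma lam) nu] does not involve
theta, which gives the theorem by taking theta and the identity. *)
Lemma quotient_theta nu : [/\ summable sigma lam theta nu, summable sigma lam theta vac &
  is_quotient (Z sigma lam theta nu) (Z sigma lam theta vac) (open_limit (column_op sigma lam) nu)].
Proof.
have [d [C deg]] := theta_graded theta asy; have [N0 [right left]] := theta_shrinks theta asy.
have [thi [K1 K2 _]] := theta_inverse theta.
have tameZ nu' : tame d (fun D : {D | dimer sigma lam theta nu' D} => dimer_weight sigma lam theta (sval D)).
  apply: tame_wiso (dimers_are_sequences sigma lam theta nu') _.
  exact: tame_shift (tame_weight deg right left nu').
have fin nu' : summable sigma lam theta nu'.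
  move=> m; apply: sub_finite_set (finite_image (fun D => sval D) (tameZ nu' (mdeg d m))) => D [dD <-].
  by exists (exist _ D dD) => //=; exact: lexx.
have lauZ nu' : laurent d (Z sigma lam theta nu').
  have := laurent_gen_series (tameZ nu'); rewrite -(gen_series_wiso (dimers_are_sequences sigma lam theta nu')).
  have -> // : gen_series (fun K => p + @weight_of _ op nu' K) = Z sigma lam theta nu'.
  by rewrite Z_gen_series; apply/funext => m; rewrite gen_series_shift.
split=> //; exists d; split=> //.
have [w0 lead] := vac_lead deg.
have [g' lg' inv] : exists2 g', laurent d g' & smul (Z sigma lam theta vac) g' = @sone l.
  apply: (@series_inverse _ _ _ p) => //; first by rewrite Z_gen_series subrr.
  move=> m; rewrite Z_gen_series => /lead; rewrite mdegB => -[E|]; last by right; lia.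
  by left; rewrite -(subrK p m) E add0r.
exists g'; split=> //; apply: (quotient_unique (d := d)) inv _ => //.
  exact: (laurent_limit K1 K2 deg right left).
by rewrite !Z_gen_series smul_shift (series_factor K1 K2 deg right left).
Qed.
End Quotient.
End Conclusion.

Theorem corollary4p13 (l : nat) (sigma : 'I_l.+1 -> sign) (lam : halfint -> sign)
  (lam_asymptotics : asymptotics sigma lam) (nu : young * young)
  (theta : Theta l) :
  let vac := (young0, young0) in
  [/\ summable sigma lam theta nu, summable sigma lam theta vac,
      summable sigma lam (theta_id l) nu, summable sigma lam (theta_id l) vac &
      exists r : series l,
        is_quotient (Z sigma lam theta nu) (Z sigma lam theta vac) r /\
        is_quotient (ZNCDT sigma lam nu) (ZNCDT sigma lam vac) r].
Proof.
have [s1 s2 q] := quotient_theta lam_asymptotics theta nu.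
have [s1' s2' q'] := quotient_theta lam_asymptotics (theta_id l) nu.
split; [exact: s1|exact: s2|exact: s1'|exact: s2'|].
by exists (open_limit (column_op sigma lam) nu); split; [exact: q|exact: q'].
Qed.
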